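(* Consider the closed-loop system described in the context. For $\hat\theta(0)\in\Theta_1$ (the set $\Theta$ under the initial-estimate selection rule stated in the context), and all $u[0]\in L^2(0,1)$, $\zeta(0)\in\mathbb R$ except for the case that both $u[0]$ and $\zeta(0)$ are zero, one has $$\hat\lambda(t)=\lambda,\qquad\hat a(t)=a\qquad\text{for all }t\ge t_2,$$ where $t_2$ is the second triggering time after $t_0=0$.
   Context: **Plant.** Scalar ODE state $\zeta(t)$, PDE state $u(x,t)$, $x\in[0,1]$, $t\ge 0$, $u[t]:=u(\cdot,t)$, $\|\cdot\|$ the $L^2(0,1)$ norm: $$\dot\zeta(t)=a\zeta(t)+b\,u(0,t),\quad u_t=\varepsilon u_{xx}+\lambda u,\quad u_x(0,t)=0,\quad u_x(1,t)+q\,u(1,t)=U_d(t).$$ $\varepsilon>0$, $b\ne 0$, $q$ are known; $\theta=[\lambda,a]^T$ is unknown with $\underline\lambda\le\lambda\le\overline\lambda$, $\underline a\le a\le\overline a$, where the bounds are known positive constants. $\Theta=\{\ell\in\mathbb R^2:\underline\lambda\le\ell_1\le\overline\lambda,\ \underline a\le\ell_2\le\overline a\}$. Assume $q>\frac14+\frac{\overline\lambda}{2\varepsilon}$. The ODE is understood in the integrated sense $\zeta(t)=\zeta(0)+\int_0^t(a\zeta+bu(0,\cdot))d\tau$; solutions satisfy $u\in C^0(\mathbb R_+;L^2(0,1))$, and $u$ is $C^1$ in $(t,x)$ with $u[t]\in C^2([0,1])$ at times $t>0$ other than the triggering times. **Gains.** Fix $\kappa$ with $b\kappa>\overline a$.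 For $\theta=[\lambda,a]^T\in\Theta$ let $a_{\rm m}=b\kappa-a$, $r=q-\frac{\lambda}{2\varepsilon}$, $\gamma(x)=-\kappa\cos\big(\sqrt{a_{\rm m}/\varepsilon}\,x\big)$, $\Psi(x,y)=-\frac{\lambda}{\varepsilon}x\,\frac{I_1(s)}{s}$ with $s=\sqrt{\lambda(x^2-y^2)/\varepsilon}$ ($I_1$ the modified Bessel function of the first kind; $I_1(s)/s:=1/2$ at $s=0$), and let $h(x,y)$, $0\le y\le x\le1$, be the (piecewise $C^2$) solution of $$\varepsilon h_y(x,0)+b\gamma(x)-b\int_0^xh(x,y)\gamma(y)dy=0,\quad h_{yy}=h_{xx},\quad h_y(x,x)+h_x(x,x)=0,\quad h(0,0)=0.$$ Define $$K_1(1,y;\theta)=\Psi_x(1,y)+h_x(1,y)+rh(1,y)+r\Psi(1,y)-\int_y^1(h_x(1,z)+rh(1,z))\Psi(z,y)dz,$$ $$K_2(1;\theta)=\gamma'(1)+r\gamma(1)-\int_0^1(h_x(1,y)+rh(1,y))\gamma(y)dy.$$ $K_1(1,y;\vartheta)$, $K_2(1;\vartheta)$ for $\vartheta\in\Theta$ denote the same expressions with $\theta$ replaced by $\vartheta$ everywhere. $K_{1y},K_{1yy}$ are derivatives in $y$. **Controller.** For $t\in[t_i,t_{i+1})$, $U_d(t)=\int_0^1K_1(1,y;\hat\theta(t_i))u(y,t_i)dy+K_2(1;\hat\theta(t_i))\zeta(t_i)$, and $\hat\theta(t)=\hat\theta(t_i)$. Let, for $t\in[t_i,t_{i+1})$,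 $$d(t)=\int_0^1K_1(1,y;\hat\theta(t_i))(u(y,t)-u(y,t_i))dy+K_2(1;\hat\theta(t_i))(\zeta(t)-\zeta(t_i)).$$ **Event-triggering mechanism.** $t_0=0$, $t_{i+1}=\min\{\inf\{t>t_i:d(t)^2\ge-\xi m(t)\},\,t_i+T\}$ for $i=0,1,2,\dots$, where $m$ is continuous, $m(0)<0$, and on each $(t_i,t_{i+1})$ $$\dot m=-\eta m+\lambda_dd^2-\kappa_1u(1,t)^2-\kappa_2u(0,t)^2-\kappa_3\|u[t]\|^2-\kappa_4\zeta(t)^2.$$ **Identifier.** Fix an integer $\tilde N\ge1$; $\mu_{i+1}=\min\{t_k:k\in\{0,\dots,i\},\ t_k\ge t_{i+1}-\tilde NT\}$. For $n\in\mathbb N=\{1,2,\dots\}$ let $$\begin{aligned}f_n(t,\mu)=&\int_0^1\sin(\pi nx)u(x,t)dx-\tfrac{\varepsilon\pi n}{b}\zeta(t)-\int_0^1\sin(\pi nx)u(x,\mu)dx+\tfrac{\varepsilon\pi n}{b}\zeta(\mu)\\&+\int_\mu^t\Big[\varepsilon\pi n(-1)^nu(1,\tau)+\varepsilon\pi^2n^2\int_0^1\sin(\pi nx)u(x,\tau)dx\Big]d\tau,\end{aligned}$$ $g_{n,1}(t,\mu)=\int_\mu^t\int_0^1\sin(\pi nx)u(x,\tau)dxd\tau$, $g_{n,2}(t,\mu)=-\frac{\varepsilon\pi n}{b}\int_\mu^t\zeta(\tau)d\tau$. With $\mu=\mu_{i+1}$ and integrals over $[\mu_{i+1},t_{i+1}]$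 in $t$: $H_{n,k}=\int g_{n,k}f_n\,dt$ ($k=1,2$), $Q_{n,1}=\int g_{n,1}^2dt$, $Q_{n,2}=\int g_{n,1}g_{n,2}dt$, $Q_{n,3}=\int g_{n,2}^2dt$, $Z_n=[H_{n,1},H_{n,2}]^T$, $G_n=\begin{bmatrix}Q_{n,1}&Q_{n,2}\\Q_{n,2}&Q_{n,3}\end{bmatrix}$. The update is $$\hat\theta(t_{i+1})=\operatorname{argmin}\{|\ell-\hat\theta(t_i)|^2:\ \ell\in\Theta,\ Z_n=G_n\ell\ \text{ for all }n\in\mathbb N\},\qquad\hat\theta=[\hat\lambda,\hat a]^T.$$ **Initial estimates: the set $\Theta_1$.** $\Theta_1$ is equal to $\Theta$ under the following selection rule: the user selects $\hat\theta(0)=[\hat\lambda(0),\hat a(0)]^T\in\Theta$; if $u[0]=0$, $\zeta(0)\neq0$, and $K_2(1;\hat\theta(0))=0$ is found under the user-selected initial estimate, then $\hat\lambda(0)$ is changed to another (arbitrary) value in $[\underline\lambda,\overline\lambda]$. **Design parameter conditions.** $\xi,\eta,\lambda_d,T>0$. Positive $\kappa_1,\dots,\kappa_4$ satisfy $\kappa_j\ge2\epsilon_{j+1}/\xi$, where, with all maxima over $\vartheta,\vartheta_1,\vartheta_2\in\Theta$ and $k_0=\max K_1(1,1;\vartheta)^2$, $$\epsilon_2=6\max(qK_1(1,1;\vartheta)\varepsilon+K_{1y}(1,1;\vartheta)\varepsilon)^2,\quad \epsilon_3=6\max(K_{1y}(1,0;\vartheta)\varepsilon+K_2(1;\vartheta)b)^2,$$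 $$\epsilon_4=12\max\int_0^1(K_{1yy}(1,y;\vartheta)\varepsilon+K_1(1,y;\vartheta)\lambda)^2dy+12\varepsilon^2k_0\max\int_0^1K_1(1,y;\vartheta)^2dy+12\varepsilon^2k_0\max\int_0^1(K_1(1,y;\vartheta_1)-K_1(1,y;\vartheta_2))^2dy,$$ $$\epsilon_5=12\overline a^2\max K_2(1;\vartheta)^2+12\varepsilon^2k_0\max K_2(1;\vartheta)^2+12\varepsilon^2k_0\max(K_2(1;\vartheta_1)-K_2(1;\vartheta_2))^2.$$ *)

(* Defs.v *)
From HB Require Import structures.
From mathcomp Require Import all_boot all_order all_algebra.
From mathcomp Require Import all_classical all_reals all_analysis.

Set Implicit Arguments.
Unset Strict Implicit.
Unset Printing Implicit Defensive.

Import Order.TTheory GRing.Theory Num.Theory.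
Import numFieldNormedType.Exports.
Local Open Scope classical_set_scope.
Local Open Scope ring_scope.

Section Calculus.
Context {R : realType}.
Implicit Types (A : set R) (f : R -> R) (g : R -> R -> R).

(* Derivatives relative to [A], so one-sided at the end points of an interval;
   [deriv_on] is meaningful only where the limit exists. *)
Definition is_deriv_on A f (x l : R) : Prop :=
  (f y - f x) / (y - x) @[y --> within A x^'] --> l.

Definition deriv_on A f (x : R) : R :=
  lim ((f y - f x) / (y - x) @[y --> within A x^']).

Definition d1 g : R -> R -> R := fun x y => derive1 (g ^~ y) x.
Definition d2 g : R -> R -> R := fun x y => derive1 (g x) y.

Definition C1_plane g : Prop :=
  [/\ forall x y : R, derivable (g ^~ y) x 1 /\ derivable (g x) y 1,
      continuous (fun z : R * R => d1 g z.1 z.2) &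
      continuous (fun z : R * R => d2 g z.1 z.2)].

Definition C2_plane g : Prop :=
  [/\ C1_plane g, C1_plane (d1 g) & C1_plane (d2 g)].

(* Membership in L^2(0,1); values of f outside [0,1] are irrelevant. *)
Definition in_L2 f : Prop :=
  measurable_fun (`[0, 1] : set R) f /\
  lebesgue_measure.-integrable `[0, 1] (fun x => (f x ^+ 2)%:E).

Definition L2norm f : R :=
  Num.sqrt (\int[lebesgue_measure]_(x in `[0, 1]) (f x ^+ 2)).

Definition L2_zero f : Prop :=
  {ae (@lebesgue_measure R), forall x : R, 0 <= x <= 1 -> f x = 0}.

Definition bessel_I1 (s : R) : R :=
  limn (series (fun k : nat =>
    (s / 2) ^+ (2 * k + 1) / (k`! * (k.+1)`!)%:R)).

Definition bessel_I1_ratio (s : R) : R :=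
  if s == 0 then 2^-1 else bessel_I1 s / s.

End Calculus.

(* [lambda] and [acoef] are the unknown plant parameters; [Ntilde] is the
   window length of the identifier and [Tmax] the upper bound T on the
   inter-event times. *)
Record sysdata (R : realType) := SysData {
  eps : R; bcoef : R; qcoef : R; lambda : R; acoef : R;
  lambda_lo : R; lambda_hi : R; a_lo : R; a_hi : R;
  kappa : R;
  xi : R; eta : R; lambda_d : R; Tmax : R;
  kappa1 : R; kappa2 : R; kappa3 : R; kappa4 : R;
  Ntilde : nat
}.

Section ClosedLoop.
Context {R : realType}.
Variable p : sysdata R.
Implicit Types (th l : 'cV[R]_2).

(* A parameter vector [th] stands for [lambda, a]^T. *)
Definition th_lambda th : R := th 0 0.
Definition th_a th : R := th 1 0.

Definition Theta : set 'cV[R]_2 :=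
  [set th | lambda_lo p <= th_lambda th <= lambda_hi p /\
            a_lo p <= th_a th <= a_hi p].

Definition plant_assumptions : Prop :=
  [/\ 0 < eps p, bcoef p != 0,
      [/\ 0 < lambda_lo p, 0 < lambda_hi p, 0 < a_lo p & 0 < a_hi p],
      lambda_lo p <= lambda p <= lambda_hi p /\
      a_lo p <= acoef p <= a_hi p &
      4^-1 + lambda_hi p / (2 * eps p) < qcoef p].

Definition a_m th : R := bcoef p * kappa p - th_a th.
Definition r_ th : R := qcoef p - th_lambda th / (2 * eps p).

Definition gamma th (x : R) : R :=
  - kappa p * cos (Num.sqrt (a_m th / eps p) * x).

Definition Psi th (x y : R) : R :=
  - (th_lambda th / eps p) * x *
  bessel_I1_ratio (Num.sqrt (th_lambda th * (x ^+ 2 - y ^+ 2) / eps p)).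

(* Psi lives on y <= x, so the derivative at x = y is one-sided. *)
Definition Psi_x th (x y : R) : R := deriv_on `[y, +oo[ (Psi th ^~ y) x.

(* The four equations have exactly one solution on the triangle, namely
   h(x,y) = - b kappa / sqrt (a eps) * sinh (sqrt (a / eps) * (x - y)),
   which is smooth; [h] is taken as a C^2 function on the plane so that its
   partial derivatives on the boundary of the triangle are the usual ones. *)
Definition is_kernel_h th (h : R -> R -> R) : Prop :=
  [/\ C2_plane h,
      forall x : R, 0 <= x <= 1 ->
        eps p * d2 h x 0 + bcoef p * gamma th x
        - bcoef p * \int[lebesgue_measure]_(y in `[0, x]) (h x y * gamma th y)
        = 0,
      forall x y : R, 0 <= y -> y <= x -> x <= 1 -> d2 (d2 h) x y = d1 (d1 h) x y,
      forall x : R, 0 <= x <= 1 -> d2 h x x + d1 h x x = 0 &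
      h 0 0 = 0].

(* [h th] is the kernel h built with the parameter value [th]. *)
Variable h : 'cV[R]_2 -> R -> R -> R.

Definition gain_assumptions : Prop :=
  a_hi p < bcoef p * kappa p /\ forall th, Theta th -> is_kernel_h th (h th).

(* K1 th y is K_1(1,y;th) and K2 th is K_2(1;th). *)
Definition K1 th (y : R) : R :=
  Psi_x th 1 y + d1 (h th) 1 y + r_ th * h th 1 y + r_ th * Psi th 1 y
  - \int[lebesgue_measure]_(z in `[y, 1])
      ((d1 (h th) 1 z + r_ th * h th 1 z) * Psi th z y).

Definition K2 th : R :=
  derive1 (gamma th) 1 + r_ th * gamma th 1
  - \int[lebesgue_measure]_(y in `[0, 1])
      ((d1 (h th) 1 y + r_ th * h th 1 y) * gamma th y).

Definition K1y th : R -> R := deriv_on `[0, 1] (K1 th).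
Definition K1yy th : R -> R := deriv_on `[0, 1] (K1y th).

(* Maxima over the compact set Theta are written as suprema; the functions
   of the parameter to which this is applied below are continuous. *)
Definition maxTheta (F : 'cV[R]_2 -> R) : R := sup [set F th | th in Theta].
Definition maxTheta2 (F : 'cV[R]_2 -> 'cV[R]_2 -> R) : R :=
  sup [set F th1 th2 | th1 in Theta & th2 in Theta].

Definition k0 : R := maxTheta (fun th => K1 th 1 ^+ 2).

Definition eps2 : R :=
  6 * maxTheta (fun th => (qcoef p * K1 th 1 * eps p + K1y th 1 * eps p) ^+ 2).

Definition eps3 : R :=
  6 * maxTheta (fun th => (K1y th 0 * eps p + K2 th * bcoef p) ^+ 2).

Definition eps4 : R :=
  12 * maxTheta (fun th => \int[lebesgue_measure]_(y in `[0, 1])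
         ((K1yy th y * eps p + K1 th y * lambda p) ^+ 2))
  + 12 * eps p ^+ 2 * k0 *
    maxTheta (fun th => \int[lebesgue_measure]_(y in `[0, 1]) (K1 th y ^+ 2))
  + 12 * eps p ^+ 2 * k0 *
    maxTheta2 (fun th1 th2 => \int[lebesgue_measure]_(y in `[0, 1])
                                ((K1 th1 y - K1 th2 y) ^+ 2)).

Definition eps5 : R :=
  12 * a_hi p ^+ 2 * maxTheta (fun th => K2 th ^+ 2)
  + 12 * eps p ^+ 2 * k0 * maxTheta (fun th => K2 th ^+ 2)
  + 12 * eps p ^+ 2 * k0 * maxTheta2 (fun th1 th2 => (K2 th1 - K2 th2) ^+ 2).

Definition design_conditions : Prop :=
  [/\ [/\ 0 < xi p, 0 < eta p, 0 < lambda_d p & 0 < Tmax p],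
      (1 <= Ntilde p)%N,
      [/\ 0 < kappa1 p, 0 < kappa2 p, 0 < kappa3 p & 0 < kappa4 p] &
      [/\ 2 * eps2 / xi p <= kappa1 p, 2 * eps3 / xi p <= kappa2 p,
          2 * eps4 / xi p <= kappa3 p & 2 * eps5 / xi p <= kappa4 p]].

(* [u x t] is u(x,t); [tk i] is the triggering time t_i; [m] is the internal
   variable of the event trigger; [that t] is the estimate at time t. *)
Variables (u : R -> R -> R) (zeta m : R -> R) (tk : nat -> R)
          (that : R -> 'cV[R]_2).

Definition feedback (i : nat) (w : R -> R) (z : R) : R :=
  \int[lebesgue_measure]_(y in `[0, 1]) (K1 (that (tk i)) y * w y)
  + K2 (that (tk i)) * z.

(* The value of U_d on [t_i, t_{i+1}). *)
Definition Ud (i : nat) : R := feedback i (u ^~ (tk i)) (zeta (tk i)).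

(* d(t), with the data held since t_i. *)
Definition dev (i : nat) (t : R) : R :=
  feedback i (fun y => u y t - u y (tk i)) (zeta t - zeta (tk i)).

Definition inter_event (t : R) : Prop := exists i, tk i < t < tk i.+1.

Definition ode_solution : Prop :=
  forall t : R, 0 <= t ->
    lebesgue_measure.-integrable `[0, t]
      (fun s => (acoef p * zeta s + bcoef p * u 0 s)%:E) /\
    zeta t = zeta 0 + \int[lebesgue_measure]_(s in `[0, t])
                        (acoef p * zeta s + bcoef p * u 0 s).

Definition L2_continuous : Prop :=
  (forall t : R, 0 <= t -> in_L2 (u ^~ t)) /\
  (forall s : R, 0 <= s ->
     L2norm (fun x => u x t - u x s) @[t --> within `[0, +oo[ (nbhs s)]
       --> (0 : R)).

Definition pde_solution : Prop :=
  exists ut ux uxx : R -> R -> R,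
  [/\ {within [set z : R * R | 0 <= z.1 <= 1 /\ inter_event z.2],
         continuous (fun z => ut z.1 z.2)},
      {within [set z : R * R | 0 <= z.1 <= 1 /\ inter_event z.2],
         continuous (fun z => ux z.1 z.2)} &
      forall (i : nat) (t : R), tk i < t < tk i.+1 ->
      [/\ forall x : R, 0 <= x <= 1 ->
            [/\ is_derive t (1 : R) (u x) (ut x t),
                is_deriv_on `[0, 1] (u ^~ t) x (ux x t) &
                is_deriv_on `[0, 1] (ux ^~ t) x (uxx x t)],
          {within `[0, 1], continuous (uxx ^~ t)},
          forall x : R, 0 <= x <= 1 -> ut x t = eps p * uxx x t + lambda p * u x t,
          ux 0 t = 0 &
          ux 1 t + qcoef p * u 1 t = Ud i]].

Definition trigger_rule : Prop :=
  [/\ tk 0%N = 0,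
      forall i, (tk i.+1)%:E =
        Order.min
          (ereal_inf [set s%:E | s in
             [set s | tk i < s /\ - xi p * m s <= dev i s ^+ 2]])
          (tk i + Tmax p)%:E,
      {within `[0, +oo[, continuous m},
      m 0 < 0 &
      forall (i : nat) (t : R), tk i < t < tk i.+1 ->
        is_derive t (1 : R) m
          (- eta p * m t + lambda_d p * dev i t ^+ 2
           - kappa1 p * u 1 t ^+ 2 - kappa2 p * u 0 t ^+ 2
           - kappa3 p * L2norm (u ^~ t) ^+ 2 - kappa4 p * zeta t ^+ 2)].

(* [mu_next i] is mu_{i+1}; the default value t_i of the iterated minimum is
   itself an admissible t_k, because t_{i+1} <= t_i + T. *)
Definition mu_next (i : nat) : R :=
  \big[Order.min/tk i]_(k < i.+1 | tk i.+1 - (Ntilde p)%:R * Tmax p <= tk k)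
     tk k.

Definition sin_coef (n : nat) (t : R) : R :=
  \int[lebesgue_measure]_(x in `[0, 1]) (sin (pi * n%:R * x) * u x t).

Definition f_ (n : nat) (t mu : R) : R :=
  sin_coef n t - eps p * pi * n%:R / bcoef p * zeta t
  - sin_coef n mu + eps p * pi * n%:R / bcoef p * zeta mu
  + \int[lebesgue_measure]_(s in `[mu, t])
      (eps p * pi * n%:R * (-1) ^+ n * u 1 s
       + eps p * pi ^+ 2 * n%:R ^+ 2 * sin_coef n s).

Definition g1_ (n : nat) (t mu : R) : R :=
  \int[lebesgue_measure]_(s in `[mu, t]) sin_coef n s.

Definition g2_ (n : nat) (t mu : R) : R :=
  - (eps p * pi * n%:R / bcoef p)
  * \int[lebesgue_measure]_(s in `[mu, t]) zeta s.

Definition window_int (i : nat) (F G : R -> R -> R) : R :=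
  \int[lebesgue_measure]_(t in `[mu_next i, tk i.+1])
    (F t (mu_next i) * G t (mu_next i)).

Definition Z_ (i n : nat) : 'cV[R]_2 :=
  \col_(j < 2) [:: window_int i (g1_ n) (f_ n);
                   window_int i (g2_ n) (f_ n)]`_j.

Definition G_ (i n : nat) : 'M[R]_2 :=
  let Q1 := window_int i (g1_ n) (g1_ n) in
  let Q2 := window_int i (g1_ n) (g2_ n) in
  let Q3 := window_int i (g2_ n) (g2_ n) in
  \matrix_(j < 2, k < 2) [:: [:: Q1; Q2]`_k; [:: Q2; Q3]`_k]`_j.

Definition feasible (i : nat) : set 'cV[R]_2 :=
  [set l | Theta l /\ forall n : nat, (1 <= n)%N -> Z_ i n = G_ i n *m l].

Definition sqdist l th : R := \sum_(j < 2) (l j 0 - th j 0) ^+ 2.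

Definition identifier : Prop :=
  (forall (i : nat) (t : R), tk i <= t < tk i.+1 -> that t = that (tk i)) /\
  (forall i, feasible i (that (tk i.+1)) /\
     forall l, feasible i l ->
       sqdist (that (tk i.+1)) (that (tk i)) <= sqdist l (that (tk i))).

Definition closed_loop : Prop :=
  [/\ ode_solution, L2_continuous, pde_solution, trigger_rule & identifier].

(* The estimates the selection rule can return; [th] is the user's choice. *)
Definition Theta1 : set 'cV[R]_2 :=
  [set th0 | exists th, Theta th /\
     let degenerate := [/\ L2_zero (u ^~ 0), zeta 0 <> 0 & K2 th = 0] in
     (~ degenerate -> th0 = th) /\
     (degenerate ->
        [/\ th_lambda th0 <> th_lambda th,
            lambda_lo p <= th_lambda th0 <= lambda_hi p &
            th_a th0 = th_a th])].

End ClosedLoop.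

(* Main.v *)
(* Multiplying the heat equation by [sin (pi n x)] and integrating gives
   [f_n = lambda g_(n,1) + a g_(n,2)] along every solution, so the true
   parameter is always feasible, and once the estimate is exact it stays exact
   by minimality of the distance.  If another parameter were feasible after the
   first event, then [d1 s_n(t) = d2 (eps pi n / b) zeta(t)] for all [n] on
   (0, t_1), where [s_n] is the n-th sine coefficient of [u[t]] and (d1, d2) is
   the nonzero difference of the two parameters.  If [d2 <> 0], letting [n] tend
   to infinity gives [zeta = 0], hence [u(0, t) = 0] by the ODE; if [d2 = 0], all
   [s_n] vanish, and comparing their derivatives for [n = 1] and [n = 2] gives
   [u(0, t) = 0] again.  Together with [u_x(0, t) = 0] this forces [u = 0] by
   unique continuation, hence [u[0] = 0], [zeta(0) <> 0] and [K2 = 0] at the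
   initial estimate.  The selection rule excludes this: the kernel is
   [h(x, y) = S(x - y)] with [S] explicit, so [K2] is affine in [lambda] with
   nonzero slope and has at most one zero.  Finally, the estimate is constant
   from [t_1] on and the dynamics of [m] keeps it away from zero on bounded time
   intervals, so the triggering times cannot accumulate. *)

Require Import Defs.
From HB Require Import structures.
From mathcomp Require Import all_boot all_order all_algebra.
From mathcomp Require Import all_classical all_reals all_analysis.
From mathcomp Require Import ring lra measurable_realfun.

Set Implicit Arguments.
Unset Strict Implicit.
Unset Printing Implicit Defensive.

Import Order.TTheory GRing.Theory Num.Theory.
Import numFieldNormedType.Exports.
Local Open Scope classical_set_scope.
Local Open Scope ring_scope.

(** * Integrals over compact intervals *)

(** Gaps in the available regularity shape the proof. The regression contains the time integral of
    [u 1], yet nothing is assumed about this trace as t approaches a triggering time. Its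
    integrability is extracted from the trigger: between events m' <= - c m - kappa1 u(1, t)^2 with
    c = eta + lambda_d xi, so the variation of the bounded function m pays for the square of the
    trace. The trace [u 0] inherits integrability from the integrated ODE. The gain [K1] is only
    shown to be bounded, and the feedback is estimated from pointwise bounds through
    [Rintegral_dominated]. The time t = 0 lies outside the domain of the classical solution and is
    reached by continuity in L^2. Unique continuation rests on the means of u against exp (- j x).
    They solve linear ODEs with growth rate eps j^2 + lambda, so running these backwards from a
    later time makes the means small. Decay along the integers j yields u = 0 by means of the double
    exponential exp (- exp (n (c - x))), which tends to a step at c. *)

Section real_integrals.
Context {R : realType}.
Notation mu := (@lebesgue_measure R).
Implicit Types (A D : set R) (f g : R -> R).

Lemma within_continuousP A f : {within A, continuous f} <->
  forall x, A x -> forall e : R, 0 < e -> exists2 d : R, 0 < d &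
    forall y, A y -> `|y - x| < d -> `|f y - f x| < e.
Proof.
rewrite subspace_continuousP; split.
  move=> cf x Ax e e0.
  have /cvgrPdist_lt/(_ e e0) := cf x Ax.
  rewrite near_withinE => /nbhs_ballP[d /= d0 H]; exists d => // y Ay yx.
  by rewrite distrC; apply: H => //; rewrite /ball/= distrC.
move=> H x Ax; apply/cvgrPdist_lt => e e0.
rewrite near_withinE; have [d d0 Hd] := H x Ax e e0.
apply/nbhs_ballP; exists d => //= y; rewrite /ball/= distrC => yx Ay.
by rewrite distrC; exact: Hd.
Qed.

Lemma continuous_at_within A f (x : R) : (exists2 d, 0 < d & forall y, `|y - x| < d -> A y) ->
  {within A, continuous f} -> {for x, continuous f}.
Proof.
move=> [d d0 dA] /within_continuousP cf; apply/cvgrPdist_lt => e e0.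
have Ax : A x by apply: dA; rewrite subrr normr0.
have [d' d'0 H] := cf x Ax e e0.
apply/nbhs_ballP; exists (Num.min d d') => /=; first by rewrite lt_min d0.
move=> y; rewrite /ball/= distrC lt_min => /andP[yd yd'].
by rewrite distrC; apply: H => //; exact: dA.
Qed.

Lemma integrable_rD (a b : R) f g : mu.-integrable `[a, b] (EFin \o f) ->
  mu.-integrable `[a, b] (EFin \o g) ->
  mu.-integrable `[a, b] (EFin \o (fun x => f x + g x)).
Proof. by move=> fi gi; apply: (integrableD _ fi gi). Qed.

Lemma integrable_rB (a b : R) f g : mu.-integrable `[a, b] (EFin \o f) ->
  mu.-integrable `[a, b] (EFin \o g) ->
  mu.-integrable `[a, b] (EFin \o (fun x => f x - g x)).
Proof. by move=> fi gi; apply: (integrableB _ fi gi). Qed.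

Lemma integrable_rZ (a b k : R) f : mu.-integrable `[a, b] (EFin \o f) ->
  mu.-integrable `[a, b] (EFin \o (fun x => k * f x)).
Proof. by move=> fi; apply: (integrableZl _ k fi). Qed.

Lemma integrable_rnorm (a b : R) f : mu.-integrable `[a, b] (EFin \o f) ->
  mu.-integrable `[a, b] (EFin \o (fun x => `|f x|)).
Proof. exact: integrable_norm. Qed.

Lemma integrable_dom (a b : R) f g : measurable_fun (`[a, b] : set R) f ->
  (forall x, a <= x <= b -> `|f x| <= g x) -> mu.-integrable `[a, b] (EFin \o g) ->
  mu.-integrable `[a, b] (EFin \o f).
Proof.
move=> mf fg; apply: le_integrable => //; first exact/measurable_EFinP.
move=> x /= Dx; rewrite lee_fin; move: Dx; rewrite in_itv/= => /fg /le_trans -> //.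
exact: ler_norm.
Qed.

Lemma integrable_itv (a b : R) f : {within `[a, b], continuous f} ->
  mu.-integrable `[a, b] (EFin \o f).
Proof. by move=> cf; apply: continuous_compact_integrable => //; exact: segment_compact. Qed.

(* No measurability of [f] is required: the integral of a non-measurable
   function is still a difference of lower integrals. *)
Lemma Rintegral_dominated (a b : R) f g : mu.-integrable `[a, b] (EFin \o g) ->
  (forall x, a <= x <= b -> `|f x| <= g x) ->
  `|\int[mu]_(x in `[a, b]) f x| <= \int[mu]_(x in `[a, b]) g x.
Proof.
set D : set R := `[a, b]%classic; move=> ig fg'.
have fg x : D x -> `|f x| <= g x by rewrite /D/= in_itv/=; exact: fg'.
have g0 x : D x -> 0 <= g x by move=> Dx; rewrite (le_trans _ (fg x Dx)).
have lower (k : R -> \bar R) : (forall x, (0 <= k x)%E) ->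
    (forall x, D x -> (k x <= (g x)%:E)%E) ->
    (0 <= \int[mu]_(x in D) k x <= \int[mu]_(x in D) (g x)%:E)%E.
  move=> k0 kg; rewrite integral_ge0//=.
  rewrite !ge0_integralE//.
  apply: le_ereal_sup => _ /= [h hk <-].
  exists h => // x; apply: (le_trans (hk x)).
  rewrite /patch; case: ifPn => // xD; apply: kg; exact/set_mem.
have gfin : (\int[mu]_(x in D) (g x)%:E)%E \is a fin_num by apply: (integrable_fin_num _ ig); rewrite /D.
have hp := lower ((EFin \o f)^\+)%E (fun x => funepos_ge0 _ _).
have hn := lower ((EFin \o f)^\-)%E (fun x => funeneg_ge0 _ _).
have /andP[p0 pg] : (0 <= \int[mu]_(x in D) (EFin \o f)^\+ x <= \int[mu]_(x in D) (g x)%:E)%E.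
  apply: hp => x Dx; rewrite funeposE/= ge_max lee_fin (le_trans (ler_norm _) (fg x Dx))/=.
  by rewrite lee_fin g0.
have /andP[n0 ng] : (0 <= \int[mu]_(x in D) (EFin \o f)^\- x <= \int[mu]_(x in D) (g x)%:E)%E.
  apply: hn => x Dx; rewrite funenegE/= ge_max lee_fin.
  have := fg x Dx; rewrite ler_norml lee_fin g0// andbT => /andP[+ _]; lra.
rewrite /Rintegral integralE.
have pfin : (\int[mu]_(x in D) (EFin \o f)^\+ x)%E \is a fin_num.
  rewrite ge0_fin_numE// (le_lt_trans pg)// ltey_eq gfin//.
have nfin : (\int[mu]_(x in D) (EFin \o f)^\- x)%E \is a fin_num.
  rewrite ge0_fin_numE// (le_lt_trans ng)// ltey_eq gfin//.
rewrite fineB//.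
move: p0 pg n0 ng; rewrite -(fineK pfin) -(fineK nfin) -(fineK gfin) !lee_fin /=.
move=> p0 pg n0 ng; rewrite ler_norml; apply/andP; split; lra.
Qed.


Lemma FTC2_within (a b : R) f F : a <= b ->
  {within `[a, b], continuous f} -> {within `[a, b], continuous F} ->
  (forall x, a < x < b -> is_derive x (1 : R) F (f x)) ->
  \int[mu]_(x in `[a, b]) f x = F b - F a.
Proof.
rewrite le_eqVlt => /predU1P[->|ab] cf cF dF.
  by rewrite set_itv1 Rintegral_set1 subrr.
rewrite /Rintegral (@continuous_FTC2 _ f F a b ab cf) //.
  have /(continuous_within_itvP _ ab)[_ ca cb] := cF.
  split => // x; rewrite in_itv/= => xab.
  by have [] := dF x xab.
by move=> x; rewrite in_itv/= => xab; rewrite derive1E; have [_ ->] := dF x xab.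
Qed.

Lemma is_derive_Rintegral (a b x : R) f : a < x < b ->
  mu.-integrable `[a, b] (EFin \o f) -> {for x, continuous f} ->
  is_derive x (1 : R) (fun t => \int[mu]_(s in `[a, t]) f s) (f x).
Proof.
move=> /andP[ax xb] intf cf.
have [dF FE] := continuous_FTC1_closed xb intf ax cf.
by have := @derivableP _ _ _ _ _ _ dF; rewrite -derive1E FE.
Qed.

Lemma Rintegral_cat (a b c : R) f : a <= b -> b <= c ->
  mu.-integrable `[a, c] (EFin \o f) ->
  \int[mu]_(x in `[a, c]) f x =
  \int[mu]_(x in `[a, b]) f x + \int[mu]_(x in `[b, c]) f x.
Proof.
move=> ab bc intf.
have := Rintegral_itvB (x := b) intf; rewrite !bnd_simp => /(_ ab bc) H.
rewrite -(Rintegral_itv_obnd_cbnd (r := b)) -?H; first by rewrite addrC subrK.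
apply: integrableS intf => //; apply: subset_itvScc; rewrite ?bnd_simp//.
Qed.

Lemma le_of_derive_le0 (a b : R) f (df : R -> R) : a <= b ->
  {within `[a, b], continuous f} ->
  (forall x, a < x < b -> is_derive x (1 : R) f (df x)) ->
  (forall x, a < x < b -> df x <= 0) -> f b <= f a.
Proof.
rewrite le_eqVlt => /predU1P[->//|ab] cf dF df0.
have dF' x : x \in `]a, b[ -> is_derive x (1 : R) f (df x) by rewrite in_itv/=; exact: dF.
have [c] := @MVT _ f df a b ab dF' cf.
rewrite in_itv/= => cab H; rewrite -subr_le0 H mulr_le0_ge0 ?df0//.
by rewrite subr_ge0 ltW.
Qed.

Lemma eq_of_derive0 (a b : R) f : a <= b -> {within `[a, b], continuous f} ->
  (forall x, a < x < b -> is_derive x (1 : R) f 0) -> f b = f a.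
Proof.
rewrite le_eqVlt => /predU1P[->//|ab] cf dF.
have dF' x : x \in `]a, b[ -> is_derive x (1 : R) f ((cst 0) x) by rewrite in_itv/=; exact: dF.
have [c] := @MVT _ f (cst 0) a b ab dF' cf.
by rewrite mul0r => _ /eqP; rewrite subr_eq0 => /eqP.
Qed.

(** All partial integrals from a are squeezed to 0, and the integrand is their derivative at
    interior points. *)
Lemma ge0_continuous_Rintegral_eq0 (a b : R) f : {within `[a, b], continuous f} ->
  (forall x, a <= x <= b -> 0 <= f x) -> \int[mu]_(x in `[a, b]) f x = 0 ->
  forall x, a < x < b -> f x = 0.
Proof.
move=> cf f0 If0 x xab; have /andP[ax xb] := xab.
have intf := integrable_itv cf.
have sub c d : a <= c -> d <= b -> mu.-integrable `[c, d] (EFin \o f).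
  move=> ac db; apply: integrableS intf => //.
  by apply: subset_itvScc; rewrite bnd_simp.
have pos c d : a <= c -> d <= b -> 0 <= \int[mu]_(x in `[c, d]) f x.
  move=> ac db; apply: Rintegral_ge0 => y /=; rewrite in_itv/= => /andP[cy yd].
  by apply: f0; rewrite (le_trans ac cy) (le_trans yd db).
have zero t : a < t < b -> \int[mu]_(x in `[a, t]) f x = 0.
  move=> /andP[/ltW at_ /ltW tb].
  apply/eqP; rewrite eq_le pos// andbT -If0 (Rintegral_cat at_ tb intf).
  by rewrite lerDl pos.
have cx : {for x, continuous f}.
  apply: (continuous_at_within _ cf); exists (Num.min (x - a) (b - x)).
    by rewrite lt_min !subr_gt0 ax.
  by move=> y; rewrite lt_min !ltr_norml /= in_itv/= => /andP[/andP[? ?] /andP[? ?]]; apply/andP; split; lra.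
have [_ d1] := is_derive_Rintegral xab intf cx.
have [_ d2] : is_derive x (1 : R) (fun t => \int[mu]_(s in `[a, t]) f s) 0.
  apply: (near_eq_is_derive (f := cst 0)).
  near=> t; rewrite zero//.
  by apply/andP; split; near: t; [exact: lt_nbhsr|exact: lt_nbhsl].
by rewrite -d1 d2.
Unshelve. all: by end_near. Qed.

Lemma Rintegral_cst01 (k : R) : \int[mu]_(x in `[0, 1]) k = k.
Proof. by rewrite Rintegral_cst//= lebesgue_measure_itv/= lte_fin ltr01 sube0 mulr1. Qed.

Lemma integrable_cst (a b k : R) : mu.-integrable `[a, b] (EFin \o cst k).
Proof. by apply: integrable_itv => x; exact: cvg_cst. Qed.

Lemma in_L2_integrable f : in_L2 f -> mu.-integrable `[0, 1] (EFin \o f).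
Proof.
move=> [mf if2].
apply: (@integrable_dom _ _ _ (fun x => 1 + f x ^+ 2)) => //.
- move=> x _; rewrite -[f x ^+ 2]real_normK ?num_real//.
  have := sqr_ge0 (`|f x| - 1); have := normr_ge0 (f x); nra.
- by apply: integrable_rD => //; exact: (integrable_cst 0 1 1).
Qed.

Lemma in_L2B f g : in_L2 f -> in_L2 g -> in_L2 (fun x => f x - g x).
Proof.
move=> [mf if2] [mg ig2]; split; first exact: measurable_funB.
apply: (@integrable_dom _ _ _ (fun x => 2 * f x ^+ 2 + 2 * g x ^+ 2)) => //.
- by apply: measurable_funX; exact: measurable_funB.
- by move=> x _; rewrite ger0_norm ?sqr_ge0//; have := sqr_ge0 (f x + g x); nra.
- by apply: integrable_rD; exact: integrable_rZ.
Qed.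

(** Cauchy-Schwarz against 1, obtained by integrating |f| <= r / 2 + f^2 / (2 r). The optimal r is
    the norm itself; if the norm is 0, let r tend to 0. *)
Lemma L1_le_L2norm f : in_L2 f -> \int[mu]_(x in `[0, 1]) `|f x| <= L2norm f.
Proof.
move=> f2; have [mf if2] := f2; have iff := in_L2_integrable f2.
have n0 : 0 <= L2norm f by exact: sqrtr_ge0.
have nE : L2norm f ^+ 2 = \int[mu]_(x in `[0, 1]) (f x ^+ 2).
  by rewrite /L2norm sqr_sqrtr//; apply: Rintegral_ge0 => x _; exact: sqr_ge0.
have young (r : R) : 0 < r ->
    \int[mu]_(x in `[0, 1]) `|f x| <= r / 2 + (2 * r)^-1 * L2norm f ^+ 2.
  move=> r0; rewrite nE -[r / 2]Rintegral_cst01 -RintegralZl// -RintegralD//; last 2 first.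
  - exact: (integrable_cst 0 1 (r / 2)).
  - exact: integrable_rZ.
  apply: le_Rintegral => //.
  - exact: integrable_norm.
  - apply: integrable_rD; first exact: (integrable_cst 0 1 (r / 2)).
    exact: integrable_rZ.
  - move=> x _; rewrite -[f x ^+ 2]real_normK ?num_real//.
    have := sqr_ge0 (`|f x| - r) => H.
    have -> : r / 2 + (2 * r)^-1 * `|f x| ^+ 2 =
      `|f x| + (2 * r)^-1 * (`|f x| - r) ^+ 2 by field; rewrite gt_eqF.
    by rewrite lerDl mulr_ge0// invr_ge0; nra.
have [n_0|nn0] := eqVneq (L2norm f) 0.
  rewrite n_0; apply/ler_addgt0Pl => e e0; have := young e e0.
  by rewrite n_0 expr0n/= mulr0 !addr0 => /le_trans; apply; lra.
have np : 0 < L2norm f by rewrite lt_def nn0.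
have := young _ np.
suff -> : L2norm f / 2 + (2 * L2norm f)^-1 * L2norm f ^+ 2 = L2norm f by [].
by field.
Qed.

Lemma L2_zero_L1 f : in_L2 f -> L2_zero f -> \int[mu]_(x in `[0, 1]) `|f x| = 0.
Proof.
move=> f2 f0; have iff := in_L2_integrable f2.
rewrite /Rintegral.
have /ae_eq_integral_abs : ae_eq mu `[0, 1]%classic (EFin \o f) (cst 0)%E.
  case: f0 => N [mN N0 sub]; exists N; split => //.
  apply: subset_trans sub => x /= nH H; apply: nH => /=.
  by rewrite in_itv/= => /H ->.
have /integrableP[mf _] := iff.
by move=> /(_ (measurable_itv _) mf) /= ->.
Qed.

Lemma L2norm0_zero f : in_L2 f -> L2norm f = 0 -> L2_zero f.
Proof.
move=> f2 n0; have iff := in_L2_integrable f2.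
have I0 : \int[mu]_(x in `[0, 1]) `|f x| = 0.
  have := L1_le_L2norm f2; rewrite n0 => le0; apply/eqP; rewrite eq_le le0/=.
  by apply: Rintegral_ge0 => x _.
have /integrableP[mf _] := iff.
have /(ae_eq_integral_abs _ _ mf) : (\int[mu]_(x in (`[0%R, 1%R] : set R)) `|(EFin \o f) x|)%E = 0%E.
  rewrite -[LHS]fineK; last first.
    by apply: (integrable_fin_num _ (integrable_norm iff)).
  by move: I0; rewrite /Rintegral/= => ->.
move=> /(_ (measurable_itv _)) [N [mN N0 sub]]; exists N; split => //.
apply: subset_trans sub => x /= nH H; apply: nH => /= x01.
by have := H; rewrite /= in_itv/= => /(_ x01) [].
Qed.

End real_integrals.

(** * One-sided derivatives, Green's formula and differentiation under the integral sign *)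

Section one_sided_derivatives.
Context {R : realType}.
Notation mu := (@lebesgue_measure R).
Implicit Types (A D : set R) (f g : R -> R).

Lemma is_deriv_on_dist A f (x l : R) : is_deriv_on A f x l ->
  forall e : R, 0 < e -> exists2 d : R, 0 < d &
    forall y, A y -> y != x -> `|y - x| < d -> `|(f y - f x) / (y - x) - l| < e.
Proof.
move=> H e e0; have /cvgrPdist_lt/(_ e e0) := H.
rewrite near_withinE near_withinE => /nbhs_ballP[d /= d0 Hd]; exists d => // y Ay yx yd.
by rewrite distrC; apply: Hd => //; rewrite /ball/= distrC.
Qed.

Lemma is_derive_dist f (x l : R) :
  (forall e : R, 0 < e -> exists2 d : R, 0 < d &
    forall y, y != x -> `|y - x| < d -> `|(f y - f x) / (y - x) - l| < e) ->
  is_derive x (1 : R) f l.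
Proof.
move=> H.
have C : h^-1 *: ((f \o shift x) (h *: (1 : R)) - f x) @[h --> (0 : R)^'] --> l.
  apply/cvgrPdist_lt => e e0; have [d d0 Hd] := H e e0.
  rewrite near_withinE; apply/nbhs_ballP; exists d => //= h; rewrite /ball/= sub0r normrN => hd h0.
  have := Hd (h + x); rewrite addrK -subr_eq0 addrK h0 => /(_ isT hd).
  by rewrite distrC [h%:A]mulr1 [h^-1 *: _]mulrC.
by apply: DeriveDef; [exact: cvgP C|exact/cvg_lim].
Qed.

Lemma is_deriv_on_interior (x l : R) f : 0 < x < 1 -> is_deriv_on `[0, 1] f x l ->
  is_derive x (1 : R) f l.
Proof.
move=> /andP[x0 x1] H; apply: is_derive_dist => e e0.
have [d d0 Hd] := is_deriv_on_dist H e0.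
exists (Num.min d (Num.min x (1 - x))); first by rewrite !lt_min d0 x0 subr_gt0.
move=> y yx; rewrite !lt_min => /andP[yd /andP[]].
rewrite ltr_norml => /andP[? _]; rewrite ltr_norml => /andP[_ ?].
apply: Hd => //=.
by rewrite in_itv/=; apply/andP; split; lra.
Qed.

Lemma is_deriv_on_continuous f (l : R -> R) A :
  (forall x, A x -> is_deriv_on A f x (l x)) -> {within A, continuous f}.
Proof.
move=> H; apply/within_continuousP => x Ax e e0.
have [d d0 Hd] := is_deriv_on_dist (H x Ax) ltr01.
have c0 : 0 < `|l x| + 1 by rewrite ltr_wpDl.
exists (Num.min d (e / (`|l x| + 1))); first by rewrite lt_min d0 divr_gt0.
move=> y Ay; rewrite lt_min => /andP[yd ye].
have [->|yx] := eqVneq y x; first by rewrite subrr normr0.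
have yx0 : y - x != 0 by rewrite subr_eq0.
have Hq := Hd y Ay yx yd; rewrite -[f y - f x](divfK yx0) normrM.
have : `|(f y - f x) / (y - x)| <= `|l x| + 1.
  set q := (f y - f x) / (y - x) in Hq *.
  by rewrite -[q](subrK (l x)) (le_trans (ler_normD _ _))// addrC lerD2l ltW.
move=> qb; rewrite (le_lt_trans (ler_wpM2r (normr_ge0 _) qb))//.
by move: ye; rewrite ltr_pdivlMr// mulrC.
Qed.

Lemma is_deriv_on_unique A f (x l1 l2 : R) : ProperFilter (within A x^') ->
  is_deriv_on A f x l1 -> is_deriv_on A f x l2 -> l1 = l2.
Proof. by move=> PF h1 h2; rewrite -(cvg_lim (@norm_hausdorff _ R) h1); exact: cvg_lim. Qed.

Lemma is_derive_continuous f (x l : R) : is_derive x (1 : R) f l -> {for x, continuous f}.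
Proof. by move=> [/derivable1_diffP/differentiable_continuous]. Qed.

Lemma within_continuousM A f g : {within A, continuous f} -> {within A, continuous g} ->
  {within A, continuous (fun x => f x * g x)}.
Proof. by move=> cf cg x; apply: cvgM; [exact: cf|exact: cg]. Qed.

Lemma within_continuousD A f g : {within A, continuous f} -> {within A, continuous g} ->
  {within A, continuous (fun x => f x + g x)}.
Proof. by move=> cf cg x; apply: cvgD; [exact: cf|exact: cg]. Qed.

Lemma within_continuousN A f : {within A, continuous f} ->
  {within A, continuous (fun x => - f x)}.
Proof. by move=> cf x; apply: cvgN; exact: cf. Qed.

Lemma within_continuousB A f g : {within A, continuous f} -> {within A, continuous g} ->
  {within A, continuous (fun x => f x - g x)}.
Proof. by move=> cf cg x; apply: cvgB; [exact: cf|exact: cg]. Qed.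

Lemma within_continuous_cst A (k : R) : {within A, continuous (fun _ : R => k)}.
Proof. by move=> x; exact: cvg_cst. Qed.

Lemma within_continuous_comp A f g : {within A, continuous f} -> continuous g ->
  {within A, continuous (fun x => g (f x))}.
Proof. by move=> cf cg x; apply: (continuous_comp (cf x)); exact: cg. Qed.

Lemma continuous_within A f : (forall x, A x -> {for x, continuous f}) ->
  {within A, continuous f}.
Proof.
move=> cf; apply/within_continuousP => x Ax e e0.
have /cvgrPdist_lt/(_ e e0)/nbhs_ballP[d /= d0 Hd] := cf x Ax.
by exists d => // y _ yx; rewrite distrC; apply: Hd; rewrite /ball/= distrC.
Qed.

Lemma itv_bounded (a b : R) f : {within `[a, b], continuous f} ->
  exists2 M : R, 0 <= M & forall x, a <= x <= b -> `|f x| <= M.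
Proof.
move=> cf; have := continuous_compact cf (@segment_compact _ a b).
move=> /compact_bounded [M [Mr HM]]; exists (`|M| + 1); first by rewrite addr_ge0.
move=> x xab; apply: (HM (`|M| + 1)); first by rewrite ltr_pwDr// ler_norm.
by exists x => //=; rewrite in_itv.
Qed.

(** Green's formula for a test function with phi'' = k phi: [phi * wx - dphi * w] is a primitive of
    phi wxx - k phi w. *)
Lemma integration_by_parts_eigen (k : R) (phi dphi w wx wxx : R -> R) :
  (forall x, is_derive x (1 : R) phi (dphi x)) ->
  (forall x, is_derive x (1 : R) dphi (k * phi x)) ->
  (forall x, 0 <= x <= 1 -> is_deriv_on `[0, 1] w x (wx x)) ->
  (forall x, 0 <= x <= 1 -> is_deriv_on `[0, 1] wx x (wxx x)) ->
  {within `[0, 1], continuous wxx} ->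
  \int[mu]_(x in `[0, 1]) (phi x * wxx x) =
  phi 1 * wx 1 - dphi 1 * w 1 - (phi 0 * wx 0 - dphi 0 * w 0)
  + k * \int[mu]_(x in `[0, 1]) (phi x * w x).
Proof.
move=> dp ddp dw dwx cwxx.
have cphi : {within `[0, 1], continuous phi}.
  by apply: continuous_within => x _; exact: is_derive_continuous (dp x).
have cdphi : {within `[0, 1], continuous dphi}.
  by apply: continuous_within => x _; exact: is_derive_continuous (ddp x).
have cw : {within `[0, 1], continuous w}.
  by apply: (@is_deriv_on_continuous _ wx) => x /=; rewrite in_itv; exact: dw.
have cwx : {within `[0, 1], continuous wx}.
  by apply: (@is_deriv_on_continuous _ wxx) => x /=; rewrite in_itv; exact: dwx.
have i1 : mu.-integrable `[0, 1] (EFin \o (fun x => phi x * wxx x)).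
  by apply: integrable_itv; exact: within_continuousM.
have i2 : mu.-integrable `[0, 1] (EFin \o (fun x => phi x * w x)).
  by apply: integrable_itv; exact: within_continuousM.
apply/eqP; rewrite -subr_eq -RintegralZl// -RintegralB//; last exact: integrable_rZ.
apply/eqP; apply: (FTC2_within (F := fun x => phi x * wx x - dphi x * w x)) => //.
- apply: within_continuousB; first exact: within_continuousM.
  by apply: within_continuousM; [exact: within_continuous_cst|exact: within_continuousM].
- by apply: within_continuousB; exact: within_continuousM.
- move=> x x01; have x01' : 0 <= x <= 1 by case/andP: x01 => /ltW -> /ltW ->.
  have h1 := dp x; have h2 := ddp x.
  have h3 := is_deriv_on_interior x01 (dw x x01').
  have h4 := is_deriv_on_interior x01 (dwx x x01').
  apply: is_derive_eq; rewrite /GRing.scale/=; ring.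
Qed.

(** Continuity of [ut] on the open strip gives no bound near a and b. On a closed interval [c, d]
    around t it is bounded by compactness, and the constant [M1 * M2] dominates. *)
Lemma is_derive_under_Rintegral (u ut : R -> R -> R) (phi : R -> R) (a b t : R) :
  a < t < b ->
  (forall x s, 0 <= x <= 1 -> a < s < b -> is_derive s (1 : R) (u x) (ut x s)) ->
  (forall s, a < s < b -> {within `[0, 1], continuous (u ^~ s)}) ->
  {within [set z : R * R | 0 <= z.1 <= 1 /\ a < z.2 < b],
     continuous (fun z => ut z.1 z.2)} ->
  {within `[0, 1], continuous phi} ->
  is_derive t (1 : R) (fun s => \int[mu]_(x in `[0, 1]) (phi x * u x s))
    (\int[mu]_(x in `[0, 1]) (phi x * ut x t)).
Proof.
move=> /andP[at_ tb] du cu cut cphi.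
pose c := (a + t) / 2; pose d := (t + b) / 2.
have act : a < c < t by rewrite /c; apply/andP; split; lra.
have tdb : t < d < b by rewrite /d; apply/andP; split; lra.
have cd s : c <= s <= d -> a < s < b by move=> /andP[? ?]; apply/andP; split; lra.
have [M1 M10 HM1] := itv_bounded cphi.
have [M2 M20 HM2] : exists2 M : R, 0 <= M & forall x s, 0 <= x <= 1 -> c <= s <= d -> `|ut x s| <= M.
  have cK : compact (`[(0 : R), 1] `*` `[c, d]).
    by apply: compact_setX; exact: segment_compact.
  have cutK : {within (`[(0 : R), 1] `*` `[c, d]), continuous (fun z : R * R => ut z.1 z.2)}.
    apply: continuous_subspaceW cut => -[x s] /= []; rewrite !in_itv/= => x01 scd.
    by split => //; exact: cd.
  have := continuous_compact cutK cK.
  move=> /compact_bounded [M [Mr HM]]; exists (`|M| + 1); first by rewrite addr_ge0.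
  move=> x s x01 scd; apply: (HM (`|M| + 1)); first by rewrite ltr_pwDr// ler_norm.
  by exists (x, s) => //=; rewrite !in_itv.
have dphiu x s : 0 <= x <= 1 -> a < s < b ->
    is_derive s (1 : R) (fun s' => phi x * u x s') (phi x * ut x s).
  by move=> x01 sab; have h1 := du x s x01 sab; apply: is_derive_eq.
have dE x s : 0 <= x <= 1 -> a < s < b ->
    partial1of2 (fun s' x' => phi x' * u x' s') s x = phi x * ut x s.
  by move=> x01 sab; rewrite partial1of2E; have [_ <-] := dphiu x s x01 sab.
have tI : `]c, d[%classic t by rewrite /= in_itv/=; apply/andP; split; lra.
have intf x : `]c, d[%classic x -> mu.-integrable `[0, 1] (EFin \o (fun y => phi y * u y x)).
  rewrite /= in_itv/= => /andP[/ltW cx /ltW xd].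
  by apply: integrable_itv; apply: within_continuousM => //; apply/cu/cd; rewrite cx xd.
have derf (x y : R) : `]c, d[%classic x -> `[0, 1]%classic y ->
    derivable (fun s => phi y * u y s) x 1.
  rewrite /= !in_itv/= => /andP[/ltW cx /ltW xd] y01.
  by have [] := dphiu y x y01; [apply: cd; rewrite cx xd|].
have Gub (x y : R) : `]c, d[%classic x -> `[0, 1]%classic y ->
    `|partial1of2 (fun s' x' => phi x' * u x' s') x y| <= cst (M1 * M2) y.
  rewrite /= !in_itv/= => /andP[/ltW cx /ltW xd] y01.
  have cxd : c <= x <= d by rewrite cx xd.
  rewrite dE//; last exact: cd.
  by rewrite normrM; apply: ler_pM => //; [exact: HM1|exact: HM2].
have G0 (y : R) : 0 <= cst (M1 * M2) y by rewrite /= mulr_ge0.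
have C := cvg_differentiation_under_integral (mu := mu) (measurable_itv _) tI intf derf G0
   (integrable_cst 0 1 (M1 * M2)) Gub.
have E : \int[mu]_(y in `[0, 1]) partial1of2 (fun s' x' => phi x' * u x' s') t y =
  \int[mu]_(x in `[0, 1]) (phi x * ut x t).
  apply: eq_Rintegral => x; rewrite inE/= in_itv/= => x01; rewrite dE//.
  by rewrite at_.
rewrite E in C.
have C' : h^-1 *: (((fun s => \int[mu]_(x in `[0, 1]) (phi x * u x s)) \o shift t) (h *: (1 : R)) -
   \int[mu]_(x in `[0, 1]) (phi x * u x t)) @[h --> (0 : R)^'] -->
   \int[mu]_(x in `[0, 1]) (phi x * ut x t).
  apply: cvg_trans C; apply: near_eq_cvg; near=> h.
  by rewrite /= [h%:A]mulr1.
by apply: DeriveDef; [exact: cvgP C'|exact/cvg_lim].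
Unshelve. all: by end_near. Qed.

End one_sided_derivatives.

(** * A Laplace transform criterion for vanishing *)

Section laplace_decay.
Context {R : realType}.
Notation mu := (@lebesgue_measure R).
Implicit Types (A D : set R) (f g : R -> R).

Lemma is_derive_expRM (k x : R) :
  is_derive x (1 : R) (fun x => expR (k * x)) (k * expR (k * x)).
Proof.
have h : is_derive x (1 : R) (fun x => k * x) k.
  by apply: is_derive_eq; rewrite /GRing.scale/= mulr1.
have := @is_derive1_comp R expR (fun x => k * x) x _ _ (is_derive_expR _) h.
by rewrite mulrC.
Qed.

Lemma is_derive_sinM (k x : R) :
  is_derive x (1 : R) (fun x => sin (k * x)) (k * cos (k * x)).
Proof.
have h : is_derive x (1 : R) (fun x => k * x) k.
  by apply: is_derive_eq; rewrite /GRing.scale/= mulr1.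
have := @is_derive1_comp R sin (fun x => k * x) x _ _ (is_derive_sin _) h.
by rewrite mulrC.
Qed.

Lemma is_derive_cosM (k x : R) :
  is_derive x (1 : R) (fun x => cos (k * x)) (- k * sin (k * x)).
Proof.
have h : is_derive x (1 : R) (fun x => k * x) k.
  by apply: is_derive_eq; rewrite /GRing.scale/= mulr1.
have := @is_derive1_comp R cos (fun x => k * x) x _ _ (is_derive_cos _) h.
by rewrite mulNr mulNr mulrC.
Qed.

(** Measurability of the limit is returned as well: this is how the discontinuous limit in
    [integral_prefix_eq0] is seen to be measurable. *)
Lemma Rdominated_cvg (a b : R) (f_ : nat -> R -> R) f g :
  (forall n, mu.-integrable `[a, b] (EFin \o f_ n)) ->
  mu.-integrable `[a, b] (EFin \o g) ->
  (forall x, a <= x <= b -> f_ n x @[n --> \oo] --> f x) ->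
  (forall n x, a <= x <= b -> `|f_ n x| <= g x) ->
  \int[mu]_(x in `[a, b]) f_ n x @[n --> \oo] --> \int[mu]_(x in `[a, b]) f x /\
  measurable_fun (`[a, b] : set R) f.
Proof.
move=> fi gi ff fg.
have mf_ n : measurable_fun `[a, b] (EFin \o f_ n) by have /integrableP[] := fi n.
have mf : measurable_fun (`[a, b] : set R) f.
  apply: (measurable_fun_cvg (h := f_)) => //.
  by move=> n; have /measurable_EFinP := mf_ n.
split => //.
have := @dominated_cvg _ _ _ mu `[a, b]%classic _ (fun n => EFin \o f_ n) (EFin \o f) (EFin \o g).
move=> /(_ (measurable_itv _) mf_); rewrite /Rintegral => H.
apply: fine_cvg; rewrite fineK.
  apply: H => //.
  by move=> x /=; rewrite in_itv/= => xab; apply: cvg_EFin; [exact: nearW|exact: ff].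
have fint : mu.-integrable `[a, b] (EFin \o f).
  apply: (@integrable_dom _ _ _ _ g) => // x xab.
  by apply: (cvgr_to_le (cvg_norm (ff x xab))); apply: nearW => n; exact: fg.
by apply: (integrable_fin_num _ fint).
Qed.

Lemma series_exp_le (x : R) n : 0 <= x -> \sum_(0 <= k < n) (x ^+ k / k`!%:R) <= expR x.
Proof.
move=> x0; have -> : \sum_(0 <= k < n) (x ^+ k / k`!%:R) = series (exp_coeff x) n by [].
apply: nondecreasing_cvgn_le; last exact: is_cvg_series_exp_coeff.
apply: nondecreasing_series => k _ _; exact: exp_coeff_ge0.
Qed.

(** A variant of Phragmen's argument. The weight exp (- exp (n (c - x))) tends to the indicator of x
    > c, so the integrals of [E n] tend to that of f over [c, 1]. Expanding the outer exponential
    turns them into alternating sums of exp (k n c) J(k n) / k!. The term k = 0 is the integral of f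
    over [0, 1], and the decay assumption makes the others O(1 / n) in total. Comparing both limits
    leaves 0 for [0, c]. *)
Lemma integral_prefix_eq0 f (c : R) : {within `[0, 1], continuous f} -> 0 < c < 1 ->
  (exists C, forall j, (0 < j)%N -> j%:R * expR (c * j%:R) *
     `|\int[mu]_(x in `[0, 1]) (expR (- j%:R * x) * f x)| <= C) ->
  \int[mu]_(x in `[0, c]) f x = 0.
Proof.
move=> cf /andP[c0 c1] [C HC].
have intf := integrable_itv cf.
have cexp k : {within `[0, 1], continuous (fun x : R => expR (k * x))}.
  by apply: continuous_within => x _; exact: is_derive_continuous (is_derive_expRM k x).
have [M M0 HM] := itv_bounded cf.
pose y n (x : R) := expR (n%:R * c) * expR (- n%:R * x).
have yE n x : y n x = expR (n%:R * (c - x)) by rewrite /y -expRD; congr expR; ring.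
have y0 n x : 0 <= y n x by rewrite yE expR_ge0.
have yM n x : 0 <= x -> y n x <= expR n%:R.
  by move=> x0; rewrite yE ler_expR ler_piMr// lerBlDr; lra.
have cy n : {within `[0, 1], continuous (y n)}.
  by apply: within_continuousM => //; exact: within_continuous_cst.
pose E n x := expR (- y n x) * f x.
pose P n N x := (\sum_(0 <= k < N) ((- y n x) ^+ k / k`!%:R)) * f x.
have cP n N : {within `[0, 1], continuous (P n N)}.
  apply: within_continuousM => //.
  rewrite (_ : (fun x => _) = \sum_(0 <= k < N) (fun x => (- y n x) ^+ k / k`!%:R)); last first.
    by apply/funext => x; rewrite fct_sumE.
  elim/big_ind: _ => [|f1 g1 h1 h2|k _].
  - exact: within_continuous_cst.
  - exact: within_continuousD.
  - apply: within_continuousM; last exact: within_continuous_cst.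
    by apply: (@within_continuous_comp _ _ (fun x => - y n x) (fun z => z ^+ k)); [exact: within_continuousN|exact: exprn_continuous].
have PE n : \int[mu]_(x in `[0, 1]) P n N x @[N --> \oo] --> \int[mu]_(x in `[0, 1]) E n x.
  have [] // := @Rdominated_cvg 0 1 (P n) (E n) (fun _ => expR (expR n%:R) * M).
  - by move=> N; exact: integrable_itv.
  - exact: integrable_cst.
  - by move=> x _; apply: cvgMl; exact: is_cvg_series_exp_coeff.
  - move=> N x /andP[x0 x1]; rewrite normrM ler_pM//; last by apply: HM; rewrite x0.
    rewrite (le_trans (ler_norm_sum _ _ _))//.
    apply: (@le_trans _ _ (expR (y n x))); last by rewrite ler_expR yM.
    apply: le_trans (series_exp_le N (y0 n x)).
    apply: ler_sum => k _.
    by rewrite normrM normrX normrN (ger0_norm (y0 n x)) ger0_norm// invr_ge0.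
pose J k := \int[mu]_(x in `[0, 1]) (expR (- k%:R * x) * f x).
have C0 : 0 <= C by apply: le_trans (HC 1%N isT); rewrite !mulr_ge0// expR_ge0.
(* The factor j in the assumption, taken at j = (k + 1) n >= n, produces the C / n that makes the
   tail vanish. *)
have HJ n k : (0 < n)%N -> `|expR (k.+1%:R * n%:R * c) * J (k.+1 * n)%N| <= C / n%:R.
  move=> n0; have n0' : 0 < n%:R :> R by rewrite ltr0n.
  have kn0 : (0 < k.+1 * n)%N by rewrite muln_gt0.
  have := HC _ kn0; rewrite -/(J _) normrM (ger0_norm (expR_ge0 _)).
  have -> : k.+1%:R * n%:R * c = c * (k.+1 * n)%:R by rewrite natrM; ring.
  rewrite -mulrA; set X := _ * `|J _| => HX; rewrite ler_pdivlMr//.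
  apply: le_trans HX; rewrite mulrC ler_wpM2r ?mulr_ge0 ?expR_ge0//.
  by rewrite ler_nat leq_pmull.
have PJ n N : \int[mu]_(x in `[0, 1]) P n N x =
    \sum_(0 <= k < N) ((-1) ^+ k / k`!%:R * expR (k%:R * n%:R * c) * J (k * n)%N).
  have iexp k : mu.-integrable `[0, 1] (EFin \o (fun x => expR (- k%:R * x) * f x)).
    by apply: integrable_itv; exact: within_continuousM.
  elim: N => [|N IH].
    rewrite big_nil; rewrite -[RHS]Rintegral_cst01; apply: eq_Rintegral => x _.
    by rewrite /P big_nil mul0r.
  rewrite big_nat_recr//= -IH -RintegralZl// -RintegralD//; last 2 first.
  - by apply: integrable_itv; exact: cP.
  - exact: integrable_rZ.
  apply: eq_Rintegral => x _; rewrite /P big_nat_recr//= mulrDl; congr (_ + _).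
  have -> : (- y n x) ^+ N = (-1) ^+ N * (expR (N%:R * n%:R * c) * expR (- (N * n)%:R * x)).
    rewrite (exprNn (y n x)) yE -expRM_natl -expRD natrM; congr (_ * expR _); ring.
  by ring.
have Pest n N : (0 < n)%N ->
    `|\int[mu]_(x in `[0, 1]) P n N.+1 x - \int[mu]_(x in `[0, 1]) f x| <= C / n%:R * expR 1.
  move=> n0; rewrite PJ big_nat_recl//=.
  have -> : (-1) ^+ 0 / 0`!%:R * expR (0%:R * n%:R * c) * J (0 * n)%N = \int[mu]_(x in `[0, 1]) f x.
    rewrite expr0 fact0 invr1 !mul0r expR0 !mul1r /J mul0n.
    by apply: eq_Rintegral => x _; rewrite oppr0 mul0r expR0 mul1r.
  rewrite addrC addKr (le_trans (ler_norm_sum _ _ _))//.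
  apply: (@le_trans _ _ (\sum_(0 <= k < N) (C / n%:R * (k.+1)`!%:R^-1))).
    apply: ler_sum => k _; rewrite -mulrA normrM mulrC ler_pM//; first exact: HJ.
    by rewrite normrM normrX normrN1 expr1n mul1r ger0_norm// invr_ge0.
  rewrite -mulr_sumr ler_wpM2l ?divr_ge0//.
  have := series_exp_le N.+1 (@ler01 R); rewrite big_nat_recl//=; apply: le_trans.
  rewrite expr0 fact0 invr1 mulr1 ler_wpDl//.
  by apply: ler_sum => k _; rewrite expr1n mul1r.
have Eest n : (0 < n)%N ->
    `|\int[mu]_(x in `[0, 1]) E n x - \int[mu]_(x in `[0, 1]) f x| <= C / n%:R * expR 1.
  move=> n0; have h : `|\int[mu]_(x in `[0, 1]) P n N.+1 x - \int[mu]_(x in `[0, 1]) f x| @[N --> \oo] -->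
      `|\int[mu]_(x in `[0, 1]) E n x - \int[mu]_(x in `[0, 1]) f x|.
    apply: cvg_norm; apply: cvgB; last exact: cvg_cst.
    by have := PE n; rewrite -(cvg_shiftS _).
  by apply: (cvgr_to_le h); apply: nearW => N; exact: Pest.
have Ef : \int[mu]_(x in `[0, 1]) E n.+1 x @[n --> \oo] --> \int[mu]_(x in `[0, 1]) f x.
  apply/subr_cvg0; apply: norm_cvg0.
  apply: (@squeeze_cvgr _ _ _ _ (cst 0) (fun n => C * expR 1 * harmonic n)).
  - by apply: nearW => n; rewrite normr_ge0/= (le_trans (Eest _ _))// mulrAC.
  - exact: cvg_cst.
  - by rewrite -[X in _ --> X](mulr0 (C * expR 1)); apply: cvgMr; exact: cvg_harmonic.
(* At x = c the inner exponential is 1 for every n, hence the value exp (- 1) at this single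
   point. *)
pose phi x := (if x < c then 0 else if x == c then expR (-1) else 1) * f x.
have small (z : R) n : 0 < z -> expR (- (n.+1%:R * z)) <= z^-1 * harmonic n.
  move=> z0; have nz0 : 0 < n.+1%:R * z by rewrite mulr_gt0.
  rewrite /harmonic/= -invfM mulrC expRN lef_pV2 ?posrE ?expR_gt0 ?mulr_gt0//.
  by rewrite (le_trans _ (expR_ge1Dx _))// lerDr.
have small0 (z : R) : z^-1 * harmonic n @[n --> \oo] --> (0 : R).
  by rewrite -[X in _ --> X](mulr0 z^-1); apply: cvgMr; exact: cvg_harmonic.
have Mf : mu.-integrable `[0, 1] (EFin \o (fun _ => M)) by exact: integrable_cst.
have Ephi x : 0 <= x <= 1 -> E n.+1 x @[n --> \oo] --> phi x.
  move=> x01; rewrite /phi /E; apply: cvgMl.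
  case: (ltgtP x c) => xc.
  - have cx : 0 < c - x by rewrite subr_gt0.
    apply: (@squeeze_cvgr _ _ _ _ (cst 0) (fun n => (c - x)^-1 * harmonic n)) => //; last exact: cvg_cst.
    apply: nearW => n; rewrite expR_ge0/= yE (le_trans _ (small _ n cx))// ler_expR lerN2.
    by rewrite (le_trans _ (expR_ge1Dx _))// lerDr.
  - have cx : 0 < x - c by rewrite subr_gt0.
    apply/subr_cvg0; apply: norm_cvg0.
    apply: (@squeeze_cvgr _ _ _ _ (cst 0) (fun n => (x - c)^-1 * harmonic n)) => //; last exact: cvg_cst.
    apply: nearW => n; rewrite normr_ge0/= distrC ger0_norm; last first.
      by rewrite subr_ge0 -expR0 ler_expR oppr_le0.
    rewrite (le_trans _ (small _ n cx))// (le_trans (y := y n.+1 x))//.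
      by have := expR_ge1Dx (- y n.+1 x); lra.
    by rewrite yE ler_expR -mulrN opprB.
  - rewrite xc; under eq_fun do rewrite yE subrr mulr0 expR0.
    exact: cvg_cst.
have EM n x : 0 <= x <= 1 -> `|E n x| <= M.
  move=> x01; rewrite normrM ger0_norm ?expR_ge0// -[leRHS]mul1r ler_pM ?expR_ge0//; last exact: HM.
  by rewrite -expR0 ler_expR oppr_le0.
have cE n : {within `[0, 1], continuous (E n)}.
  apply: within_continuousM => //.
  apply: (@within_continuous_comp _ _ (fun x => - y n x) expR).
    exact: within_continuousN.
  by move=> z; exact: continuous_expR.
have [Ecvg mphi] : \int[mu]_(x in `[0, 1]) E n.+1 x @[n --> \oo] --> \int[mu]_(x in `[0, 1]) phi x /\
    measurable_fun (`[0, 1] : set R) phi.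
  apply: (Rdominated_cvg (f_ := fun n => E n.+1) (g := fun _ => M)) => // [n|n x].
  - by apply: integrable_itv.
  - exact: EM.
have If : \int[mu]_(x in `[0, 1]) phi x = \int[mu]_(x in `[0, 1]) f x.
  by rewrite -(cvg_lim (@norm_hausdorff _ R) Ecvg); exact: cvg_lim.
have iphi : mu.-integrable `[0, 1] (EFin \o phi).
  apply: (@integrable_dom _ _ _ _ (fun _ => M)) => // x x01.
  rewrite normrM -[leRHS]mul1r ler_pM//; last exact: HM.
  case: ifP => _; first by rewrite normr0.
  case: ifP => _; last by rewrite normr1.
  by rewrite ger0_norm ?expR_ge0// -expR0 ler_expR lerN10.
have [c0' c1'] := (ltW c0, ltW c1).
move: If; rewrite (Rintegral_cat c0' c1' iphi) (Rintegral_cat c0' c1' intf).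
have mS (g : R -> R) (a b : R) : 0 <= a -> b <= 1 -> measurable_fun (`[0, 1] : set R) g ->
    measurable_fun (`]a, b[ : set R) g.
  move=> a0 b1; apply: measurable_funS => // x /=; rewrite !in_itv/= => /andP[ax xb].
  by rewrite (le_trans a0 (ltW ax)) (le_trans (ltW xb) b1).
have mf : measurable_fun (`[0, 1] : set R) f by have /integrableP[/measurable_EFinP] := intf.
have -> : \int[mu]_(x in `[0, c]) phi x = 0.
  rewrite /Rintegral (eq_integral_itv_bounded (f := phi) (g := fun _ => 0)) //.
  - by rewrite integral0.
  - exact: mS.
  - by move=> x; rewrite in_itv/= => /andP[_ xc]; rewrite /phi xc mul0r.
have -> : \int[mu]_(x in `[c, 1]) phi x = \int[mu]_(x in `[c, 1]) f x.
  rewrite /Rintegral (eq_integral_itv_bounded (f := phi) (g := f)) //.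
  - exact: mS.
  - exact: mS.
  - by move=> x; rewrite in_itv/= => /andP[cx _]; rewrite /phi ltNge ltW//= gt_eqF// mul1r.
by move=> /addIr <-.
Qed.

Lemma laplace_decay_eq0 f : {within `[0, 1], continuous f} ->
  (forall c, 0 < c < 1 -> exists C, forall j, (0 < j)%N -> j%:R * expR (c * j%:R) *
     `|\int[mu]_(x in `[0, 1]) (expR (- j%:R * x) * f x)| <= C) ->
  forall x, 0 < x < 1 -> f x = 0.
Proof.
move=> cf H x x01; have intf := integrable_itv cf; have /andP[x0 x1] := x01.
have cx : {for x, continuous f}.
  apply: (continuous_at_within _ cf); exists (Num.min x (1 - x)).
    by rewrite lt_min x0 subr_gt0.
  move=> y; rewrite lt_min => /andP[]; rewrite ltr_norml => /andP[? _]; rewrite ltr_norml => /andP[_ ?].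
  by rewrite /= in_itv/=; apply/andP; split; lra.
have [_ d1] := is_derive_Rintegral x01 intf cx.
have [_ d2] : is_derive x (1 : R) (fun t => \int[mu]_(s in `[0, t]) f s) 0.
  apply: (near_eq_is_derive (f := cst 0)).
  near=> t; have t01 : 0 < t < 1.
    by apply/andP; split; near: t; [exact: lt_nbhsr|exact: lt_nbhsl].
  by rewrite (integral_prefix_eq0 cf t01 (H t t01)).
by rewrite -d1 d2.
Unshelve. all: by end_near. Qed.

(** The shift A / k absorbs the forcing: exp (- k x) (L + A / k) has derivative exp (- k x) (c - A)
    <= 0. This bounds L s from below by data at the later time t, and applying it to - J gives the
    other side. A large growth rate k helps when read backwards. *)
Lemma backward_growth_bound (J b : R -> R) (k A s t : R) : s <= t -> 0 < k ->
  {within `[s, t], continuous J} ->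
  (forall x, s < x < t -> is_derive x (1 : R) J (k * J x + b x)) ->
  (forall x, s < x < t -> `|b x| <= A) -> 0 <= A ->
  `|J s| <= expR (- k * (t - s)) * `|J t| + A / k.
Proof.
move=> st k0 cJ dJ bA A0.
have one (L c : R -> R) : {within `[s, t], continuous L} ->
  (forall x, s < x < t -> is_derive x (1 : R) L (k * L x + c x)) ->
  (forall x, s < x < t -> `|c x| <= A) -> - (expR (- k * (t - s)) * `|L t| + A / k) <= L s.
  move=> cL dL cA.
  have dN x : s < x < t -> is_derive x (1 : R) (fun x => expR (- k * x) * (L x + A / k))
      (expR (- k * x) * (c x - A)).
    move=> xst; have h1 := is_derive_expRM (- k) x; have h2 := dL x xst.
    by apply: is_derive_eq; rewrite /GRing.scale/=; field; rewrite gt_eqF.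
  have : expR (- k * t) * (L t + A / k) <= expR (- k * s) * (L s + A / k).
    apply: (le_of_derive_le0 st _ dN).
      apply: within_continuousM.
        by apply: continuous_within => x _; exact: is_derive_continuous (is_derive_expRM _ x).
      by apply: within_continuousD => //; exact: within_continuous_cst.
    move=> x xst; rewrite mulr_ge0_le0 ?expR_ge0// subr_le0.
    exact: le_trans (ler_norm _) (cA x xst).
  have -> : expR (- k * t) = expR (- k * s) * expR (- k * (t - s)).
    by rewrite -expRD; congr expR; ring.
  rewrite -mulrA ler_pM2l ?expR_gt0// => H.
  have e0 := expR_gt0 (- k * (t - s)).
  have : - (expR (- k * (t - s)) * `|L t|) <= expR (- k * (t - s)) * (L t + A / k).
    rewrite -mulrN ler_pM2l// (@le_trans _ _ (L t))//; first by rewrite lerNl -normrN ler_norm.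
    by rewrite lerDl divr_ge0// ltW.
  by move=> H2; rewrite opprD lerBlDr (le_trans H2).
rewrite ler_norml one//=.
have := one (fun x => - J x) (fun x => - b x).
rewrite normrN lerN2; apply.
- exact: within_continuousN.
- move=> x xst; have h := dJ x xst; apply: is_derive_eq; ring.
- by move=> x xst; rewrite normrN; exact: bA.
Qed.

End laplace_decay.

(** * Unique continuation for the heat equation *)

Section unique_continuation.
Context {R : realType}.
Notation mu := (@lebesgue_measure R).
Variables (ep la al be : R) (u ut ux uxx : R -> R -> R).
Hypothesis ep0 : 0 < ep.
Hypothesis cut : {within [set z : R * R | 0 <= z.1 <= 1 /\ al < z.2 < be],
     continuous (fun z => ut z.1 z.2)}.
Hypothesis du : forall x t, 0 <= x <= 1 -> al < t < be -> is_derive t (1 : R) (u x) (ut x t).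
Hypothesis dux : forall x t, 0 <= x <= 1 -> al < t < be -> is_deriv_on `[0, 1] (u ^~ t) x (ux x t).
Hypothesis duxx : forall x t, 0 <= x <= 1 -> al < t < be -> is_deriv_on `[0, 1] (ux ^~ t) x (uxx x t).
Hypothesis cuxx : forall t, al < t < be -> {within `[0, 1], continuous (uxx ^~ t)}.
Hypothesis heat : forall x t, 0 <= x <= 1 -> al < t < be -> ut x t = ep * uxx x t + la * u x t.

Let cu t : al < t < be -> {within `[0, 1], continuous (u ^~ t)}.
Proof.
move=> tab; apply: (@is_deriv_on_continuous _ _ (ux ^~ t)) => x /=.
by rewrite in_itv/= => x01; exact: dux.
Qed.

(** With phi = sin (pi n x) and k = - (pi n)^2 this is the modal equation behind the regression;
    with phi = exp (- j x) and k = j^2 it is the growing mode behind unique continuation. *)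
Lemma heat_weighted_derive (k : R) (phi dphi : R -> R) t : al < t < be ->
  (forall x, is_derive x (1 : R) phi (dphi x)) ->
  (forall x, is_derive x (1 : R) dphi (k * phi x)) ->
  is_derive t (1 : R) (fun s => \int[mu]_(x in `[0, 1]) (phi x * u x s))
    (ep * (phi 1 * ux 1 t - dphi 1 * u 1 t - (phi 0 * ux 0 t - dphi 0 * u 0 t))
     + (ep * k + la) * \int[mu]_(x in `[0, 1]) (phi x * u x t)).
Proof.
move=> tab dp ddp.
have cphi : {within `[0, 1], continuous phi}.
  by apply: continuous_within => x _; exact: is_derive_continuous (dp x).
have := is_derive_under_Rintegral tab du cu cut cphi.
have -> : \int[mu]_(x in `[0, 1]) (phi x * ut x t) =
    ep * \int[mu]_(x in `[0, 1]) (phi x * uxx x t) + la * \int[mu]_(x in `[0, 1]) (phi x * u x t).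
  have i1 : mu.-integrable `[0, 1] (EFin \o (fun x => phi x * uxx x t)).
    by apply: integrable_itv; apply: within_continuousM => //; exact: cuxx.
  have i2 : mu.-integrable `[0, 1] (EFin \o (fun x => phi x * u x t)).
    by apply: integrable_itv; apply: within_continuousM => //; exact: cu.
  rewrite -!RintegralZl// -RintegralD//; [|exact: integrable_rZ|exact: integrable_rZ].
  apply: eq_Rintegral => x; rewrite inE/= in_itv/= => x01; rewrite heat//; ring.
rewrite (integration_by_parts_eigen dp ddp (w := u ^~ t) (wx := ux ^~ t) (wxx := uxx ^~ t)) //.
- by move=> H; apply: (is_derive_eq H); ring.
- by move=> x x01; exact: dux.
- by move=> x x01; exact: duxx.
- exact: cuxx.
Qed.

(* Testing with [exp (- j x)] turns the vanishing Cauchy data at [x = 0] into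
   a decay [O(exp (- j))] of the Laplace transform of [u ^~ s], which is
   possible only for [u ^~ s = 0]. *)
Lemma heat_unique_continuation (q U : R) : 0 < la ->
  (forall t, al < t < be -> u 0 t = 0) ->
  (forall t, al < t < be -> ux 0 t = 0) ->
  (forall t, al < t < be -> ux 1 t + q * u 1 t = U) ->
  forall x t, 0 <= x <= 1 -> al < t < be -> u x t = 0.
Proof.
move=> la0 u0 ux0 bc x s x01 sab.
suff H : forall x, 0 < x < 1 -> u x s = 0.
  have /within_continuousP cus := cu sab.
  apply/eqP; rewrite -normr_le0; apply/ler_addgt0Pl => e e0; rewrite addr0.
  have xI : `[0, 1]%classic x by rewrite /= in_itv.
  have [d d0 Hd] := cus x xI e e0.
  pose r := Num.min (d / 2) 3^-1.
  have r0 : 0 < r by rewrite lt_min divr_gt0//= invr_gt0.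
  have rd : r < d by rewrite gt_min; apply/orP; left; lra.
  have r3 : r <= 3^-1 by rewrite ge_min lexx orbT.
  have r3' : r < 2^-1 by apply: le_lt_trans r3 _; lra.
  have [y [yI yx]] : exists y, 0 < y < 1 /\ `|y - x| <= r.
    have [xh|xh] := leP x 2^-1.
      exists (x + r); rewrite addrC addrK ger0_norm; last exact: ltW.
      by split => //; move: x01 => /andP[? ?]; apply/andP; split; lra.
    exists (x - r); rewrite addrAC subrr add0r normrN ger0_norm; last exact: ltW.
    by split => //; move: x01 => /andP[? ?]; apply/andP; split; lra.
  have := Hd y; rewrite H// sub0r normrN => Hy; apply/ltW/Hy; last exact: le_lt_trans rd.
  by rewrite /= in_itv/=; move: yI => /andP[? ?]; apply/andP; split; lra.
apply: laplace_decay_eq0; first exact: cu.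
move=> c c01.
have /andP[as_ sb] := sab.
(* Any later time inside the interval would do; the backward estimate runs from t to s and exploits
   t - s > 0. *)
pose t := (s + be) / 2.
have st : s < t by rewrite /t; lra.
have tb : t < be by rewrite /t; lra.
have tab : al < t < be by apply/andP; split; lra.
have sub y : s <= y <= t -> al < y < be by move=> /andP[? ?]; apply/andP; split; lra.
have cu1 : {within `[s, t], continuous (u 1)}.
  apply: continuous_within => y; rewrite /= in_itv/= => yst.
  by apply: (is_derive_continuous (du _ (sub _ yst))); rewrite ler01 lexx.
have [M1 M10 HM1] := itv_bounded cu1.
(* [ux 1] is bounded through the boundary condition, whose right-hand side U is constant in time. *)
pose M := M1 + `|q| * M1 + `|U|.
have M0 : 0 <= M by rewrite !addr_ge0// mulr_ge0.
have Mu y : s <= y <= t -> `|u 1 y| <= M.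
  by move=> yst; rewrite (le_trans (HM1 y yst))// /M -addrA lerDl addr_ge0// mulr_ge0.
have Mux y : s <= y <= t -> `|ux 1 y| <= M.
  move=> yst; have -> : ux 1 y = U - q * u 1 y by rewrite -(bc y (sub y yst)) addrK.
  have h1 : `|q * u 1 y| <= `|q| * M1 by rewrite normrM ler_wpM2l// HM1.
  by rewrite (le_trans (ler_normB _ _))// /M; lra.
pose L := \int[mu]_(x in `[0, 1]) `|u x t|.
have iabs : mu.-integrable `[0, 1] (EFin \o (fun x => `|u x t|)).
  by apply: integrable_norm; apply: integrable_itv; exact: cu.
have L0 : 0 <= L by exact: Rintegral_ge0.
pose del := t - s; have del0 : 0 < del by rewrite subr_gt0.
exists (L * expR ((ep * del)^-1) + 2 * M) => j j0.
have j0' : 1 <= j%:R :> R by rewrite ler1n.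
have j00 : 0 < j%:R :> R by rewrite ltr0n.
pose J y := \int[mu]_(x in `[0, 1]) (expR (- j%:R * x) * u x y).
rewrite -/(J s).
pose k := ep * j%:R ^+ 2 + la.
have k0 : 0 < k by rewrite addr_gt0// mulr_gt0// exprn_gt0.
pose b y := ep * (expR (- j%:R) * (ux 1 y + j%:R * u 1 y)).
have dJ y : s <= y <= t -> is_derive y (1 : R) J (k * J y + b y).
  move=> yst; have yab := sub _ yst.
  have := @heat_weighted_derive (j%:R ^+ 2) (fun x => expR (- j%:R * x))
     (fun x => - j%:R * expR (- j%:R * x)) y yab.
  move=> /(_ (fun x => is_derive_expRM _ x)) HH.
  apply: is_derive_eq (HH _) _.
    move=> x'; have h := is_derive_expRM (- j%:R) x'.
    by apply: is_derive_eq; rewrite /GRing.scale/=; ring.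
  by rewrite u0// ux0// !mulr1 mulr0 /b /k -/(J y); ring.
have A0 : 0 <= ep * (expR (- j%:R) * (M * (1 + j%:R))).
  by rewrite !mulr_ge0 ?expR_ge0 ?(ltW ep0)// addr_ge0.
have bb y : s < y < t -> `|b y| <= ep * (expR (- j%:R) * (M * (1 + j%:R))).
  move=> /andP[/ltW sy /ltW yt]; have yst : s <= y <= t by rewrite sy yt.
  rewrite /b !normrM (ger0_norm (ltW ep0)) (ger0_norm (expR_ge0 _)).
  rewrite !ler_wpM2l ?expR_ge0// ?(ltW ep0)//.
  rewrite (le_trans (ler_normD _ _))// normrM (ger0_norm (ltW j00)) mulrDr mulr1.
  by rewrite lerD ?Mux// mulrC ler_wpM2r ?(ltW j00)// Mu.
have cJ : {within `[s, t], continuous J}.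
  by apply: continuous_within => y; rewrite /= in_itv/= => /dJ; exact: is_derive_continuous.
have dJ' y : s < y < t -> is_derive y (1 : R) J (k * J y + b y).
  by move=> /andP[/ltW sy /ltW yt]; apply: dJ; rewrite sy yt.
have := backward_growth_bound (ltW st) k0 cJ dJ' bb A0.
rewrite -/del; set A := ep * _ => HJ.
have Jt : `|J t| <= L.
  apply: Rintegral_dominated => // x' /andP[x'0 _]; rewrite normrM ger0_norm ?expR_ge0//.
  by rewrite -[leRHS]mul1r ler_wpM2r// -expR0 ler_expR mulNr oppr_le0 mulr_ge0// ltW.
pose w := ep * del; have w0 : 0 < w by rewrite mulr_gt0.
(* The quadratic exponent beats the linear ones: j and exp (c j) are each at most exp j, and (w j -
   1)^2 >= 0 gives 2 j - w j^2 <= 1 / w. *)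
have T1 : j%:R * expR (c * j%:R) * expR (- k * del) <= expR w^-1.
  have h1 : j%:R <= expR j%:R :> R by apply: le_trans (expR_ge1Dx _); rewrite lerDr.
  apply: (@le_trans _ _ (expR j%:R * expR (c * j%:R) * expR (- k * del))).
    by rewrite ler_wpM2r ?expR_ge0// ler_wpM2r ?expR_ge0.
  rewrite -!expRD ler_expR.
  have h2 : c * j%:R <= j%:R by rewrite ler_piMl ?ltW//; case/andP: c01.
  have h3 : j%:R * 2 - w * j%:R ^+ 2 <= w^-1.
    rewrite -(ler_pM2l w0) mulfV ?gt_eqF//; have := sqr_ge0 (w * j%:R - 1); nra.
  have h4 : w * j%:R ^+ 2 <= k * del.
    by rewrite /w mulrAC ler_wpM2r ?(ltW del0)// /k lerDl ltW.
  by lra.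
(* The forcing carries exp (- j), which absorbs exp (c j) because c < 1; then j (1 + j) <= 2 j^2 is
   compared with k >= eps j^2. *)
have T2 : j%:R * expR (c * j%:R) * A <= 2 * M * k.
  have e1 : expR (c * j%:R) * expR (- j%:R) <= 1.
    rewrite -expRD -expR0 ler_expR; have /andP[_ /ltW c1] := c01.
    by rewrite subr_le0 ler_piMl// ltW.
  have e0 : 0 <= expR (c * j%:R) * expR (- j%:R) by rewrite mulr_ge0 ?expR_ge0.
  have -> : j%:R * expR (c * j%:R) * A =
     (expR (c * j%:R) * expR (- j%:R)) * (ep * M * (j%:R * (1 + j%:R))) by rewrite /A; ring.
  have h5 : 0 <= ep * M * (j%:R * (1 + j%:R)) by rewrite !mulr_ge0 ?(ltW ep0)// addr_ge0.
  apply: (@le_trans _ _ (ep * M * (j%:R * (1 + j%:R)))); first by rewrite ler_piMl.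
  apply: (@le_trans _ _ (ep * M * (2 * j%:R ^+ 2))).
    by rewrite ler_wpM2l ?mulr_ge0 ?(ltW ep0)//; nra.
  have -> : ep * M * (2 * j%:R ^+ 2) = 2 * M * (ep * j%:R ^+ 2) by ring.
  by rewrite ler_wpM2l ?mulr_ge0// /k lerDl ltW.
have X0 : 0 <= j%:R * expR (c * j%:R) by rewrite mulr_ge0 ?expR_ge0.
apply: (le_trans (ler_wpM2l X0 HJ)); rewrite mulrDr; apply: lerD.
  rewrite mulrA [leRHS]mulrC; apply: ler_pM => //.
by rewrite mulrA ler_pdivrMr.
Qed.
End unique_continuation.

(** * Boundedness of the gains *)

Section gain_bounds.
Context {R : realType}.
Notation mu := (@lebesgue_measure R).

(** Partial sums of I_1(s) / s as a power series in z = s^2. In this variable the function is smooth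
    at 0, where the constant term 1 / 2 is the conventional value of the ratio. *)
Definition bessel_poly (n : nat) (z : R) : R :=
  \sum_(0 <= k < n) (z ^+ k / (2 * 4 ^+ k * (k`! * (k.+1)`!)%:R)).

Lemma bessel_coef_le (k : nat) : (2 * 4 ^+ k * (k`! * (k.+1)`!)%:R)^-1 <= (k`!)%:R^-1 :> R.
Proof.
have k0 : 0 < (k`!)%:R :> R by rewrite ltr0n fact_gt0.
have k1 : 1 <= ((k.+1)`!)%:R :> R by rewrite ler1n fact_gt0.
have p1 : 1 <= 4 ^+ k :> R by rewrite exprn_ege1// ler1n.
rewrite lef_pV2 ?posrE//.
rewrite natrM mulrCA ler_peMr ?(ltW k0)//.
have : 1 * 1 <= 2 * 4 ^+ k :> R by apply: ler_pM => //; rewrite ler1n.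
by rewrite mulr1 => h; rewrite -[leLHS]mulr1 ler_pM.
Qed.

Lemma bessel_coef_ge0 (k : nat) : 0 <= (2 * 4 ^+ k * (k`! * (k.+1)`!)%:R)^-1 :> R.
Proof. by rewrite invr_ge0 !mulr_ge0// exprn_ge0. Qed.

Lemma bessel_poly_bound n (z M : R) : 0 <= z <= M -> `|bessel_poly n z| <= expR M.
Proof.
move=> /andP[z0 zM]; rewrite ger0_norm; last first.
  by apply: sumr_ge0 => k _; rewrite mulr_ge0 ?exprn_ge0// bessel_coef_ge0.
rewrite (@le_trans _ _ (expR z)) ?ler_expR//.
apply: le_trans (series_exp_le n z0).
by apply: ler_sum => k _; rewrite ler_wpM2l ?exprn_ge0// bessel_coef_le.
Qed.

Lemma exprB_lip (k : nat) (z w M : R) : 0 <= z <= M -> 0 <= w <= M ->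
  `|z ^+ k.+1 - w ^+ k.+1| <= k.+1%:R * M ^+ k * `|z - w|.
Proof.
move=> /andP[z0 zM] /andP[w0 wM]; have M0 := le_trans z0 zM.
elim: k => [|k IH]; first by rewrite !expr1 expr0 !mul1r.
have -> : z ^+ k.+2 - w ^+ k.+2 = z * (z ^+ k.+1 - w ^+ k.+1) + w ^+ k.+1 * (z - w).
  by rewrite !exprS; ring.
rewrite (le_trans (ler_normD _ _))// !normrM.
have -> : k.+2%:R * M ^+ k.+1 * `|z - w| =
   M * (k.+1%:R * M ^+ k * `|z - w|) + M ^+ k.+1 * `|z - w|.
  by rewrite -[k.+2%:R]natr1 exprS; ring.
apply: lerD; first by rewrite ler_pM// ger0_norm.
by rewrite ler_wpM2r// normrX ger0_norm// lerXn2r ?nnegrE.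
Qed.

(** By [exprB_lip] the term of degree k + 1 contributes at most M^k / k! times |z - w|, so the
    exponential series reappears. The estimate is in z and not in its square root, which is not
    Lipschitz at 0; the argument of the Bessel ratio is 0 on the diagonal x = y. *)
Lemma bessel_poly_lip n (z w M : R) : 0 <= z <= M -> 0 <= w <= M ->
  `|bessel_poly n z - bessel_poly n w| <= expR M * `|z - w|.
Proof.
move=> zM wM; have M0 : 0 <= M by case/andP: zM => /le_trans; apply.
case: n => [|n]; first by rewrite /bessel_poly !big_nil subrr normr0 mulr_ge0 ?expR_ge0.
rewrite /bessel_poly -sumrB big_nat_recl//= !expr0 subrr add0r.
rewrite (le_trans (ler_norm_sum _ _ _))//.
apply: (@le_trans _ _ (\sum_(0 <= k < n) (M ^+ k / k`!%:R) * `|z - w|)).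
  apply: ler_sum => k _; rewrite -mulrBl normrM (ger0_norm (bessel_coef_ge0 _)).
  apply: (@le_trans _ _ (k.+1%:R * M ^+ k * `|z - w| * (k.+1)`!%:R^-1)).
    by rewrite ler_pM ?bessel_coef_ge0 ?exprB_lip ?bessel_coef_le.
  rewrite factS natrM invfM.
  have k0 : k.+1%:R != 0 :> R by rewrite pnatr_eq0.
  have f0 : (k`!)%:R != 0 :> R by rewrite pnatr_eq0 -lt0n fact_gt0.
  move: (k.+1%:R : R) (k`!%:R : R) k0 f0 => a b k0 f0.
  by rewrite le_eqVlt; apply/orP; left; apply/eqP; field; rewrite k0 f0.
by rewrite -mulr_suml ler_wpM2r// series_exp_le.
Qed.

Lemma cvg_bessel_poly (z : R) : 0 <= z ->
  bessel_poly n z @[n --> \oo] --> bessel_I1_ratio (Num.sqrt z).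
Proof.
move=> z0.
have cv : cvgn (bessel_poly ^~ z).
  apply: nondecreasing_is_cvgn.
    by apply: nondecreasing_series => k _ _; rewrite mulr_ge0 ?exprn_ge0// bessel_coef_ge0.
  exists (expR z) => _ [n _ <-].
  by rewrite (le_trans (ler_norm _))// bessel_poly_bound// z0 lexx.
rewrite /bessel_I1_ratio; case: eqVneq => [s0|s0].
  have -> : z = 0 by rewrite -(sqr_sqrtr z0) s0 expr0n.
  apply: (cvg_trans (G := (fun=> 2^-1 : R) @ \oo)); last exact: cvg_cst.
  apply: near_eq_cvg; near=> n.
  have n0 : (0 < n)%N by near: n; exact: nbhs_infty_gt.
  rewrite -(prednK n0) /bessel_poly big_nat_recl//= big1 ?addr0 => [|k _]; last by rewrite exprS !mul0r.
  by rewrite !expr0 (_ : (0`! * 1`!)%N = 1%N)// !mulr1 mul1r.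
suff : bessel_I1 (Num.sqrt z) = Num.sqrt z * limn (bessel_poly ^~ z).
  by move=> ->; rewrite mulrAC divff// mul1r.
rewrite /bessel_I1; apply/cvg_lim => //.
rewrite [X in X @ _ --> _](_ : _ = (fun n => Num.sqrt z * bessel_poly n z)).
  by apply: cvgMr.
apply/funext => n; rewrite /series/= /bessel_poly mulr_sumr; apply: eq_bigr => k _.
have -> : (Num.sqrt z / 2) ^+ (2 * k + 1) = Num.sqrt z / 2 * (z ^+ k / 4 ^+ k).
  rewrite addn1 exprS exprM; congr (_ * _).
  rewrite expr_div_n (sqr_sqrtr z0) -expr_div_n; congr ((_ / _) ^+ _).
  by rewrite -natrX.
have f0 : (k`! * (k.+1)`!)%:R != 0 :> R by rewrite pnatr_eq0 -lt0n muln_gt0 !fact_gt0.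
have p0 : 4 ^+ k != 0 :> R by rewrite expf_neq0.
by move: (4 ^+ k : R) ((k`! * (k.+1)`!)%:R : R) p0 f0 => a b p0 f0; field; rewrite p0 f0.
Unshelve. all: by end_near. Qed.

Lemma bessel_ratio_bound (z M : R) : 0 <= z <= M -> `|bessel_I1_ratio (Num.sqrt z)| <= expR M.
Proof.
move=> zM; have z0 : 0 <= z by case/andP: zM.
apply: (cvgr_to_le (cvg_norm (cvg_bessel_poly z0))); apply: nearW => n.
exact: bessel_poly_bound.
Qed.

Lemma bessel_ratio_lip (z w M : R) : 0 <= z <= M -> 0 <= w <= M ->
  `|bessel_I1_ratio (Num.sqrt z) - bessel_I1_ratio (Num.sqrt w)| <= expR M * `|z - w|.
Proof.
move=> zM wM; have z0 : 0 <= z by case/andP: zM.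
have w0 : 0 <= w by case/andP: wM.
have C : bessel_poly n z - bessel_poly n w @[n --> \oo] -->
    bessel_I1_ratio (Num.sqrt z) - bessel_I1_ratio (Num.sqrt w).
  by apply: cvgB; exact: cvg_bessel_poly.
apply: (cvgr_to_le (cvg_norm C)); apply: nearW => n.
exact: bessel_poly_lip.
Qed.

(** A divergent [lim] takes the default value [point]. The extra term covers that case, so bounding
    [Psi_x] amounts to bounding difference quotients. *)
Lemma lim_bounded (F : set_system R) (PF : ProperFilter F) (f : R -> R) (Q : R) :
  (\forall x \near F, `|f x| <= Q) -> `|lim (f x @[x --> F])| <= Q + `|point : R|.
Proof.
move=> fQ; have [cf|/dvgP ->] := pselect (cvg (f x @[x --> F])); last first.
  by rewrite lerDr; have [x /(le_trans (normr_ge0 _))] := filter_ex fQ.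
rewrite (@le_trans _ _ Q) ?lerDl//.
exact: (cvgr_to_le (cvg_norm cf)).
Qed.

Section K1bound.
Variable p : sysdata R.
Variable th : 'cV[R]_2.
Hypothesis ep0 : 0 < eps p.
Hypothesis la0 : 0 < th_lambda th.
Let L := th_lambda th / eps p.
Let L0 : 0 < L. Proof. exact: divr_gt0. Qed.

Let argE (x y : R) : th_lambda th * (x ^+ 2 - y ^+ 2) / eps p = L * (x ^+ 2 - y ^+ 2).
Proof. by rewrite /L mulrAC. Qed.

Let arg_in (x y : R) : 0 <= y -> y <= x -> x <= 2 -> 0 <= L * (x ^+ 2 - y ^+ 2) <= L * 4.
Proof.
move=> y0 yx x2; have h1 : 0 <= x ^+ 2 - y ^+ 2 by nra.
have h2 : x ^+ 2 - y ^+ 2 <= 4 by nra.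
by apply/andP; split; [exact: mulr_ge0 (ltW L0) h1|exact: ler_wpM2l (ltW L0) _ _ h2].
Qed.

Lemma Psi_bound (x y : R) : 0 <= y -> y <= x -> x <= 1 ->
  `|Psi p th x y| <= L * expR (L * 4).
Proof.
move=> y0 yx x1; rewrite /Psi argE -mulrA normrM normrN (ger0_norm (ltW L0)) ler_wpM2l ?(ltW L0)//.
rewrite normrM -[leRHS]mul1r ler_pM//.
  by rewrite ger0_norm// (le_trans y0).
by apply: bessel_ratio_bound; apply: arg_in => //; lra.
Qed.

(** Difference quotients with |x - 1| < 1 are bounded by splitting x r1 - r2 into (x - 1) r1 and r1
    - r2. There x <= 2 keeps the Bessel arguments in [0, 4 L], and x + 1 <= 3 is the origin of the
    factor 3. *)
Lemma Psi_x_bound (y : R) : 0 <= y <= 1 ->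
  `|Psi_x p th 1 y| <= L * (expR (L * 4) + expR (L * 4) * (L * 3)) + `|point : R|.
Proof.
move=> /andP[y0 y1].
have PF : ProperFilter (within `[y, +oo[%classic (1 : R)^').
  apply: Build_ProperFilter_ex => P; rewrite /dnbhs /within/= => /nbhs_ballP[d /= d0 H].
  exists (1 + d / 2); apply: H.
  - by rewrite /ball/= opprD addrA subrr sub0r normrN ger0_norm; lra.
  - by apply/eqP; lra.
  - by rewrite in_itv/= andbT; lra.
apply: lim_bounded; rewrite near_withinE near_withinE; apply/nbhs_ballP.
exists 1 => //= x; rewrite /ball/= distrC ltr_norml => /andP[? xlt] x1.
rewrite in_itv/= andbT => yx.
have x1' : x - 1 != 0 by rewrite subr_eq0.
have x2 : x <= 2 by lra.
have x0 : 0 <= x by lra.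
rewrite normrM normfV ler_pdivrMr ?normr_gt0// /Psi !argE.
set r1 := bessel_I1_ratio _; set r2 := bessel_I1_ratio _.
have -> : - (th_lambda th / eps p) * x * r1 - - (th_lambda th / eps p) * 1 * r2 =
   - L * ((x - 1) * r1 + (r1 - r2)) by rewrite /L; ring.
rewrite normrM normrN (ger0_norm (ltW L0)) -[leRHS]mulrA; apply: (ler_wpM2l (ltW L0)).
rewrite (le_trans (ler_normD _ _))// [leRHS]mulrDl lerD//.
  by rewrite normrM mulrC ler_wpM2r// bessel_ratio_bound// arg_in.
have y2 : y <= 2 by lra.
have H := bessel_ratio_lip (arg_in y0 yx x2) (arg_in y0 y1 (ler1n R 2)).
rewrite (le_trans H)// -[leRHS]mulrA; apply: (ler_wpM2l (expR_ge0 _)).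
have -> : L * (x ^+ 2 - y ^+ 2) - L * (1 ^+ 2 - y ^+ 2) = L * ((x + 1) * (x - 1)) by ring.
rewrite (normrM L) (normrM (x + 1)) (ger0_norm (ltW L0)) -[leRHS]mulrA; apply: (ler_wpM2l (ltW L0)).
by apply: ler_wpM2r => //; rewrite ger0_norm; lra.
Qed.

(** Each summand is bounded: h and h_x by continuity on the edge x = 1, [Psi] and [Psi_x] by the
    Bessel estimates. The bound serves to estimate the feedback integrals through
    [Rintegral_dominated]. *)
Lemma K1_bound (h : 'cV[R]_2 -> R -> R -> R) : is_kernel_h p th (h th) ->
  exists2 C, 0 <= C & forall y, 0 <= y <= 1 -> `|K1 p h th y| <= C.
Proof.
move=> [[[C1h c1h c2h] _ _] _ _ _ _].
have cslice (g : R -> R -> R) : continuous (fun z : R * R => g z.1 z.2) ->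
    {within `[0, 1], continuous (g 1)}.
  move=> cg; apply: continuous_within => y _.
  have pc : ((1 : R), x) @[x --> y] --> ((1 : R), y).
    apply: (@cvg_pair _ _ _ (nbhs y) (nbhs (1 : R)) (nbhs y) _ _ _ (fun _ => 1) (fun x => x)) => //.
    exact: cvg_cst.
  exact: (cvg_comp _ _ pc (cg (1, y))).
have ch : {within `[0, 1], continuous (h th 1)}.
  apply: continuous_within => y _.
  by have [_ /derivable1_diffP/differentiable_continuous] := C1h 1 y.
have [M1 M10 HM1] := itv_bounded ch.
have [M2 M20 HM2] := itv_bounded (cslice _ c1h).
pose r := r_ p th.
pose B := L * expR (L * 4).
have B0 : 0 <= B by rewrite mulr_ge0 ?expR_ge0// ltW.
pose Q := L * (expR (L * 4) + expR (L * 4) * (L * 3)) + `|point : R|.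
have G0 : 0 <= (M2 + `|r| * M1) * B by rewrite mulr_ge0// addr_ge0// mulr_ge0.
have Q0 : 0 <= Q by apply: le_trans (@Psi_x_bound 0 _); rewrite ?lexx ?ler01.
exists (Q + M2 + `|r| * M1 + `|r| * B + (M2 + `|r| * M1) * B).
  have rM : 0 <= `|r| * M1 by exact: mulr_ge0.
  have rB : 0 <= `|r| * B by exact: mulr_ge0.
  by do 4 (apply: addr_ge0 => //).
move=> y y01; have /andP[y0 y1] := y01.
have h1 := Psi_x_bound y01.
have h2 := HM2 y y01.
have h3 : `|r * h th 1 y| <= `|r| * M1 by rewrite normrM ler_wpM2l// HM1.
have h4 : `|r * Psi p th 1 y| <= `|r| * B by rewrite normrM ler_wpM2l// Psi_bound.
have h5 : `|\int[mu]_(z in `[y, 1]) ((d1 (h th) 1 z + r * h th 1 z) * Psi p th z y)| <=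
    (M2 + `|r| * M1) * B.
  apply: (@le_trans _ _ (\int[mu]_(z in `[y, 1]) ((M2 + `|r| * M1) * B))).
    apply: Rintegral_dominated; first exact: integrable_cst.
    move=> z /andP[yz z1]; have z01 : 0 <= z <= 1 by rewrite (le_trans y0).
    rewrite normrM ler_pM ?Psi_bound// (le_trans (ler_normD _ _))// lerD ?HM2//.
    by rewrite normrM ler_wpM2l// HM1.
  rewrite Rintegral_cst//= lebesgue_measure_itv/= lte_fin.
  case: ltP => _ /=; last by rewrite mulr0.
  by rewrite ler_piMr//; lra.
rewrite /K1 -/r (le_trans (ler_normB _ _))// lerD//.
rewrite (le_trans (ler_normD _ _))// lerD//.
rewrite (le_trans (ler_normD _ _))// lerD//.
by rewrite (le_trans (ler_normD _ _))// lerD.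
Qed.

End K1bound.
End gain_bounds.

(** * The kernel [h] and the dependence of [K2] on the parameter *)

Section wave_equation.
Context {R : realType}.
Notation mu := (@lebesgue_measure R).

Lemma is_derive_rD (f g : R -> R) (x a b : R) : is_derive x (1 : R) f a ->
  is_derive x (1 : R) g b -> is_derive x (1 : R) (fun x => f x + g x) (a + b).
Proof. exact: is_deriveD. Qed.

Lemma is_derive_rB (f g : R -> R) (x a b : R) : is_derive x (1 : R) f a ->
  is_derive x (1 : R) g b -> is_derive x (1 : R) (fun x => f x - g x) (a - b).
Proof. exact: is_deriveB. Qed.

Lemma is_derive_rM (f g : R -> R) (x a b : R) : is_derive x (1 : R) f a ->
  is_derive x (1 : R) g b -> is_derive x (1 : R) (fun x => f x * g x) (a * g x + f x * b).
Proof.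
move=> fa gb; have := is_deriveM fa gb; rewrite /GRing.scale/= => H.
by apply: (is_derive_eq H); ring.
Qed.

Lemma is_derive_rZ (k : R) (f : R -> R) (x a : R) : is_derive x (1 : R) f a ->
  is_derive x (1 : R) (fun x => k * f x) (k * a).
Proof. exact: is_deriveZ. Qed.

Lemma plane_continuous_dist (g : R -> R -> R) (x y e : R) :
  continuous (fun z : R * R => g z.1 z.2) -> 0 < e ->
  exists2 d : R, 0 < d & forall x' y', `|x' - x| < d -> `|y' - y| < d ->
    `|g x' y' - g x y| < e.
Proof.
move=> cg e0; have /cvgrPdist_lt/(_ e e0) := cg (x, y).
move=> /nbhs_ballP[d /= d0 H]; exists d => // x' y' hx hy.
rewrite distrC; apply: (H (x', y')); split => /=; rewrite /ball/= distrC//.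
Qed.

Lemma MVT_between (f df : R -> R) (a b : R) : (forall x, is_derive x (1 : R) f (df x)) ->
  exists2 c, Num.min a b <= c <= Num.max a b & f b - f a = df c * (b - a).
Proof.
move=> dF.
have cf (u v : R) : {within `[u, v], continuous f}.
  by apply: continuous_within => x _; exact: is_derive_continuous (dF x).
have [ab|/ltW ba] := leP a b.
  have [c] := MVT_segment ab (fun x _ => dF x) (cf a b).
  by rewrite in_itv/= => cab ->; exists c.
have [c] := MVT_segment ba (fun x _ => dF x) (cf b a).
by rewrite in_itv/= => cab E; exists c => //; rewrite -opprB E -mulrN opprB.
Qed.

Lemma between_dist (a b c : R) : Num.min a b <= c <= Num.max a b -> `|c - a| <= `|b - a|.
Proof.
have [ab|ba] := leP a b => /andP[h1 h2].
  by rewrite !ger0_norm ?lerD2r// subr_ge0.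
by rewrite !ler0_norm ?lerN2 ?lerD2r// subr_le0// ltW.
Qed.

Lemma is_derive_d1 (g : R -> R -> R) (x y : R) : C1_plane g ->
  is_derive x (1 : R) (g ^~ y) (d1 g x y).
Proof. by move=> [/(_ x y)[dg _] _ _]; rewrite /d1 derive1E; exact: derivableP. Qed.

Lemma is_derive_d2 (g : R -> R -> R) (x y : R) : C1_plane g ->
  is_derive y (1 : R) (g x) (d2 g x y).
Proof. by move=> [/(_ x y)[_ dg] _ _]; rewrite /d2 derive1E; exact: derivableP. Qed.

(** Chain rule from continuous partial derivatives, by two mean value steps through the corner (X,
    Y'). The two errors add up to less than (1 + |c|) e / (2 + |c|) < e. It is applied along the
    characteristics c = 1 and c = - 1. *)
Lemma is_derive_line (g : R -> R -> R) (x y c s : R) : C1_plane g ->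
  is_derive s (1 : R) (fun s => g (x + s) (y + c * s))
    (d1 g (x + s) (y + c * s) + c * d2 g (x + s) (y + c * s)).
Proof.
move=> Cg; have [_ c1 c2] := Cg; apply: is_derive_dist => e e0.
set X := x + s; set Y := y + c * s.
have e1 : 0 < e / (2 + `|c|) by rewrite divr_gt0// ltr_wpDr.
have [da da0 Ha] := plane_continuous_dist X Y c1 e1.
have [db db0 Hb] := plane_continuous_dist X Y c2 e1.
pose d := Num.min da db / (1 + `|c|).
have c10 : 0 < 1 + `|c| by rewrite ltr_wpDr.
have d0 : 0 < d by rewrite divr_gt0// lt_min da0.
exists d => // t ts td.
have small : (1 + `|c|) * `|t - s| < Num.min da db by rewrite mulrC -ltr_pdivlMr.
have ts0 : t - s != 0 by rewrite subr_eq0.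
set X' := x + t; set Y' := y + c * t.
have XX : X' - X = t - s by rewrite /X /X'; ring.
have YY : Y' - Y = c * (t - s) by rewrite /Y /Y'; ring.
have [xi xiP xiE] := MVT_between X X' (fun x => is_derive_d1 x Y' Cg).
have [et etP etE] := MVT_between Y Y' (fun y => is_derive_d2 X y Cg).
have xid := between_dist xiP; have etd := between_dist etP.
rewrite XX in xid; rewrite YY normrM in etd.
have tsn := normr_ge0 (t - s); have cn := normr_ge0 c.
have l1 : `|t - s| <= (1 + `|c|) * `|t - s| by rewrite ler_peMl// lerDl.
have l2 : `|c| * `|t - s| <= (1 + `|c|) * `|t - s| by rewrite ler_wpM2r// lerDr.
move: small; rewrite lt_min => /andP[sa sb].
have -> : (g X' Y' - g X Y) / (t - s) = d1 g xi Y' + c * d2 g X et.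
  have -> : g X' Y' - g X Y = (g X' Y' - g X Y') + (g X Y' - g X Y) by ring.
  by rewrite xiE etE XX YY; field.
have -> : d1 g xi Y' + c * d2 g X et - (d1 g X Y + c * d2 g X Y) =
  (d1 g xi Y' - d1 g X Y) + c * (d2 g X et - d2 g X Y) by ring.
have A1 : `|d1 g xi Y' - d1 g X Y| < e / (2 + `|c|).
  by apply: Ha; [exact: le_lt_trans xid (le_lt_trans l1 sa)|rewrite YY normrM; exact: le_lt_trans l2 sa].
have A2 : `|d2 g X et - d2 g X Y| < e / (2 + `|c|).
  apply: Hb; first by rewrite subrr normr0.
  exact: le_lt_trans etd (le_lt_trans l2 sb).
rewrite (le_lt_trans (ler_normD _ _))// normrM.
have := ler_wpM2l cn (ltW A2).
have E : (2 + `|c|) * (e / (2 + `|c|)) = e by rewrite mulrC divfK// gt_eqF// ltr_wpDr.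
move: E A1 e1; set w := e / _; clear; move: (`|c| * _) (`|_ - _|) => a b; lra.
Qed.

(** Schwarz's theorem: the second difference over a small square is expressed by the mean value
    theorem in either order. *)
Lemma mixed_partials_eq (g : R -> R -> R) (x y : R) : C2_plane g ->
  d2 (d1 g) x y = d1 (d2 g) x y.
Proof.
move=> [C1 Cd1 Cd2]; have [_ _ c12] := Cd1; have [_ c21 _] := Cd2.
apply/eqP; rewrite -subr_eq0 -normr_le0; apply/ler_addgt0Pl => e e0; rewrite addr0.
have e2 : 0 < e / 2 by rewrite divr_gt0.
have [da da0 Ha] := plane_continuous_dist x y c12 e2.
have [db db0 Hb] := plane_continuous_dist x y c21 e2.
pose k := Num.min da db / 2.
have k0 : 0 < k by rewrite divr_gt0// lt_min da0.
have km : k < Num.min da db by rewrite /k ltr_pdivrMr// ltr_pMr ?ltr1n// lt_min da0.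
move: km; rewrite lt_min => /andP[ka kb].
have kn : k != 0 by rewrite gt_eqF.
pose D := g (x + k) (y + k) - g x (y + k) - (g (x + k) y - g x y).
have near0 (a c : R) : Num.min a (a + k) <= c <= Num.max a (a + k) -> `|c - a| <= k.
  by move=> /between_dist; rewrite addrAC subrr add0r (ger0_norm (ltW k0)).
have [x1 x1P [y1 y1P E1]] : exists2 x1, `|x1 - x| <= k & exists2 y1, `|y1 - y| <= k &
    D = d2 (d1 g) x1 y1 * k * k.
  have dF z : is_derive z (1 : R) (fun z => g z (y + k) - g z y) (d1 g z (y + k) - d1 g z y).
    by have h1 := is_derive_d1 z (y + k) C1; have h2 := is_derive_d1 z y C1; exact: (is_derive_rB h1 h2).
  have [x1 x1P E] := MVT_between x (x + k) dF.
  exists x1; first exact: near0.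
  have [y1 y1P E'] := MVT_between y (y + k) (fun y => is_derive_d2 x1 y Cd1).
  exists y1; first exact: near0.
  have -> : D = d2 (d1 g) x1 y1 * (y + k - y) * (x + k - x) by rewrite -E' -E /D; ring.
  by ring.
have [x2 x2P [y2 y2P E2]] : exists2 x2, `|x2 - x| <= k & exists2 y2, `|y2 - y| <= k &
    D = d1 (d2 g) x2 y2 * k * k.
  have dF z : is_derive z (1 : R) (fun z => g (x + k) z - g x z) (d2 g (x + k) z - d2 g x z).
    by have h1 := is_derive_d2 (x + k) z C1; have h2 := is_derive_d2 x z C1; exact: (is_derive_rB h1 h2).
  have [y2 y2P E] := MVT_between y (y + k) dF.
  have [x2 x2P E'] := MVT_between x (x + k) (fun z => is_derive_d1 z y2 Cd2).
  exists x2; first exact: near0.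
  exists y2; first exact: near0.
  have -> : D = d1 (d2 g) x2 y2 * (x + k - x) * (y + k - y) by rewrite -E' -E /D; ring.
  by ring.
have EE : d2 (d1 g) x1 y1 = d1 (d2 g) x2 y2.
  move: E1 E2; move: (d2 (d1 g) x1 y1) (d1 (d2 g) x2 y2) => a b -> .
  by move=> /(mulIf kn)/(mulIf kn).
have B1 := Ha x1 y1 (le_lt_trans x1P ka) (le_lt_trans y1P ka).
have B2 := Hb x2 y2 (le_lt_trans x2P kb) (le_lt_trans y2P kb).
move: EE B1 B2; move: (d2 (d1 g) x1 y1) (d1 (d2 g) x2 y2) (d2 (d1 g) x y) (d1 (d2 g) x y).
clear -R => a b c d ->; rewrite !ltr_norml ler_norml => /andP[? ?] /andP[? ?].
by apply/andP; split; lra.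
Qed.

End wave_equation.

(** * Characteristics, a Volterra equation and an explicit convolution *)

Section volterra.
Context {R : realType}.
Notation mu := (@lebesgue_measure R).

(* d'Alembert: [g_x + g_y] is constant along the other characteristic, and it
   vanishes on the diagonal. *)
Lemma triangle_transport (g : R -> R -> R) : C2_plane g ->
  (forall x y, 0 <= y -> y <= x -> x <= 1 -> d2 (d2 g) x y = d1 (d1 g) x y) ->
  (forall x, 0 <= x <= 1 -> d2 g x x + d1 g x x = 0) ->
  forall x y, 0 <= y -> y <= x -> x <= 1 -> d1 g x y + d2 g x y = 0 /\ g x y = g (x - y) 0.
Proof.
move=> C2 wave diag; have [C1 Cd1 Cd2] := C2.
have V0 x y : 0 <= y -> y <= x -> x <= 1 -> d1 g x y + d2 g x y = 0.
  (* The segment (z + s, z - s), 0 <= s <= r, joins the diagonal point (z, z) to (x, y) inside the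
     triangle. *)
  move=> y0 yx x1; pose z := (x + y) / 2; pose r := (x - y) / 2.
  have r0 : 0 <= r by rewrite divr_ge0// subr_ge0.
  have dV s : is_derive s (1 : R) (fun s => d1 g (z + s) (z + -1 * s) + d2 g (z + s) (z + -1 * s))
    (d1 (d1 g) (z + s) (z + -1 * s) + -1 * d2 (d1 g) (z + s) (z + -1 * s) +
     (d1 (d2 g) (z + s) (z + -1 * s) + -1 * d2 (d2 g) (z + s) (z + -1 * s))).
    have h1 := is_derive_line z z (-1) s Cd1; have h2 := is_derive_line z z (-1) s Cd2.
    exact: (is_derive_rD h1 h2).
  have := @eq_of_derive0 R 0 r _ r0 _ _.
  move=> /(_ (fun s => d1 g (z + s) (z + -1 * s) + d2 g (z + s) (z + -1 * s))).
  have -> : z + r = x by rewrite /z /r; field.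
  have -> : z + -1 * r = y by rewrite /z /r; field.
  rewrite mulr0 !addr0 [d1 g z z + _]addrC diag; last first.
    by rewrite /z; apply/andP; split; lra.
  apply.
    by apply: continuous_within => s _; exact: is_derive_continuous (dV s).
  move=> s /andP[s0 sr]; have := dV s.
  rewrite mixed_partials_eq// wave; last 3 first.
  - by move: sr; rewrite /z /r; lra.
  - by move: sr; rewrite /z /r; lra.
  - by move: sr; rewrite /z /r; lra.
  have E (a b : R) : a + -1 * b + (b + -1 * a) = 0 by ring.
  by rewrite E.
move=> x y y0 yx x1; split; first exact: V0.
(* With g_x + g_y = 0 established, g is constant along the segment from (x - y, 0) to (x, y). *)
have dG s : is_derive s (1 : R) (fun s => g (x - y + s) (0 + 1 * s))
    (d1 g (x - y + s) (0 + 1 * s) + 1 * d2 g (x - y + s) (0 + 1 * s)).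
  exact: is_derive_line.
have := @eq_of_derive0 R 0 y _ y0 _ _.
move=> /(_ (fun s => g (x - y + s) (0 + 1 * s))).
rewrite subrK mul1r add0r mulr0 !addr0; apply.
  by apply: continuous_within => s _; exact: is_derive_continuous (dG s).
move=> s /andP[s0 sy]; apply: (is_derive_eq (dG s)).
by rewrite (mul1r (d2 _ _ _)) V0//; lra.
Qed.

(** Iteration of the equation gives |D x| <= M (C x)^n / n! for every n, with C = |k| G. The
    convolution over [0, z] costs only its length z <= 1, and integrating the resulting bound on
    [dD] supplies the new power of x and the factor 1 / (n + 1). *)
Lemma volterra_unique (D dD ga : R -> R) (k : R) :
  (forall x, is_derive x (1 : R) D (dD x)) -> D 0 = 0 ->
  {within `[0, 1], continuous ga} ->
  (forall x, 0 <= x <= 1 -> dD x = k * \int[mu]_(y in `[0, x]) (D (x - y) * ga y)) ->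
  forall x, 0 <= x <= 1 -> D x = 0.
Proof.
move=> hD D0 cga hI.
have [G G0 HG] := itv_bounded cga.
have cD : {within `[0, 1], continuous D}.
  by apply: continuous_within => x _; exact: is_derive_continuous (hD x).
have [M M0 HM] := itv_bounded cD.
pose C := `|k| * G; have C0 : 0 <= C by exact: mulr_ge0.
have step n : forall x, 0 <= x <= 1 -> `|D x| <= M * (C ^+ n / n`!%:R * x ^+ n).
  elim: n => [|n IH] x /andP[x0 x1].
    by rewrite !expr0 fact0 divr1 !mulr1 HM// x0.
  pose A := M * (C ^+ n / n`!%:R).
  have A0 : 0 <= A by rewrite !mulr_ge0// ?exprn_ge0 ?invr_ge0.
  have bD z : 0 <= z <= x -> `|dD z| <= C * A * z ^+ n.
    move=> /andP[z0 zx]; have z1 := le_trans zx x1.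
    rewrite hI ?z0// normrM.
    have -> : C * A * z ^+ n = `|k| * (G * (A * z ^+ n)) by rewrite /C !mulrA.
    apply: ler_wpM2l => //.
    apply: (@le_trans _ _ (\int[mu]_(y in `[0, z]) (G * (A * z ^+ n)))).
      apply: Rintegral_dominated; first exact: integrable_cst.
      move=> y /andP[y0 yz]; rewrite normrM mulrC; apply: ler_pM => //.
        by apply: HG; rewrite y0 (le_trans yz).
      apply: le_trans (IH (z - y) _) _; first by apply/andP; split; lra.
      rewrite mulrA -/A; apply: ler_wpM2l => //.
      by rewrite lerXn2r ?nnegrE//; lra.
    rewrite Rintegral_cst//= lebesgue_measure_itv/= lte_fin.
    have X0 : 0 <= G * (A * z ^+ n) by rewrite !mulr_ge0// exprn_ge0.
    case: ltP => _ /=; last by rewrite mulr0.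
    by rewrite subr0 ler_piMr.
  have fE : C ^+ n.+1 / (n.+1)`!%:R * x ^+ n.+1 * M = C * A / n.+1%:R * x ^+ n.+1.
    rewrite /A factS natrM exprS.
    have f0 : (n`!)%:R != 0 :> R by rewrite pnatr_eq0 -lt0n fact_gt0.
    have f1 : n.+1%:R != 0 :> R by rewrite pnatr_eq0.
    move: (n`!%:R : R) (n.+1%:R : R) f0 f1 => a b f0 f1.
    by field; rewrite f0 f1.
  rewrite mulrC fE.
  have dP z : is_derive z (1 : R) (fun z => C * A / n.+1%:R * z ^+ n.+1) (C * A * z ^+ n).
    have f1 : n.+1%:R != 0 :> R by rewrite pnatr_eq0.
    have hX : is_derive z (1 : R) (fun z : R => z ^+ n.+1) (n.+1%:R * z ^+ n).
      have := derivableP (@exprn_derivable R n.+1 z 1); rewrite exp_derive/= => H.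
      by apply: (is_derive_eq H); rewrite [_%:A]mulr1.
    by apply: (is_derive_eq (is_derive_rZ (C * A / n.+1%:R) hX)); rewrite mulrA divfK.
  have bound (E dE : R -> R) : (forall z, is_derive z (1 : R) E (dE z)) -> E 0 = 0 ->
      (forall z, 0 <= z <= x -> dE z <= C * A * z ^+ n) -> E x <= C * A / n.+1%:R * x ^+ n.+1.
    move=> hE E0 bE.
    pose W := fun z => E z - C * A / n.+1%:R * z ^+ n.+1.
    have dW z : is_derive z (1 : R) W (dE z - C * A * z ^+ n).
      by have h1 := hE z; have h2 := dP z; exact: (is_derive_rB h1 h2).
    have : W x <= W 0.
      apply: (le_of_derive_le0 x0 _ (fun z _ => dW z)).
        by apply: continuous_within => z _; exact: is_derive_continuous (dW z).
      by move=> z /andP[/ltW z0 /ltW zx]; rewrite subr_le0 bE// z0.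
    by rewrite /W E0 expr0n/= mulr0 subr0 subr_le0.
  rewrite ler_norml; apply/andP; split; last first.
    by apply: (bound _ _ hD) => // z zx; apply: le_trans (bD z zx); exact: ler_norm.
  rewrite lerNl; apply: (bound (fun z => - D z) (fun z => - dD z)).
  - by rewrite D0 oppr0.
  - by move=> z zx; apply: le_trans (bD z zx); rewrite -normrN; exact: ler_norm.
move=> x x01; apply/eqP; rewrite -normr_le0.
have c0 : M * exp_coeff (C * x) n @[n --> \oo] --> (0 : R).
  rewrite -[X in _ --> X](mulr0 M); apply: cvgMr.
  exact: cvg_series_cvg_0 (is_cvg_series_exp_coeff _).
apply: (cvgr_to_ge c0); apply: nearW => n; rewrite (le_trans (step n x x01))//.
suff -> : C ^+ n / n`!%:R * x ^+ n = exp_coeff (C * x) n by [].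
have -> : exp_coeff (C * x) n = C ^+ n * x ^+ n / n`!%:R by rewrite -exprMn.
by rewrite mulrAC.
Qed.

Lemma sinh_cos_convolution (k nu x : R) : 0 <= x -> k ^+ 2 + nu ^+ 2 != 0 ->
  \int[mu]_(y in `[0, x]) ((expR (k * (x - y)) - expR (- k * (x - y))) / 2 * cos (nu * y)) =
  k / (k ^+ 2 + nu ^+ 2) * ((expR (k * x) + expR (- k * x)) / 2 - cos (nu * x)).
Proof.
move=> x0 n0.
pose ch y : R := (expR (k * (x - y)) + expR (- k * (x - y))) / 2.
pose sh y : R := (expR (k * (x - y)) - expR (- k * (x - y))) / 2.
have de (c y : R) : is_derive y (1 : R) (fun y => expR (c * (x - y))) (- c * expR (c * (x - y))).
  have -> : (fun y => expR (c * (x - y))) = (fun y => expR (c * x) * expR (- c * y)).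
    by apply/funext => z; rewrite -expRD; congr expR; ring.
  have h := is_derive_expRM (- c) y; apply: is_derive_eq.
  rewrite /GRing.scale/=.
  have -> : expR (c * (x - y)) = expR (c * x) * expR (- c * y).
    by rewrite -expRD; congr expR; ring.
  by ring.
have dch y : is_derive y (1 : R) ch (- k * sh y).
  have h1 := de k y; have h2 := de (- k) y; apply: is_derive_eq.
  by rewrite /GRing.scale/= /sh; field.
have dsh y : is_derive y (1 : R) sh (- k * ch y).
  have h1 := de k y; have h2 := de (- k) y; apply: is_derive_eq.
  by rewrite /GRing.scale/= /ch; field.
(* The primitive found by integrating by parts twice and solving for the integral. *)
pose F y := (- k * (ch y * cos (nu * y)) + nu * (sh y * sin (nu * y))) / (k ^+ 2 + nu ^+ 2).
have dF y : is_derive y (1 : R) F (sh y * cos (nu * y)).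
  have h1 := dch y; have h2 := dsh y.
  have h3 := is_derive_cosM nu y; have h4 := is_derive_sinM nu y.
  apply: is_derive_eq; rewrite /GRing.scale/=; field; exact: n0.
have cF : {within `[0, x], continuous F}.
  by apply: continuous_within => y _; exact: is_derive_continuous (dF y).
have cf : {within `[0, x], continuous (fun y => sh y * cos (nu * y))}.
  apply: within_continuousM; apply: continuous_within => y _.
    exact: is_derive_continuous (dsh y).
  exact: is_derive_continuous (is_derive_cosM nu y).
rewrite (FTC2_within x0 cf cF (fun y _ => dF y)).
rewrite /F /ch /sh subrr !mulr0 expR0 subr0 cos0 sin0; field; exact: n0.
Qed.

End volterra.

(** * The explicit kernel and the resulting formula for the gain K2 *)

Section kernel.
Context {R : realType}.
Notation mu := (@lebesgue_measure R).
Variables (p : sysdata R) (h : 'cV[R]_2 -> R -> R -> R) (th : 'cV[R]_2).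
Hypotheses (ep0 : 0 < eps p) (a0 : 0 < th_a th) (am0 : th_a th < bcoef p * kappa p).
Hypothesis hP : is_kernel_h p th (h th).
Let k := Num.sqrt (th_a th / eps p).
Let nu := Num.sqrt (a_m p th / eps p).
Let ch (x : R) := (expR (k * x) + expR (- k * x)) / 2.
Let sh (x : R) := (expR (k * x) - expR (- k * x)) / 2.
Let b := bcoef p.
Let ka := kappa p.
Let ep := eps p.

(** The derivative of S(x) = - b kappa / sqrt (a eps) * sinh (sqrt (a / eps) * x), where h(x, y) =
    S(x - y). The formula involves [th] only through a, so parameters with the same a share it. *)
Definition kernel_slope (x : R) : R :=
  - (bcoef p * kappa p / eps p) *
  ((expR (Num.sqrt (th_a th / eps p) * x) + expR (- Num.sqrt (th_a th / eps p) * x)) / 2).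

Let S (x : R) := - (b * ka / (ep * k)) * sh x.

Let kE : k ^+ 2 = th_a th / ep.
Proof. by rewrite sqr_sqrtr// ltW// divr_gt0. Qed.
Let nuE : nu ^+ 2 = (b * ka - th_a th) / ep.
Proof. by rewrite sqr_sqrtr// ltW// divr_gt0// subr_gt0. Qed.
Let k0 : k != 0.
Proof. by rewrite gt_eqF// sqrtr_gt0 divr_gt0. Qed.
Let bka0 : b * ka != 0.
Proof. by rewrite gt_eqF// (lt_trans a0). Qed.
Let ka0 : ka != 0.
Proof. by move: bka0; rewrite mulf_eq0 negb_or => /andP[]. Qed.
Let ep_neq0 : ep != 0. Proof. by rewrite gt_eqF. Qed.
Let knu : k ^+ 2 + nu ^+ 2 = b * ka / ep.
Proof. by rewrite kE nuE -mulrDl addrCA subrr addr0. Qed.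

Let cgamma x : {for x, continuous (gamma p th)}.
Proof.
have h1 := is_derive_rZ (- kappa p) (is_derive_cosM nu x).
exact: (is_derive_continuous h1).
Qed.

Let dS (x : R) : is_derive x (1 : R) S (kernel_slope x).
Proof.
have h1 := is_derive_rB (is_derive_expRM k x) (is_derive_expRM (- k) x).
have h2 := is_derive_rZ (- (b * ka / (ep * k)) / 2) h1.
have -> : S = (fun x => - (b * ka / (ep * k)) / 2 * (expR (k * x) - expR (- k * x))).
  by apply/funext => z; rewrite /S /sh; ring.
apply: (is_derive_eq h2); rewrite /kernel_slope -/k -/b -/ka -/ep.
by field; rewrite k0 ep_neq0.
Qed.

(** Since k^2 + nu^2 = b kappa / eps, the constants of the general convolution formula collapse to
    kappa. *)
Let Sconv (x : R) : 0 <= x ->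
  \int[mu]_(y in `[0, x]) (S (x - y) * gamma p th y) = ka * (ch x - cos (nu * x)).
Proof.
move=> x0; have n0 : k ^+ 2 + nu ^+ 2 != 0 by rewrite knu mulf_neq0// invr_neq0.
have cf : {within `[0, x], continuous
    (fun y => (expR (k * (x - y)) - expR (- k * (x - y))) / 2 * cos (nu * y))}.
  have cE c : {within `[0, x], continuous (fun y => expR (c * (x - y)))}.
    apply: (@within_continuous_comp _ _ (fun y => c * (x - y)) expR).
      apply: within_continuousM; first exact: within_continuous_cst.
      apply: within_continuousB; first exact: within_continuous_cst.
      by apply: continuous_within => y _; exact: cvg_id.
    exact: continuous_expR.
  apply: within_continuousM.
    by apply: within_continuousM; [exact: within_continuousB|exact: within_continuous_cst].
  by apply: continuous_within => y _; exact: is_derive_continuous (is_derive_cosM nu y).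
have -> : ka * (ch x - cos (nu * x)) =
    b * ka ^+ 2 / (ep * k) * (k / (k ^+ 2 + nu ^+ 2) * (ch x - cos (nu * x))).
  rewrite knu; move: (ch x - _) => z; move: bka0 k0 ep_neq0; rewrite mulf_eq0 negb_or => /andP[? ?] ? ?.
  by field; do ?(apply/andP; split).
rewrite -(sinh_cos_convolution x0 n0) -RintegralZl//; last exact: integrable_itv.
apply: eq_Rintegral => y _; rewrite /S /sh /gamma -/nu -/ka.
by field; rewrite k0 ep_neq0.
Qed.

(** On the axis h_y = - h_x by [triangle_transport], so the first kernel equation becomes an
    integro-differential Volterra equation for h(x, 0). By [Sconv], S solves the same equation; the
    difference solves the homogeneous one and vanishes. *)
Let kernel_on_axis (x : R) : 0 <= x <= 1 -> h th x 0 = S x.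
Proof.
have [C2 bd wave diag h00] := hP.
have C1 : C1_plane (h th) by case: C2.
have tr := triangle_transport C2 wave diag.
move=> x01; apply/eqP; rewrite -subr_eq0; apply/eqP; move: x x01.
have dF x := is_derive_d1 x 0 C1.
have dD x : is_derive x (1 : R) (fun x => h th x 0 - S x) (d1 (h th) x 0 - kernel_slope x).
  exact: (is_derive_rB (dF x) (dS x)).
have D0 : h th 0 0 - S 0 = 0 by rewrite h00 /S /sh !mulr0 subrr mul0r mulr0 subrr.
apply: (volterra_unique (ga := gamma p th) (k := - (b / ep)) dD D0).
  by apply: continuous_within => x _.
move=> x /andP[x0 x1].
have crev (f : R -> R) : (forall z, {for z, continuous f}) ->
    {within `[0, x], continuous (fun y => f (x - y))}.
  move=> cf; apply: (@within_continuous_comp _ _ (fun y => x - y) f) => //.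
  apply: within_continuousB; first exact: within_continuous_cst.
  by apply: continuous_within => y _; exact: cvg_id.
have cg : {within `[0, x], continuous (gamma p th)} by apply: continuous_within => z _.
have iF : mu.-integrable `[0, x] (EFin \o (fun y => h th (x - y) 0 * gamma p th y)).
  apply: integrable_itv; apply: within_continuousM => //.
  by apply: (crev (fun z => h th z 0)) => z; exact: is_derive_continuous (dF z).
have iS : mu.-integrable `[0, x] (EFin \o (fun y => S (x - y) * gamma p th y)).
  apply: integrable_itv; apply: within_continuousM => //.
  by apply: (crev S) => z; exact: is_derive_continuous (dS z).
have -> : \int[mu]_(y in `[0, x]) ((h th (x - y) 0 - S (x - y)) * gamma p th y) =
   \int[mu]_(y in `[0, x]) (h th (x - y) 0 * gamma p th y) - ka * (ch x - cos (nu * x)).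
  rewrite -Sconv// -RintegralB//; apply: eq_Rintegral => y _; exact: mulrBl.
have x01 : 0 <= x <= 1 by rewrite x0.
have := bd x x01; have [+ _] := tr x 0 (lexx _) x0 x1.
have -> : \int[mu]_(y in `[0, x]) (h th x y * gamma p th y) =
   \int[mu]_(y in `[0, x]) (h th (x - y) 0 * gamma p th y).
  apply: eq_Rintegral => y; rewrite inE/= in_itv/= => /andP[y0 yx].
  by have [_ ->] := tr x y y0 yx x1.
rewrite /kernel_slope -/k -/b -/ka -/ep -/(ch x) /gamma -/ka -/nu.
move: (\int[mu]_(y in _) _) (d1 _ _ _) (d2 _ _ _) (ch x) (cos _) => I e1 e2 c1 c2.
move=> E1 E2; have {E1} E1 : e2 = - e1 by lra.
rewrite E1 in E2; apply: (mulfI ep_neq0).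
have -> : ep * (- (b / ep) * (I - ka * (c1 - c2))) = - b * (I - ka * (c1 - c2)) by field.
have -> : ep * (e1 - - (b * ka / ep) * c1) = ep * e1 + b * ka * c1 by field.
by lra.
Qed.

(** This form isolates lambda, which enters only through [r_]. The coefficient of [r_] is gamma(1)
    minus the integral of h gamma; the cosines cancel by [Sconv] and leave - kappa cosh (sqrt (a /
    eps)). *)
Lemma K2E : K2 p h th = derive1 (gamma p th) 1
  - \int[mu]_(y in `[0, 1]) (kernel_slope (1 - y) * gamma p th y)
  - r_ p th * (kappa p * ((expR (Num.sqrt (th_a th / eps p)) + expR (- Num.sqrt (th_a th / eps p))) / 2)).
Proof.
have [C2 bd wave diag h00] := hP.
have C1 : C1_plane (h th) by case: C2.
have [_ c1 _] := C1.
have tr := triangle_transport C2 wave diag.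
have hS y : 0 <= y <= 1 -> h th 1 y = S (1 - y).
  move=> /andP[y0 y1]; have [_ ->] := tr 1 y y0 y1 (lexx _).
  by apply: kernel_on_axis; apply/andP; split; lra.
have cg : {within `[0, 1], continuous (gamma p th)} by apply: continuous_within => z _.
have ch1 : {within `[0, 1], continuous (h th 1)}.
  by apply: continuous_within => y _; exact: is_derive_continuous (is_derive_d2 1 y C1).
have cd1 : {within `[0, 1], continuous (d1 (h th) 1)}.
  apply/within_continuousP => y _ e e0.
  have [d d0 H] := plane_continuous_dist 1 y c1 e0.
  by exists d => // y' _ yy; apply: H => //; rewrite subrr normr0.
(* The identity h(x, y) = S(x - y) is known for x <= 1 only, so the derivative in x on the edge x =
   1 is recovered from the one in y through h_x + h_y = 0. Differentiating in y needs 0 < y < 1,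
   which suffices under the integral. *)
have dh y : 0 < y < 1 -> d1 (h th) 1 y = kernel_slope (1 - y).
  move=> /andP[y0 y1]; have [E _] := tr 1 y (ltW y0) (ltW y1) (lexx _).
  suff : d2 (h th) 1 y = - kernel_slope (1 - y) by move=> E2; lra.
  have [_ D1] := is_derive_d2 1 y C1.
  have hr : is_derive y (1 : R) (fun y => S (1 - y)) (- kernel_slope (1 - y)).
    have hB : is_derive y (1 : R) (fun y : R => 1 - y) (-1).
      by have := is_derive_rB (is_derive_cst (1 : R) y 1) (is_derive_id y (1 : R)); rewrite sub0r.
    have := @is_derive1_comp R S (fun y => 1 - y) y _ _ (dS (1 - y)) hB.
    by rewrite mulrN1.
  have [_ D2] : is_derive y (1 : R) (h th 1) (- kernel_slope (1 - y)).
    apply: near_eq_is_derive hr; near=> z; rewrite hS//.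
    apply/andP; split; apply/ltW; near: z; [exact: lt_nbhsr|exact: lt_nbhsl].
  by rewrite -D1 D2.
have i1 : mu.-integrable `[0, 1] (EFin \o (fun y => d1 (h th) 1 y * gamma p th y)).
  by apply: integrable_itv; exact: within_continuousM.
have i2 : mu.-integrable `[0, 1] (EFin \o (fun y => h th 1 y * gamma p th y)).
  by apply: integrable_itv; exact: within_continuousM.
have I1 : \int[mu]_(y in `[0, 1]) (d1 (h th) 1 y * gamma p th y) =
    \int[mu]_(y in `[0, 1]) (kernel_slope (1 - y) * gamma p th y).
  have cks : {within `[0, 1], continuous (fun y => kernel_slope (1 - y) * gamma p th y)}.
    apply: within_continuousM => //; apply: within_continuousM; first exact: within_continuous_cst.
    have cE c : {within `[0, 1], continuous (fun y : R => expR (c * (1 - y)))}.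
      apply: (@within_continuous_comp _ _ (fun y => c * (1 - y)) expR); last exact: continuous_expR.
      apply: within_continuousM; first exact: within_continuous_cst.
      apply: within_continuousB; first exact: within_continuous_cst.
      by apply: continuous_within => y _; exact: cvg_id.
    by apply: within_continuousM; [exact: within_continuousD|exact: within_continuous_cst].
  have mS (g : R -> R) : mu.-integrable `[0, 1] (EFin \o g) -> measurable_fun (`]0, 1[ : set R) g.
    move=> /integrableP[/measurable_EFinP mg _]; apply: measurable_funS mg => // x.
    by rewrite /= !in_itv/= => /andP[/ltW -> /ltW ->].
  rewrite /Rintegral; congr fine; apply: eq_integral_itv_bounded.
  - exact: mS.
  - by apply: mS; exact: integrable_itv.
  - by move=> y; rewrite in_itv/= => y01; rewrite dh.
have I2 : \int[mu]_(y in `[0, 1]) (h th 1 y * gamma p th y) = ka * (ch 1 - cos (nu * 1)).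
  rewrite -Sconv//; apply: eq_Rintegral => y; rewrite inE/= in_itv/= => y01; rewrite hS//.
rewrite /K2.
have -> : \int[mu]_(y in `[0, 1]) ((d1 (h th) 1 y + r_ p th * h th 1 y) * gamma p th y) =
  \int[mu]_(y in `[0, 1]) (kernel_slope (1 - y) * gamma p th y) + r_ p th * (ka * (ch 1 - cos (nu * 1))).
  rewrite -I1 -I2 -RintegralZl// -RintegralD//; last exact: integrable_rZ.
  by apply: eq_Rintegral => y _; rewrite mulrDl mulrA.
rewrite {2}/gamma -/nu -/ka /ch !mulr1 -/k; ring.
Unshelve. all: by end_near. Qed.

End kernel.

(** * Uniqueness of the zero of K2 in lambda *)

Section K2unique.
Context {R : realType}.
Variables (p : sysdata R) (h : 'cV[R]_2 -> R -> R -> R).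
Hypotheses (plantP : plant_assumptions p) (gainP : gain_assumptions p h).

Lemma K2_zero_unique th1 th2 : Theta p th1 -> Theta p th2 -> th_a th1 = th_a th2 ->
  K2 p h th1 = 0 -> K2 p h th2 = 0 -> th_lambda th1 = th_lambda th2.
Proof.
have [ep0 bn0 [_ _ alo0 _] _ _] := plantP; have [am kerP] := gainP.
move=> T1 T2 Ea.
have a1 th : Theta p th -> 0 < th_a th by move=> [_ /andP[+ _]]; exact: lt_le_trans.
have a2 th : Theta p th -> th_a th < bcoef p * kappa p.
  by move=> [_ /andP[_ h2]]; exact: le_lt_trans h2 am.
rewrite (K2E ep0 (a1 _ T1) (a2 _ T1) (kerP _ T1)) (K2E ep0 (a1 _ T2) (a2 _ T2) (kerP _ T2)).
have gE : gamma p th1 = gamma p th2 by rewrite /gamma /a_m Ea.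
have sE : kernel_slope p th1 = kernel_slope p th2 by rewrite /kernel_slope Ea.
rewrite gE sE Ea; set c := (expR _ + _) / 2; set A := derive1 _ _ - _.
have ka0 : kappa p != 0.
  have : bcoef p * kappa p != 0 by rewrite gt_eqF// (lt_trans (a1 _ T1))// a2.
  by rewrite mulf_eq0 negb_or => /andP[].
have c0 : c != 0 by rewrite gt_eqF// divr_gt0// addr_gt0 ?expR_gt0.
have kc0 : kappa p * c != 0 by rewrite mulf_neq0.
move: (kappa p * c) kc0 => kc kc0 E1 E2.
have : r_ p th1 = r_ p th2 by apply: (mulIf kc0); lra.
rewrite /r_ => /addrI/oppr_inj; apply: mulIf.
by rewrite invr_eq0 mulf_neq0// gt_eqF.
Qed.

End K2unique.

(** * The triggering times *)

Section triggering.
Context {R : realType}.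
Notation mu := (@lebesgue_measure R).
Variables (p : sysdata R) (h : 'cV[R]_2 -> R -> R -> R).
Variables (u : R -> R -> R) (zeta m : R -> R) (tk : nat -> R) (that : R -> 'cV[R]_2).
Hypotheses (plantP : plant_assumptions p) (gainP : gain_assumptions p h).
Hypotheses (designP : design_conditions p h).
Hypotheses (odeP : ode_solution p u zeta) (L2P : L2_continuous u).
Hypotheses (trigP : trigger_rule p h u zeta m tk that) (idP : identifier p u zeta tk that).
Hypothesis th0P : Theta p (that 0).

Let xi0 : 0 < xi p. Proof. by case: designP => -[]. Qed.
Let T0 : 0 < Tmax p. Proof. by case: designP => -[]. Qed.
Let tk0 : tk 0%N = 0. Proof. by case: trigP. Qed.

Lemma Theta_estimates i : Theta p (that (tk i)).
Proof. by case: i => [|i]; [rewrite tk0|have [_ /(_ i) [[]]] := idP]. Qed.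

Lemma K1_bounded th : Theta p th -> exists2 C : R, 0 <= C &
  forall y, 0 <= y <= 1 -> `|K1 p h th y| <= C.
Proof.
move=> T; have [ep0 _ [ll0 _ _ _] _ _] := plantP; have [_ /(_ th T) hk] := gainP.
apply: K1_bound => //; have [/andP[+ _] _] := T; exact: lt_le_trans.
Qed.

Lemma zeta_increment (s t : R) : 0 <= s -> s <= t ->
  zeta t - zeta s = \int[mu]_(r in `[s, t]) (acoef p * zeta r + bcoef p * u 0 r).
Proof.
move=> s0 st; have [it Et] := odeP (le_trans s0 st); have [_ Es] := odeP s0.
by rewrite Et Es (Rintegral_cat s0 st it); ring.
Qed.

Lemma zeta_continuous (T : R) : 0 <= T -> {within `[0, T], continuous zeta}.
Proof.
move=> T_0; have [iT _] := odeP T_0.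
have := within_continuousD (@within_continuous_cst _ _ (zeta 0)) (parameterized_integral_continuous T_0 iT).
move=> /within_continuousP H; apply/within_continuousP => x xI e e0.
have [d d_0 Hd] := H x xI e e0; exists d => // y yI yx.
have := Hd y yI yx; rewrite /parameterized_integral.
have x0 : 0 <= x by move: xI; rewrite /= in_itv/= => /andP[].
have y0 : 0 <= y by move: yI; rewrite /= in_itv/= => /andP[].
by have [_ <-] := odeP x0; have [_ <-] := odeP y0.
Qed.

Lemma zeta_dist (s e : R) : 0 <= s -> 0 < e -> exists2 d : R, 0 < d &
  forall t, 0 <= t -> `|t - s| < d -> `|zeta t - zeta s| < e.
Proof.
move=> s0 e0.
have s1 : 0 <= s + 1 by lra.
have /within_continuousP H := zeta_continuous s1.
have [|d d0 Hd] := H s _ e e0; first by rewrite /= in_itv/=; apply/andP; split; lra.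
exists (Num.min d 1); first by rewrite lt_min d0 ltr01.
move=> t t0; rewrite lt_min => /andP[td]; rewrite ltr_norml => /andP[_ t1].
by apply: Hd => //; rewrite /= in_itv/=; apply/andP; split; lra.
Qed.

Lemma u_L1_dist (s e : R) : 0 <= s -> 0 < e -> exists2 d : R, 0 < d &
  forall t, 0 <= t -> `|t - s| < d -> \int[mu]_(x in `[0, 1]) `|u x t - u x s| < e.
Proof.
move=> s0 e0; have [inL2 cont] := L2P.
have /cvgrPdist_lt/(_ e e0) := cont s s0.
rewrite near_withinE => /nbhs_ballP[d /= d0 H]; exists d => // t t0 ts.
have := H t; rewrite /ball/= distrC => /(_ ts); rewrite in_itv/= andbT => /(_ t0).
rewrite sub0r normrN => /(le_lt_trans (ler_norm _)); apply: le_lt_trans.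
by apply: L1_le_L2norm; apply: in_L2B; exact: inL2.
Qed.

Lemma feedback_bound th (C : R) (w : R -> R) (z : R) : 0 <= C ->
  (forall y, 0 <= y <= 1 -> `|K1 p h th y| <= C) ->
  mu.-integrable `[0, 1] (EFin \o w) ->
  `|\int[mu]_(y in `[0, 1]) (K1 p h th y * w y) + K2 p h th * z| <=
  C * \int[mu]_(y in `[0, 1]) `|w y| + `|K2 p h th| * `|z|.
Proof.
move=> C0 HC iw; have iw' := integrable_rnorm iw.
rewrite (le_trans (ler_normD _ _))// normrM lerD// -RintegralZl//.
apply: Rintegral_dominated; first exact: integrable_rZ.
by move=> y y01; rewrite normrM ler_wpM2r// HC.
Qed.

Let mcont : {within `[0, +oo[, continuous m}. Proof. by case: trigP. Qed.

Lemma m_dist (s e : R) : 0 <= s -> 0 < e -> exists2 d : R, 0 < d &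
  forall t, 0 <= t -> `|t - s| < d -> `|m t - m s| < e.
Proof.
move=> s0 e0; have /within_continuousP H := mcont.
have [|d d0 Hd] := H s _ e e0; first by rewrite /= in_itv/= s0.
by exists d => // t t0 ts; apply: Hd => //; rewrite /= in_itv/= t0.
Qed.

(* Near any time at which [m] is negative the trigger cannot fire, whatever
   the time of the last update. *)
Lemma no_trigger_near th (s : R) : Theta p th -> 0 <= s -> m s < 0 ->
  exists2 r : R, 0 < r & forall t t', 0 <= t -> 0 <= t' -> `|t - s| < r -> `|t' - s| < r ->
    (\int[mu]_(y in `[0, 1]) (K1 p h th y * (u y t - u y t')) +
       K2 p h th * (zeta t - zeta t')) ^+ 2 < - xi p * m t.
Proof.
move=> T s0 ms; have [C C0 HC] := K1_bounded T.
(* [rho] is half of the threshold at time s. Near s one has m t < m s / 2, so the threshold stays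
   above [rho], while [e] is chosen to keep the deviation within min (1, rho) / 2; being below 1, it
   has a square below [rho]. *)
pose rho := - xi p * m s / 2.
have rho0 : 0 < rho by rewrite /rho divr_gt0// nmulr_rgt0// oppr_lt0.
pose e := Num.min 1 rho / (4 * (C + `|K2 p h th| + 1)).
have K0 : 0 < C + `|K2 p h th| + 1 by rewrite ltr_wpDl// addr_ge0.
have e0 : 0 < e by rewrite divr_gt0// ?mulr_gt0// lt_min ltr01.
have [da da0 Ha] := u_L1_dist s0 e0.
have [db db0 Hb] := zeta_dist s0 e0.
have m0 : 0 < - m s / 2 by rewrite divr_gt0// oppr_gt0.
have [dc dc0 Hc] := m_dist s0 m0.
exists (Num.min da (Num.min db dc)); first by rewrite !lt_min da0 db0.
move=> t t' t0 t'0; rewrite !lt_min => /andP[ta /andP[tb tc]] /andP[t'a /andP[t'b t'c]].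
have [inL2 _] := L2P.
have iu r : 0 <= r -> mu.-integrable `[0, 1] (EFin \o (u ^~ r)).
  by move=> /inL2; exact: in_L2_integrable.
have B1 : \int[mu]_(y in `[0, 1]) `|u y t - u y t'| <= 2 * e.
  apply: (@le_trans _ _ (\int[mu]_(y in `[0, 1]) (`|u y t - u y s| + `|u y t' - u y s|))).
    apply: le_Rintegral => //.
    - by apply: integrable_rnorm; apply: integrable_rB; exact: iu.
    - by apply: integrable_rD; apply: integrable_rnorm;
         apply: integrable_rB; exact: iu.
    - move=> y _; have -> : u y t - u y t' = (u y t - u y s) - (u y t' - u y s) by ring.
      exact: ler_normB.
  rewrite RintegralD//; last 2 first.
  - by apply: integrable_rnorm; apply: integrable_rB; exact: iu.
  - by apply: integrable_rnorm; apply: integrable_rB; exact: iu.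
  by have := Ha t t0 ta; have := Ha t' t'0 t'a; lra.
have B2 : `|zeta t - zeta t'| <= 2 * e.
  have -> : zeta t - zeta t' = (zeta t - zeta s) - (zeta t' - zeta s) by ring.
  rewrite (le_trans (ler_normB _ _))//.
  by have := Hb t t0 tb; have := Hb t' t'0 t'b; lra.
have iw : mu.-integrable `[0, 1] (EFin \o (fun y => u y t - u y t')).
  by apply: integrable_rB; exact: iu.
have B3 := feedback_bound (zeta t - zeta t') C0 HC iw.
set X := _ + _ in B3 *.
have X1 : `|X| <= Num.min 1 rho / 2.
  apply: (le_trans B3); apply: (@le_trans _ _ ((C + `|K2 p h th| + 1) * (2 * e))).
    have := ler_wpM2l C0 B1; have := ler_wpM2l (normr_ge0 (K2 p h th)) B2.
    by move: e0; rewrite !mulrDl; lra.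
  by rewrite /e le_eqVlt; apply/orP; left; apply/eqP; field; rewrite gt_eqF.
have X2 : X ^+ 2 < rho.
  rewrite -real_normK ?num_real//.
  have h1 : Num.min 1 rho <= 1 by rewrite ge_min lexx.
  have h2 : Num.min 1 rho <= rho by rewrite ge_min lexx orbT.
  have h3 := normr_ge0 X.
  have : `|X| ^+ 2 <= `|X| by rewrite expr2 ler_piMr//; lra.
  by lra.
apply: lt_trans X2 _; rewrite /rho.
have := Hc t t0 tc; rewrite ltr_norml => /andP[_ h4].
rewrite -mulrA !mulNr ltrN2 -subr_gt0 -mulrBr mulr_gt0//.
by lra.
Qed.

Let devE i t : dev p h u zeta tk that i t =
  \int[mu]_(y in `[0, 1]) (K1 p h (that (tk i)) y * (u y t - u y (tk i))) +
  K2 p h (that (tk i)) * (zeta t - zeta (tk i)).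
Proof. by []. Qed.

Lemma next_trigger_ge i (B : R) :
  (forall s, tk i < s < B -> dev p h u zeta tk that i s ^+ 2 < - xi p * m s) ->
  Num.min B (tk i + Tmax p) <= tk i.+1.
Proof.
move=> H; have [_ /(_ i) E _ _ _] := trigP.
rewrite -lee_fin E EFin_min ge_min le_min; apply/orP.
have [c|c] := leP B (tk i + Tmax p).
  left; apply/andP; split; last by rewrite lee_fin.
  apply: le_ereal_inf_tmp => _ [s [is_ hs] <-]; rewrite lee_fin leNgt; apply/negP => sB.
  by have := H s; rewrite is_ sB => /(_ isT); rewrite ltNge hs.
right; rewrite le_min lexx andbT.
apply: le_ereal_inf_tmp => _ [s [is_ hs] <-]; rewrite lee_fin leNgt; apply/negP => sB.
by have := H s; rewrite is_ (lt_trans sB c) => /(_ isT); rewrite ltNge hs.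
Qed.

Lemma no_trigger_between i s : tk i < s < tk i.+1 ->
  dev p h u zeta tk that i s ^+ 2 < - xi p * m s.
Proof.
move=> /andP[is_ si]; rewrite ltNge; apply/negP => hs.
have [_ /(_ i) E _ _ _] := trigP.
suff : ((tk i.+1)%:E <= s%:E)%E by rewrite lee_fin leNgt si.
rewrite E ge_min; apply/orP; left; apply: ereal_inf_lbound; exists s => //.
Qed.

(** While the trigger is silent d^2 < - xi m, so m' <= - c m with this rate. *)
Let c := Defs.eta p + lambda_d p * xi p.

(** The claims need each other. Negativity of m at [tk i] keeps the trigger silent for some time, so
    the next event is strictly later; silence up to [tk i.+1] makes m exp (c t) nonincreasing there,
    so m is still negative at that event. *)
Lemma trigger_progress i : [/\ 0 <= tk i, tk i < tk i.+1 &
  forall t, 0 <= t <= tk i -> m t * expR (c * t) <= m 0].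
Proof.
have [_ _ _ m00 dm] := trigP.
have [[_ eta0 ld0 _] _ [k10 k20 k30 k40] _] := designP.
have neg t : m t * expR (c * t) <= m 0 -> m t < 0.
  move=> H; rewrite -(pmulr_llt0 _ (expR_gt0 (c * t))); exact: le_lt_trans m00.
have adv i' : 0 <= tk i' -> m (tk i') * expR (c * tk i') <= m 0 -> tk i' < tk i'.+1.
  move=> i0 /neg mi; have [r r0 Hr] := no_trigger_near (Theta_estimates i') i0 mi.
  apply: lt_le_trans (@next_trigger_ge i' (tk i' + r) _); first by rewrite lt_min !ltrDl r0.
  move=> s /andP[s1 s2]; rewrite devE; apply: Hr => //.
  - exact: le_trans (ltW s1).
  - by rewrite ger0_norm; lra.
  - by rewrite subrr normr0.
elim: i => [|i [i0 ii Hi]].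
  have H (t : R) : 0 <= t <= tk 0%N -> m t * expR (c * t) <= m 0.
    rewrite tk0 => /andP[h1 h2]; have -> : t = 0 by apply/le_anti; rewrite h1 h2.
    by rewrite mulr0 expR0 mulr1.
  by split=> //; [rewrite tk0|apply: adv; [rewrite tk0|apply: H; rewrite tk0 lexx]].
have H t : 0 <= t <= tk i.+1 -> m t * expR (c * t) <= m 0.
  move=> /andP[t0 ti]; have [tl|tl] := leP t (tk i); first by apply: Hi; rewrite t0.
  apply: (@le_trans _ _ (m (tk i) * expR (c * tk i))); last by apply: Hi; rewrite i0 lexx.
  pose dmt s := - Defs.eta p * m s + lambda_d p * dev p h u zeta tk that i s ^+ 2
           - kappa1 p * u 1 s ^+ 2 - kappa2 p * u 0 s ^+ 2
           - kappa3 p * L2norm (u ^~ s) ^+ 2 - kappa4 p * zeta s ^+ 2.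
  have dW s : tk i < s < t -> is_derive s (1 : R) (fun s => m s * expR (c * s))
      (dmt s * expR (c * s) + m s * (c * expR (c * s))).
    move=> /andP[s1 s2]; apply: is_derive_rM; last exact: is_derive_expRM.
    by apply: dm; rewrite s1 (lt_le_trans s2).
  apply: (le_of_derive_le0 (ltW tl) _ dW).
    apply: within_continuousM.
      by apply: continuous_subspaceW mcont => s; rewrite /= !in_itv/= andbT => /andP[/(le_trans i0)].
    by apply: continuous_within => s _; exact: is_derive_continuous (is_derive_expRM c s).
  move=> s /andP[s1 s2].
  have hd : dev p h u zeta tk that i s ^+ 2 < - xi p * m s.
    by apply: no_trigger_between; rewrite s1 (lt_le_trans s2).
  have -> : dmt s * expR (c * s) + m s * (c * expR (c * s)) = (dmt s + c * m s) * expR (c * s) by ring.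
  apply: mulr_le0_ge0; last exact: expR_ge0.
  have := ler_wpM2l (ltW ld0) (ltW hd).
  have := mulr_ge0 (ltW k10) (sqr_ge0 (u 1 s)); have := mulr_ge0 (ltW k20) (sqr_ge0 (u 0 s)).
  have := mulr_ge0 (ltW k30) (sqr_ge0 (L2norm (u ^~ s))); have := mulr_ge0 (ltW k40) (sqr_ge0 (zeta s)).
  rewrite /dmt /c; move: (lambda_d p * _ ^+ 2) (kappa1 p * _) (kappa2 p * _) (kappa3 p * _) (kappa4 p * _).
  move=> y1 y2 y3 y4 y5; lra.
have i1 : 0 <= tk i.+1 by exact: le_trans i0 (ltW ii).
by split=> //; apply: adv => //; apply: H; rewrite i1 lexx.
Qed.

Lemma tk_ge0 i : 0 <= tk i. Proof. by have [] := trigger_progress i. Qed.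

Lemma tk_lt i : tk i < tk i.+1. Proof. by have [] := trigger_progress i. Qed.

Lemma tk_le i j : (i <= j)%N -> tk i <= tk j.
Proof. by apply: (homo_leq (r := fun a b => a <= b)) => // [x y z|k]; [exact: le_trans|exact/ltW/tk_lt]. Qed.

(** The radius given by [no_trigger_near] depends on the parameter, which is why the estimate is
    required to be constant from some index on. At an accumulation time [ts] one radius then serves
    all late events, and the successor of a late event falls beyond [ts]. *)
Lemma triggers_diverge th (i0 : nat) : (forall i, (i0 <= i)%N -> that (tk i) = th) ->
  forall t, exists i, t < tk i.
Proof.
move=> Hth t; apply: contrapT => nex.
have ub : has_ubound (range tk).
  by exists t => _ [i _ <-]; rewrite leNgt; apply/negP => ti; apply: nex; exists i.
have cv : tk n @[n --> \oo] --> sup (range tk).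
  by apply: nondecreasing_cvgn => // i j; exact: tk_le.
set ts := sup _ in cv.
have le_ts i : tk i <= ts by apply: ub_le_sup => //; exists i.
have ts0 : 0 <= ts by rewrite -tk0.
have T : Theta p th by rewrite -(Hth i0 (leqnn _)); exact: Theta_estimates.
(* At the events m is at most m 0 exp (- c tk n) <= m 0 exp (- c ts), because m 0 < 0 and tk n <=
   ts; continuity transfers this to [ts]. *)
have mts : m ts < 0.
  apply: (@le_lt_trans _ _ (m 0 * expR (- c * ts))); last first.
    by rewrite pmulr_llt0 ?expR_gt0//; case: trigP.
  apply/ler_addgt0Pr => e e0.
  have [d d0 Hd] := m_dist ts0 e0.
  have /cvgrPdist_lt/(_ d d0)[n _ Hn] := cv.
  have := Hn n (leqnn n); rewrite distrC => /(Hd _ (tk_ge0 n)).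
  rewrite ltr_norml => /andP[+ _].
  have [_ _ /(_ (tk n))] := trigger_progress n; rewrite tk_ge0 lexx => /(_ isT) mn.
  suff : m (tk n) <= m 0 * expR (- c * ts) by lra.
  have m00 : m 0 < 0 by case: trigP.
  have c0 : 0 <= c by have [[_ eta0 ld0 _] _ _ _] := designP; rewrite addr_ge0 ?mulr_ge0 ?ltW.
  apply: (@le_trans _ _ (m 0 * expR (- c * tk n))).
    by rewrite mulNr expRN ler_pdivlMr ?expR_gt0.
  by rewrite (ler_nM2l m00) ler_expR !mulNr lerN2 ler_wpM2l.
have [r r0 Hr] := no_trigger_near T ts0 mts.
(* Being within [Tmax p] of [ts] ensures that the forced event at tk k + Tmax p is also later than
   [ts]. *)
pose d := Num.min r (Tmax p).
have d0 : 0 < d by rewrite lt_min r0.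
have /cvgrPdist_lt/(_ d d0)[n _ Hn] := cv.
pose k := maxn n i0.
have kn := Hn k (leq_maxl _ _).
have tk_k : `|tk k - ts| < d by rewrite distrC.
have : Num.min (ts + r) (tk k + Tmax p) <= tk k.+1.
  apply: next_trigger_ge => s /andP[s1 s2]; rewrite devE (Hth _ (leq_maxr _ _)).
  have s0 : 0 <= s by exact: le_trans (tk_ge0 k) (ltW s1).
  move: tk_k; rewrite lt_min => /andP[kr _].
  apply: Hr => //; first exact: tk_ge0.
  by move: kr; rewrite !ltr_norml => /andP[? _]; apply/andP; split; lra.
move=> H; have := le_trans H (le_ts k.+1).
move: kn; rewrite lt_min => /andP[_]; rewrite ltr_norml => /andP[_ kT].
rewrite ge_min => /orP[|]; lra.
Qed.

End triggering.

(** * Integrability on joined intervals and up to the end points *)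

Section integrability.
Context {R : realType}.
Notation mu := (@lebesgue_measure R).

Lemma integrable_itv_cat (a b c : R) (f : R -> R) : a <= b -> b <= c ->
  mu.-integrable `[a, b] (EFin \o f) -> mu.-integrable `[b, c] (EFin \o f) ->
  mu.-integrable `[a, c] (EFin \o f).
Proof.
move=> ab bc fab fbc.
have -> : `[a, c]%classic = `[a, b]%classic `|` `[b, c]%classic :> set R.
  apply/seteqP; split => x /=; rewrite !in_itv/=.
    by move=> /andP[ax xc]; have [xb|/ltW bx] := leP x b; [left|right]; apply/andP.
  by move=> [|] /andP[h1 h2]; apply/andP; split => //; [exact: le_trans bc|exact: le_trans h1].
have /integrableP[m1 i1] := fab.
have fbc' : mu.-integrable `]b, c] (EFin \o f).
  by apply: integrableS fbc => //; apply: subset_itvr; rewrite bnd_simp.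
have /integrableP[m2 i2] := fbc'.
have eU : `[a, b]%classic `|` `[b, c]%classic = `[a, b]%classic `|` `]b, c]%classic :> set R.
  apply/seteqP; split => x /= [h1|]; rewrite ?in_itv/=; [by left| |by left|].
    move=> /andP[bx xc]; move: bx; rewrite le_eqVlt => /predU1P[<-|bx]; last by right; rewrite bx.
    by left; rewrite ab lexx.
  by move=> /andP[/ltW bx xc]; right; rewrite bx.
rewrite eU; apply/integrableP; split; first by apply/measurable_funU.
rewrite ge0_integral_setU//; first exact: lte_add_pinfty.
- by apply: measurableT_comp => //; apply/measurable_funU.
- by apply/disj_setPS => x [/=]; rewrite !in_itv/= => /andP[_ xb] /andP[bx _]; move: (lt_le_trans bx xb); rewrite ltxx.
Qed.

(** The compact intervals [F n] exhaust the open interval and monotone convergence carries the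
    uniform bound over; the end points form a null set. *)
Lemma integrable_of_bounded_sub (a b B : R) (f : R -> R) : a < b ->
  (forall x, a < x < b -> {for x, continuous f}) ->
  (forall c d, a < c -> c <= d -> d < b -> \int[mu]_(x in `[c, d]) `|f x| <= B) ->
  mu.-integrable `[a, b] (EFin \o f).
Proof.
move=> ab cf HB.
(* The shift n + 3 ensures 2 r n < b - a already for n = 0, so that no [F n] is empty. *)
pose r (n : nat) : R := (b - a) / n.+3%:R.
have r0 n : 0 < r n by rewrite divr_gt0// subr_gt0.
have r2 n : r n + r n < b - a.
  rewrite -mulr2n -mulr_natr -mulrA gtr_pMr ?subr_gt0//.
  by rewrite mulrC ltr_pdivrMr// mul1r ltr_nat.
pose F n : set R := `[a + r n, b - r n]%classic.
have Fcont n : {within F n, continuous f}.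
  apply: continuous_within => x; rewrite /F /= in_itv/= => /andP[h1 h2].
  by apply: cf; have rn := r0 n; apply/andP; split; lra.
have UF : \bigcup_n F n = `]a, b[%classic.
  apply/seteqP; split => x /=.
    by move=> [n _]; rewrite /F/= !in_itv/= => /andP[h1 h2]; have rn := r0 n; apply/andP; split; lra.
  rewrite in_itv/= => /andP[ax xb].
  pose e := Num.min (x - a) (b - x).
  have e0 : 0 < e by rewrite lt_min !subr_gt0 ax.
  pose n := Num.bound ((b - a) / e).
  have : (b - a) / e < n%:R by apply: archi_boundP; rewrite divr_ge0 ?ltW// subr_gt0.
  rewrite ltr_pdivrMr// => hn; exists n => //; rewrite /F/= in_itv/=.
  have rn : r n <= e.
    rewrite /r ler_pdivrMr// (le_trans (ltW hn))// mulrC ler_wpM2l ?(ltW e0)// ler_nat.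
    by rewrite -addn3 leq_addr.
  by move: rn; rewrite le_min => /andP[h1 h2]; apply/andP; split; lra.
have Fmono : {homo F : n k / (n <= k)%N >-> (n <= k)%O}.
  move=> n k nk; rewrite subsetEset /F => x /=; rewrite !in_itv/= => /andP[h1 h2].
  have : r k <= r n.
    by rewrite /r ler_wpM2l ?subr_ge0 ?(ltW ab)// lef_pV2 ?posrE// ler_nat !ltnS.
  by move=> rr; apply/andP; split; lra.
have mFn n : measurable_fun (F n) (EFin \o f).
  by have /integrableP[] := integrable_itv (Fcont n).
have mf : measurable_fun (`]a, b[ : set R) f.
  rewrite -UF; apply/measurable_fun_bigcup => n; first by rewrite /F.
  by have /measurable_EFinP := mFn n.
apply/integrableP; split; first by apply/measurable_EFinP; exact: measurable_fun_itv_cc mf.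
rewrite (_ : (\int[mu]_(x in `[a, b]) `|(EFin \o f) x|)%E = (\int[mu]_(x in `]a, b[) `|(EFin \o f) x|)%E); last first.
  by rewrite integral_itv_bndoo//; apply/measurable_EFinP; apply: measurableT_comp.
apply: (@le_lt_trans _ _ B%:E); last exact: ltry.
have := @ge0_nondecreasing_set_cvg_integral _ (measurableTypeR R) R F (fun x => `|(EFin \o f) x|%E) mu Fmono _ _ _.
rewrite UF => H; have {}H := H (fun n => measurable_itv _) _ _.
apply: (cvge_to_le (H _ _)).
- by move=> n; apply: measurableT_comp => //; exact: mFn.
- by move=> n x _; exact: abse_ge0.
apply: nearW => n.
have iF := integrable_rnorm (integrable_itv (Fcont n)).
rewrite -[leLHS]fineK; last by apply: (integrable_fin_num _ iF).
rewrite lee_fin; apply: HB; have := r0 n; have := r2 n; lra.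
Qed.
End integrability.

(** * Values of sine and cosine at multiples of pi *)

Section trigonometry.
Context {R : realType}.
Lemma sin_pi_nat (n : nat) : sin (pi * n%:R) = 0 :> R.
Proof.
elim: n => [|n IH]; first by rewrite mulr0 sin0.
by rewrite -natr1 mulrDr mulr1 sinDpi IH oppr0.
Qed.

Lemma cos_pi_nat (n : nat) : cos (pi * n%:R) = (-1) ^+ n :> R.
Proof.
elim: n => [|n IH]; first by rewrite mulr0 cos0 expr0.
by rewrite -natr1 mulrDr mulr1 cosDpi IH exprS mulN1r.
Qed.
End trigonometry.

(** * The regression satisfied along solutions *)

Section regression.
Context {R : realType}.
Notation mu := (@lebesgue_measure R).
Variables (p : sysdata R) (h : 'cV[R]_2 -> R -> R -> R).
Variables (u : R -> R -> R) (zeta m : R -> R) (tk : nat -> R) (that : R -> 'cV[R]_2).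
Hypotheses (plantP : plant_assumptions p) (gainP : gain_assumptions p h).
Hypotheses (designP : design_conditions p h).
Hypotheses (odeP : ode_solution p u zeta) (L2P : L2_continuous u).
Hypothesis pdeP : pde_solution p h u zeta tk that.
Hypotheses (trigP : trigger_rule p h u zeta m tk that) (idP : identifier p u zeta tk that).
Hypothesis th0P : Theta p (that 0).

Let ep0 : 0 < eps p. Proof. by case: plantP. Qed.
Let bn0 : bcoef p != 0. Proof. by case: plantP. Qed.
Let tge0 := tk_ge0 plantP gainP designP odeP L2P trigP idP th0P.
Let tlt := tk_lt plantP gainP designP odeP L2P trigP idP th0P.
Let tk0 : tk 0%N = 0. Proof. by case: trigP. Qed.
Let s_ := sin_coef u.

Lemma u_integrable t : 0 <= t -> mu.-integrable `[0, 1] (EFin \o (u ^~ t)).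
Proof. by move=> t0; apply: in_L2_integrable; have [H _] := L2P; exact: H. Qed.

Let csin (k : R) (A : set R) : {within A, continuous (fun x => sin (k * x))}.
Proof. by apply: continuous_within => x _; exact: is_derive_continuous (is_derive_sinM k x). Qed.

Lemma sin_integrable n t : 0 <= t ->
  mu.-integrable `[0, 1] (EFin \o (fun x => sin (pi * n%:R * x) * u x t)).
Proof.
move=> t0; have iu := u_integrable t0.
apply: (@integrable_dom _ _ _ _ (fun x => `|u x t|)); last exact: integrable_rnorm.
  apply: measurable_funM; last by have /integrableP[/measurable_EFinP] := iu.
  by have /integrableP[/measurable_EFinP] := integrable_itv (@csin (pi * n%:R) `[0, 1]).
move=> x _; rewrite normrM ler_piMl// ler_norml; apply/andP; split; [exact: sin_geN1|exact: sin_le1].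
Qed.

Lemma sin_coef_bound n t : 0 <= t -> `|s_ n t| <= \int[mu]_(x in `[0, 1]) `|u x t|.
Proof.
move=> t0; have iu := u_integrable t0.
apply: Rintegral_dominated; first exact: integrable_rnorm.
move=> x _; rewrite normrM ler_piMl// ler_norml; apply/andP; split; [exact: sin_geN1|exact: sin_le1].
Qed.

(** Continuity holds across the events too, since it comes from continuity in L^2 rather than from
    the classical solution. *)
Lemma sin_coef_continuous n (T : R) : {within `[0, T], continuous (s_ n)}.
Proof.
apply/within_continuousP => s; rewrite /= in_itv/= => /andP[s0 sT] e e0.
have [d d0 Hd] := u_L1_dist L2P s0 e0.
exists d => // t; rewrite /= in_itv/= => /andP[t0 tT] ts.
apply: le_lt_trans (Hd t t0 ts).
have -> : s_ n t - s_ n s = \int[mu]_(x in `[0, 1]) (sin (pi * n%:R * x) * (u x t - u x s)).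
  rewrite /s_ /sin_coef -RintegralB//; [|exact: sin_integrable|exact: sin_integrable].
  by apply: eq_Rintegral => x _; rewrite mulrBr.
apply: Rintegral_dominated.
  by apply: integrable_rnorm; apply: integrable_rB; exact: u_integrable.
move=> x _; rewrite normrM ler_piMl// ler_norml; apply/andP; split; [exact: sin_geN1|exact: sin_le1].
Qed.

(** The time derivative of [sin_coef u n] between events. The fluxes at both ends are weighted by
    sin (pi n x), which vanishes there, so the input does not appear and only boundary values of u
    remain. *)
Definition sin_rate n t : R :=
  eps p * pi * n%:R * (u 0 t - (-1) ^+ n * u 1 t)
  + (lambda p - eps p * (pi * n%:R) ^+ 2) * sin_coef u n t.

Lemma u_time_continuous x i t : 0 <= x <= 1 -> tk i < t < tk i.+1 -> {for t, continuous (u x)}.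
Proof.
move=> x01 ti; have [ut [ux [uxx [_ _ H]]]] := pdeP.
have [Hx _ _ _ _] := H i t ti.
by have [d _ _] := Hx x x01; exact: is_derive_continuous d.
Qed.

Let pde_itv i : exists ut ux uxx : R -> R -> R, [/\
  {within [set z : R * R | 0 <= z.1 <= 1 /\ tk i < z.2 < tk i.+1], continuous (fun z => ut z.1 z.2)},
  forall x t, 0 <= x <= 1 -> tk i < t < tk i.+1 ->
    [/\ is_derive t (1 : R) (u x) (ut x t), is_deriv_on `[0, 1] (u ^~ t) x (ux x t),
        is_deriv_on `[0, 1] (ux ^~ t) x (uxx x t) & ut x t = eps p * uxx x t + lambda p * u x t],
  forall t, tk i < t < tk i.+1 -> {within `[0, 1], continuous (uxx ^~ t)} &
  forall t, tk i < t < tk i.+1 ->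
    ux 0 t = 0 /\ ux 1 t + qcoef p * u 1 t = Ud p h u zeta tk that i].
Proof.
have [ut [ux [uxx [c1 _ H]]]] := pdeP; exists ut, ux, uxx; split.
- by apply: continuous_subspaceW c1 => z /= [z1 z2]; split=> //; exists i.
- by move=> x t x01 ti; have [/(_ x x01) [h1 h2 h3] _ /(_ x x01) h4 _ _] := H i t ti.
- by move=> t ti; have [] := H i t ti.
- by move=> t ti; have [] := H i t ti.
Qed.

Lemma sin_coef_derive n i t : tk i < t < tk i.+1 ->
  is_derive t (1 : R) (s_ n) (sin_rate n t).
Proof.
move=> ti; have [ut [ux [uxx [cut D cuxx bc]]]] := pde_itv i.
have d1' x s (x01 : 0 <= x <= 1) (si : tk i < s < tk i.+1) : is_derive s (1 : R) (u x) (ut x s) by have [] := D x s x01 si.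
have d2' x s (x01 : 0 <= x <= 1) (si : tk i < s < tk i.+1) : is_deriv_on `[0, 1] (u ^~ s) x (ux x s) by have [] := D x s x01 si.
have d3' x s (x01 : 0 <= x <= 1) (si : tk i < s < tk i.+1) : is_deriv_on `[0, 1] (ux ^~ s) x (uxx x s) by have [] := D x s x01 si.
have d4' x s (x01 : 0 <= x <= 1) (si : tk i < s < tk i.+1) : ut x s = eps p * uxx x s + lambda p * u x s by have [] := D x s x01 si.
pose k := pi * n%:R : R.
have dd x : is_derive x (1 : R) (fun x => k * cos (k * x)) (- k ^+ 2 * sin (k * x)).
  by apply: (is_derive_eq (is_derive_rZ k (is_derive_cosM k x))); ring.
have := heat_weighted_derive cut d1' d2' d3' cuxx d4' ti (is_derive_sinM k) dd.
have [-> _] := bc t ti.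
rewrite !mulr1 !mulr0 cos0 /k sin_pi_nat cos_pi_nat => H.
by apply: (is_derive_eq H); rewrite /sin_rate /sin_coef; ring.
Qed.

(** The ODE is given in integrated form; it holds pointwise where [u 0] is continuous, that is
    between events. *)
Lemma zeta_derive i t : tk i < t < tk i.+1 ->
  is_derive t (1 : R) zeta (acoef p * zeta t + bcoef p * u 0 t).
Proof.
move=> ti; have /andP[t1 t2] := ti; have i0 := tge0 i.
have i1 := tge0 i.+1.
have [it _] := odeP i1.
have cz : {for t, continuous zeta}.
  apply: (continuous_at_within _ (zeta_continuous odeP i1)).
  exists (Num.min (t - tk i) (tk i.+1 - t)); first by rewrite lt_min !subr_gt0 t1.
  move=> y; rewrite lt_min => /andP[]; rewrite ltr_norml => /andP[? _]; rewrite ltr_norml => /andP[_ ?].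
  by rewrite /= in_itv/=; apply/andP; split; lra.
have cf : {for t, continuous (fun s => acoef p * zeta s + bcoef p * u 0 s)}.
  apply: cvgD; apply: cvgMr => //.
  by apply: (u_time_continuous _ ti); rewrite lexx ler01.
have t0 : 0 < t < tk i.+1 by rewrite (le_lt_trans i0).
have H := is_derive_Rintegral t0 it cf.
have H2 := is_derive_rD (is_derive_cst (zeta 0) t 1) H.
rewrite add0r in H2.
apply: near_eq_is_derive H2; near=> s.
have s0 : 0 <= s by apply/ltW; near: s; apply: lt_nbhsr; case/andP: t0.
by have [_ ->] := odeP s0.
Unshelve. all: by end_near. Qed.

(** The dynamics of m bounds the L^1 norm of [u 1] on all compact subintervals uniformly, and
    [integrable_of_bounded_sub] extends this to the events. *)
Lemma u1_integrable_event i : mu.-integrable `[tk i, tk i.+1] (EFin \o (u 1)).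
Proof.
have [_ _ mc _ dm] := trigP.
have [[xi0 eta0 ld0 _] _ [k10 k20 k30 k40] _] := designP.
have i0 := tge0 i.
have cmi : {within `[tk i, tk i.+1], continuous m}.
  by apply: continuous_subspaceW mc => s; rewrite /= !in_itv/= andbT => /andP[/(le_trans i0)].
have [M M0 HM] := itv_bounded cmi.
pose c0 := Defs.eta p + lambda_d p * xi p.
have c00 : 0 <= c0 by rewrite addr_ge0 ?mulr_ge0 ?ltW.
pose B' := c0 * M + kappa1 p.
have x01 : 0 <= (1 : R) <= 1 by rewrite ler01 lexx.
apply: (@integrable_of_bounded_sub _ _ _ ((2 * M + B' * (tk i.+1 - tk i)) / (2 * kappa1 p))).
- exact: tlt.
- by move=> t ti; exact: (u_time_continuous x01 ti).
move=> c d ac cd db.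
have ci s : c <= s <= d -> tk i < s < tk i.+1 by move=> /andP[? ?]; apply/andP; split; lra.
(* c and d are interior to [a', b'], so the primitive [W] is differentiable on the whole closed
   interval [c, d]. *)
pose a' := (tk i + c) / 2; pose b' := (d + tk i.+1) / 2.
have ti := tlt i.
have cab s : a' <= s <= b' -> tk i < s < tk i.+1.
  by rewrite /a' /b' => /andP[? ?]; apply/andP; split; lra.
have cu1 s : tk i < s < tk i.+1 -> {for s, continuous (fun s => `|u 1 s|)}.
  by move=> si; apply: (continuous_comp (u_time_continuous x01 si)); exact: norm_continuous.
have iab e f : (forall s, e <= s <= f -> tk i < s < tk i.+1) ->
    mu.-integrable `[e, f] (EFin \o (fun s => `|u 1 s|)).
  by move=> ef; apply: integrable_itv; apply: continuous_within => s; rewrite /= in_itv/= => /ef; exact: cu1.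
pose W t := \int[mu]_(s in `[a', t]) `|u 1 s|.
pose dmt s := - Defs.eta p * m s + lambda_d p * dev p h u zeta tk that i s ^+ 2
           - kappa1 p * u 1 s ^+ 2 - kappa2 p * u 0 s ^+ 2
           - kappa3 p * L2norm (u ^~ s) ^+ 2 - kappa4 p * zeta s ^+ 2.
(* V is nonincreasing: m' <= c0 M - kappa1 u(1)^2, and 2 |u(1)| <= u(1)^2 + 1 trades the square for
   the absolute value. [B'] collects the constants. *)
pose V t := m t + 2 * kappa1 p * W t - B' * t.
have dV s : c <= s <= d -> is_derive s (1 : R) V (dmt s + 2 * kappa1 p * `|u 1 s| - B' * 1).
  move=> scd; have si := ci s scd.
  have sab : a' < s < b' by move: scd; rewrite /a' /b' => /andP[? ?]; apply/andP; split; lra.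
  have hW := is_derive_Rintegral sab (iab _ _ cab) (cu1 s si).
  exact: (is_derive_rB (is_derive_rD (dm i s si) (is_derive_rZ (2 * kappa1 p) hW))
    (is_derive_rZ B' (is_derive_id s (1 : R)))).
have VV : V d <= V c.
  apply: (@le_of_derive_le0 _ c d V (fun s => dmt s + 2 * kappa1 p * `|u 1 s| - B' * 1)) => //.
  - by apply: continuous_within => s; rewrite /= in_itv/= => /dV; exact: is_derive_continuous.
  - by move=> s /andP[/ltW s1 /ltW s2]; apply: dV; rewrite s1 s2.
  move=> s /andP[/ltW s1 /ltW s2]; have scd : c <= s <= d by rewrite s1 s2.
  have si := ci s scd.
  have hd := no_trigger_between trigP si.
  have h1 := ler_wpM2l (ltW ld0) (ltW hd).
  have h2 := mulr_ge0 (ltW k20) (sqr_ge0 (u 0 s)).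
  have h3 := mulr_ge0 (ltW k30) (sqr_ge0 (L2norm (u ^~ s))).
  have h4 := mulr_ge0 (ltW k40) (sqr_ge0 (zeta s)).
  have h5 := mulr_ge0 (ltW k10) (sqr_ge0 (`|u 1 s| - 1)).
  have h6 : - m s <= M.
    have : tk i <= s <= tk i.+1 by case/andP: si => /ltW -> /ltW ->.
    by move=> /HM; rewrite ler_norml => /andP[? _]; lra.
  have h7 := ler_wpM2l c00 h6.
  rewrite sqrrB1 real_normK ?num_real// in h5.
  move: h1 h2 h3 h4 h5 h7; rewrite /dmt /B' /c0.
  move: (dev _ _ _ _ _ _ _ _ ^+ 2) (kappa2 p * _) (kappa3 p * _) (kappa4 p * _) => y1 y2 y3 y4.
  move: (u 1 s ^+ 2) (`|u 1 s|) (m s) => v w ms.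
  rewrite !mulrDr !mulrDl !mulrN !mulNr mulr1; move=> *.
  lra.
have cI : \int[mu]_(s in `[c, d]) `|u 1 s| = W d - W c.
  have a'c : a' <= c by rewrite /a'; lra.
  rewrite [W d](Rintegral_cat a'c cd); first by rewrite addrC addKr.
  by apply: iab => s /andP[h1 h2]; apply: cab; rewrite h1 (le_trans h2)// /b'; lra.
rewrite cI ler_pdivlMr ?mulr_gt0//.
have Mc : m c <= M.
  have : tk i <= c <= tk i.+1 by apply/andP; split; lra.
  by move=> /HM; rewrite ler_norml => /andP[].
have Md : - m d <= M.
  have : tk i <= d <= tk i.+1 by apply/andP; split; lra.
  by move=> /HM; rewrite ler_norml => /andP[? _]; lra.
have B'0 : 0 <= B' by exact: addr_ge0 (mulr_ge0 c00 M0) (ltW k10).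
have dc : d - c <= tk i.+1 - tk i by lra.
have h8 := ler_wpM2l B'0 dc.
have -> : (W d - W c) * (2 * kappa1 p) = 2 * kappa1 p * W d - 2 * kappa1 p * W c by ring.
rewrite mulrBr in h8.
move: VV; rewrite /V; lra.
Qed.

Lemma u1_integrable j : mu.-integrable `[0, tk j] (EFin \o (u 1)).
Proof.
elim: j => [|j IH]; last exact: integrable_itv_cat (tge0 j) (ltW (tlt j)) IH (u1_integrable_event j).
by rewrite tk0; apply: integrable_itv; rewrite set_itv1; exact: continuous_subspace1.
Qed.

(** The integrand of the ODE is integrable; subtract the continuous part [acoef p * zeta] and divide
    by [bcoef p]. *)
Lemma u0_integrable j : mu.-integrable `[0, tk j] (EFin \o (u 0)).
Proof.
have [it _] := odeP (tge0 j).
have iz : mu.-integrable `[0, tk j] (EFin \o zeta).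
  by apply: integrable_itv; exact: (zeta_continuous odeP (tge0 j)).
have := integrable_rZ (bcoef p)^-1 (integrable_rB it (integrable_rZ (acoef p) iz)).
apply: eq_integrable => // x _ /=; congr (_%:E).
by rewrite addrAC subrr add0r mulKf.
Qed.

Lemma sin_rate_integrable n j : mu.-integrable `[0, tk j] (EFin \o (sin_rate n)).
Proof.
apply: integrable_rD; apply: integrable_rZ.
  by apply: integrable_rB; [exact: u0_integrable|apply: integrable_rZ; exact: u1_integrable].
by apply: integrable_itv; exact: sin_coef_continuous.
Qed.

(** On each inter-event interval the difference [P] of the two sides has derivative 0. It is
    continuous across events, since the rate is integrable over all of [0, tk j], so induction joins
    the intervals. *)
Lemma sin_coef_integral n j t : 0 <= t <= tk j ->
  s_ n t - s_ n 0 = \int[mu]_(r in `[0, t]) sin_rate n r.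
Proof.
pose P t := s_ n t - s_ n 0 - \int[mu]_(r in `[0, t]) sin_rate n r.
suff H : 0 <= t <= tk j -> P t = 0 by move=> /H /eqP; rewrite subr_eq0 => /eqP.
elim: j t => [|j IH] t.
  rewrite tk0 => /andP[h1 h2]; have -> : t = 0 by lra.
  by rewrite /P set_itv1 Rintegral_set1 !subrr.
move=> /andP[t0 tj]; have [tl|tl] := leP t (tk j); first by apply: IH; rewrite t0.
rewrite -[RHS](IH (tk j)); last by rewrite tge0 lexx.
have cP : {within `[0, tk j.+1], continuous P}.
  apply: within_continuousB.
    by apply: within_continuousB; [exact: sin_coef_continuous|exact: within_continuous_cst].
  exact: (parameterized_integral_continuous (tge0 _) (sin_rate_integrable n j.+1)).
apply: eq_of_derive0; first exact: ltW.
  apply: continuous_subspaceW cP => s; rewrite /= !in_itv/= => /andP[s1 s2].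
  by rewrite (le_trans (tge0 j) s1) (le_trans s2 tj).
move=> s /andP[s1 s2]; have sj : tk j < s < tk j.+1 by rewrite s1 (lt_le_trans s2).
have s0 : 0 < s < tk j.+1 by rewrite (le_lt_trans (tge0 j) s1) (lt_le_trans s2).
have hs := sin_coef_derive n sj.
have cr : {for s, continuous (sin_rate n)}.
  apply: cvgD; apply: cvgMr; last exact: (is_derive_continuous hs).
  apply: cvgB; first by apply: (u_time_continuous _ sj); rewrite lexx ler01.
  by apply: cvgMr; apply: (u_time_continuous _ sj); rewrite lexx ler01.
have hI := is_derive_Rintegral s0 (sin_rate_integrable n j.+1) cr.
have := is_derive_rB (is_derive_rB hs (is_derive_cst (s_ n 0) s 1)) hI.
by rewrite subr0 subrr.
Qed.

(** The combination of [sin_coef] and [zeta] in [f_] is balanced so that u(0, .) cancels: its weight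
    eps pi n in [sin_rate] equals w b. The integral in [f_] removes the terms in u(1, .) and the
    diffusion, and what is left is multiplied by lambda or by a. *)
Lemma f_decomposition n j (nu t : R) : 0 <= nu -> nu <= t -> t <= tk j ->
  f_ p u zeta n t nu = lambda p * g1_ u n t nu + acoef p * g2_ p zeta n t nu.
Proof.
move=> n0 nt tj.
have sub (f : R -> R) : mu.-integrable `[0, tk j] (EFin \o f) -> mu.-integrable `[nu, t] (EFin \o f).
  by move=> H; apply: integrableS H => //; apply: subset_itvScc; rewrite bnd_simp.
pose w := eps p * pi * n%:R / bcoef p.
have is_ : mu.-integrable `[nu, t] (EFin \o (s_ n)).
  by apply: sub; apply: integrable_itv; exact: sin_coef_continuous.
have iz : mu.-integrable `[nu, t] (EFin \o zeta).
  by apply: sub; apply: integrable_itv; exact: (zeta_continuous odeP (tge0 j)).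
have iu0 := sub _ (u0_integrable j); have iu1 := sub _ (u1_integrable j).
have ir := sub _ (sin_rate_integrable n j).
have ds : s_ n t - s_ n nu = \int[mu]_(r in `[nu, t]) sin_rate n r.
  have t0 : 0 <= t <= tk j by rewrite (le_trans n0 nt).
  have nu0 : 0 <= nu <= tk j by rewrite n0 (le_trans nt tj).
  have E1 := sin_coef_integral n t0; have E2 := sin_coef_integral n nu0.
  rewrite (Rintegral_cat n0 nt) in E1; last first.
    by apply: integrableS (sin_rate_integrable n j) => //; apply: subset_itvScc; rewrite bnd_simp.
  by rewrite -E2 in E1; lra.
have dz := zeta_increment odeP n0 nt.
pose E r := eps p * pi * n%:R * (-1) ^+ n * u 1 r + eps p * pi ^+ 2 * n%:R ^+ 2 * s_ n r.
have iE : mu.-integrable `[nu, t] (EFin \o E) by apply: integrable_rD; exact: integrable_rZ.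
have io : mu.-integrable `[nu, t] (EFin \o (fun r => acoef p * zeta r + bcoef p * u 0 r)).
  by apply: integrable_rD; exact: integrable_rZ.
have -> : f_ p u zeta n t nu = (s_ n t - s_ n nu) - w * (zeta t - zeta nu) + \int[mu]_(r in `[nu, t]) E r.
  by rewrite /f_ -/w -/s_; ring.
have -> : lambda p * g1_ u n t nu + acoef p * g2_ p zeta n t nu =
    lambda p * (\int[mu]_(r in `[nu, t]) s_ n r) + (- (w * acoef p)) * \int[mu]_(r in `[nu, t]) zeta r.
  by rewrite /g1_ /g2_ -/w -/s_; ring.
rewrite ds dz -!RintegralZl// -!RintegralB// -?RintegralD//.
- apply: eq_Rintegral => r _; rewrite /sin_rate -/(s_ n r) /E /w; field; exact: bn0.
- exact: integrable_rZ.
- exact: integrable_rZ.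
- by apply: integrable_rB => //; exact: integrable_rZ.
- exact: integrable_rZ.
Qed.

Definition true_theta : 'cV[R]_2 := \col_(j < 2) [:: lambda p; acoef p]`_j.

Lemma true_theta_in : Theta p true_theta.
Proof. by have [_ _ _ H _] := plantP; rewrite /Theta/= /th_lambda /th_a !mxE. Qed.

Lemma mu_next_bounds i : 0 <= mu_next p tk i <= tk i.
Proof.
rewrite /mu_next; apply/andP; split.
  by elim/big_ind: _ => [|x y x0 y0|k _]; rewrite ?le_min ?x0 ?y0 ?tge0.
by elim/big_rec: _ => [|k x _ xt]; rewrite ?lexx// ge_min xt orbT.
Qed.

Let g1_cont n i : {within `[mu_next p tk i, tk i.+1], continuous (fun t => g1_ u n t (mu_next p tk i))}.
Proof.
have /andP[m0 mi] := mu_next_bounds i; have mt := le_trans mi (ltW (tlt i)).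
apply: (parameterized_integral_continuous mt); apply: integrable_itv.
apply: continuous_subspaceW (@sin_coef_continuous n (tk i.+1)) => s.
by rewrite /= !in_itv/= => /andP[/(le_trans m0) -> ->].
Qed.

Let g2_cont n i : {within `[mu_next p tk i, tk i.+1], continuous (fun t => g2_ p zeta n t (mu_next p tk i))}.
Proof.
have /andP[m0 mi] := mu_next_bounds i; have mt := le_trans mi (ltW (tlt i)).
apply: within_continuousM; first exact: within_continuous_cst.
apply: (parameterized_integral_continuous mt); apply: integrable_itv.
apply: continuous_subspaceW (zeta_continuous odeP (tge0 i.+1)) => s.
by rewrite /= !in_itv/= => /andP[/(le_trans m0) -> ->].
Qed.

(** Integrating the regression against g1 and g2 over the window gives the normal equations of a
    least-squares problem, which the true parameter satisfies. *)
Lemma Z_eq i n : Z_ p u zeta tk i n = G_ p u zeta tk i n *m true_theta.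
Proof.
have /andP[m0 mi] := mu_next_bounds i; have mt := le_trans mi (ltW (tlt i)).
have E (G : R -> R -> R) : {within `[mu_next p tk i, tk i.+1], continuous (fun t => G t (mu_next p tk i))} ->
  window_int p tk i G (f_ p u zeta n) =
  lambda p * window_int p tk i G (g1_ u n) + acoef p * window_int p tk i G (g2_ p zeta n).
  move=> cG; rewrite /window_int -!RintegralZl//; last 2 first.
  - by apply: integrable_itv; apply: within_continuousM => //; exact: g2_cont.
  - by apply: integrable_itv; apply: within_continuousM => //; exact: g1_cont.
  rewrite -RintegralD//; last 2 first.
  - by apply: integrable_rZ; apply: integrable_itv; apply: within_continuousM => //; exact: g1_cont.
  - by apply: integrable_rZ; apply: integrable_itv; apply: within_continuousM => //; exact: g2_cont.
  apply: eq_Rintegral => t; rewrite inE/= in_itv/= => /andP[t1 t2].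
  by rewrite (f_decomposition n m0 t1 t2); ring.
have sym F G : window_int p tk i F G = window_int p tk i G F.
  by apply: eq_Rintegral => t _; exact: mulrC.
apply/colP => j; rewrite !mxE !big_ord_recl big_ord0 addr0 !mxE /=.
case: j => -[|[|//]] /= _; rewrite E; [|exact: g1_cont| |exact: g2_cont].
  by rewrite [lambda p * _]mulrC [acoef p * _]mulrC.
by rewrite [window_int p tk i (g2_ _ _ _) (g1_ _ _)]sym [lambda p * _]mulrC [acoef p * _]mulrC.
Qed.

Lemma true_theta_feasible i : feasible p u zeta tk i true_theta.
Proof. by split; [exact: true_theta_in|move=> n _; exact: Z_eq]. Qed.

End regression.

(** * Identification *)

Section identification.
Context {R : realType}.
Notation mu := (@lebesgue_measure R).
Variables (p : sysdata R) (h : 'cV[R]_2 -> R -> R -> R).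
Variables (u : R -> R -> R) (zeta m : R -> R) (tk : nat -> R) (that : R -> 'cV[R]_2).
Hypotheses (plantP : plant_assumptions p) (gainP : gain_assumptions p h).
Hypotheses (designP : design_conditions p h).
Hypotheses (odeP : ode_solution p u zeta) (L2P : L2_continuous u).
Hypothesis pdeP : pde_solution p h u zeta tk that.
Hypotheses (trigP : trigger_rule p h u zeta m tk that) (idP : identifier p u zeta tk that).
Hypothesis initP : Theta1 p h u zeta (that 0).
Hypothesis nonzeroP : ~ (L2_zero (u ^~ 0) /\ zeta 0 = 0).

Lemma Theta1_sub : Theta p (that 0).
Proof.
have [th [T [nd d]]] := initP.
have [deg|/nd -> //] := pselect [/\ L2_zero (u ^~ 0), zeta 0 <> 0 & K2 p h th = 0].
have [_ l1 l2] := d deg; split => //; rewrite l2; by case: T.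
Qed.

Let th0P := Theta1_sub.
Let tge0 := tk_ge0 plantP gainP designP odeP L2P trigP idP th0P.
Let tlt := tk_lt plantP gainP designP odeP L2P trigP idP th0P.
Let tk0 : tk 0%N = 0. Proof. by case: trigP. Qed.
Let t1_gt0 : 0 < tk 1%N. Proof. by rewrite -tk0 tlt. Qed.
Let ep0 : 0 < eps p. Proof. by case: plantP. Qed.
Let bn0 : bcoef p != 0. Proof. by case: plantP. Qed.

(** If lambda was replaced, the old and the new parameter share a; were both zeros of [K2], they
    would share lambda as well by [K2_zero_unique]. *)
Lemma selection_rule : L2_zero (u ^~ 0) -> zeta 0 <> 0 -> K2 p h (that 0) <> 0.
Proof.
move=> u0 z0 K0; have [th [T [nd d]]] := initP.
have [deg|ndeg] := pselect [/\ L2_zero (u ^~ 0), zeta 0 <> 0 & K2 p h th = 0].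
  have [l0 _ la] := d deg; apply: l0; have [_ _ Kth] := deg.
  exact: (K2_zero_unique plantP gainP th0P T la K0 Kth).
by apply: (ndeg); split => //; rewrite -(nd ndeg).
Qed.

(* On the first inter-event interval the Cauchy data at [x = 0] cannot both
   vanish: otherwise the state is [0], and the input, which is then
   [K2 * zeta 0], must vanish too. *)
Lemma boundary_trace_nonzero : ~ (forall t, 0 < t < tk 1%N -> u 0 t = 0).
Proof.
move=> u0.
have [ut [ux [uxx [c1 _ H]]]] := pdeP.
have tE t : 0 < t < tk 1%N -> tk 0%N < t < tk 1%N by rewrite tk0.
have cut : {within [set z : R * R | 0 <= z.1 <= 1 /\ 0 < z.2 < tk 1%N], continuous (fun z => ut z.1 z.2)}.
  by apply: continuous_subspaceW c1 => z /= [z1 z2]; split=> //; exists 0%N; rewrite tk0.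
have d1' x t : 0 <= x <= 1 -> 0 < t < tk 1%N -> is_derive t (1 : R) (u x) (ut x t).
  by move=> x01 /tE /H[Hx _ _ _ _]; have [] := Hx x x01.
have d2' x t : 0 <= x <= 1 -> 0 < t < tk 1%N -> is_deriv_on `[0, 1] (u ^~ t) x (ux x t).
  by move=> x01 /tE /H[Hx _ _ _ _]; have [] := Hx x x01.
have d3' x t : 0 <= x <= 1 -> 0 < t < tk 1%N -> is_deriv_on `[0, 1] (ux ^~ t) x (uxx x t).
  by move=> x01 /tE /H[Hx _ _ _ _]; have [] := Hx x x01.
have d4' x t : 0 <= x <= 1 -> 0 < t < tk 1%N -> ut x t = eps p * uxx x t + lambda p * u x t.
  by move=> x01 /tE /H[_ _ /(_ x x01)].
have cuxx t : 0 < t < tk 1%N -> {within `[0, 1], continuous (uxx ^~ t)} by move=> /tE /H[].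
have ux0 t : 0 < t < tk 1%N -> ux 0 t = 0 by move=> /tE /H[].
have bc t : 0 < t < tk 1%N -> ux 1 t + qcoef p * u 1 t = Ud p h u zeta tk that 0 by move=> /tE /H[].
have la0 : 0 < lambda p.
  by have [_ _ [ll0 _ _ _] [/andP[+ _] _] _] := plantP; exact: lt_le_trans.
have uz := heat_unique_continuation ep0 cut d1' d2' d3' cuxx d4' la0 u0 ux0 bc.
pose s := tk 1%N / 2.
have t1p := t1_gt0.
have s01 : 0 < s < tk 1%N by rewrite /s; apply/andP; split; lra.
have [inL2 contL2] := L2P.
have uL2 := inL2 0 (lexx _).
(* The solution vanishes at small positive times, and continuity in L^2 at t = 0 passes this on to
   the initial state. *)
have zL2 : L2_zero (u ^~ 0).
  apply: L2norm0_zero => //; apply/eqP; rewrite eq_le sqrtr_ge0 andbT; apply/ler_addgt0Pl => e e0.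
  rewrite addr0; have /cvgrPdist_lt/(_ e e0) := contL2 0 (lexx _).
  rewrite near_withinE => /nbhs_ballP[d /= d0 Hd].
  pose t := Num.min (d / 2) s.
  have /andP[s0 s1] := s01.
  have t0 : 0 < t by rewrite lt_min divr_gt0.
  have tb : ball (0 : R) d t.
    by rewrite /ball/= sub0r normrN gtr0_norm// gt_min; apply/orP; left; lra.
  have := Hd t tb; rewrite in_itv/= andbT => /(_ (ltW t0)).
  rewrite sub0r normrN => /(le_lt_trans (ler_norm _)) /ltW.
  suff -> : L2norm (fun x => u x t - u x 0) = L2norm (u ^~ 0) by [].
  rewrite /L2norm; congr (Num.sqrt _); apply: eq_Rintegral => x.
  rewrite inE/= in_itv/= => x01; rewrite uz ?sub0r ?sqrrN// t0/=.
  by rewrite gt_min s1 orbT.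
have z0 : zeta 0 <> 0 by move=> z0; apply: nonzeroP.
(* Since [u ^~ s] vanishes on [0, 1], 0 is a derivative relative to [0, 1] at x = 1; it is the only
   one because 1 is a limit point of [0, 1]. *)
have ux1 : ux 1 s = 0.
  have PF : ProperFilter (within `[(0 : R), 1]%classic (1 : R)^').
    apply: Build_ProperFilter_ex => P; rewrite /dnbhs /within/= => /nbhs_ballP[d /= d0 Hd].
    pose r := Num.min (d / 2) 1.
    have r0 : 0 < r by rewrite lt_min divr_gt0//= ltr01.
    have r1 : r <= 1 by rewrite ge_min lexx orbT.
    have rd : r < d by rewrite gt_min; apply/orP; left; lra.
    exists (1 - r); apply: Hd.
    - by rewrite /ball/= opprB addrC subrK gtr0_norm.
    - by apply/eqP; lra.
    - by rewrite in_itv/=; apply/andP; split; lra.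
  have x11 : 0 <= (1 : R) <= 1 by rewrite ler01 lexx.
  apply: (is_deriv_on_unique PF (d2' 1 s x11 s01)).
  apply/cvgrPdist_lt => e e0; rewrite near_withinE near_withinE; apply/nbhs_ballP.
  exists 1 => //= x _ _; rewrite in_itv/= => xI.
  by rewrite !uz// subrr mul0r subrr normr0.
have := bc s s01; rewrite ux1 uz ?ler01 ?lexx// mulr0 addr0 => Ud0.
have [C C0 HC] := K1_bounded plantP gainP th0P.
have I0 : \int[mu]_(y in `[0, 1]) (K1 p h (that 0) y * u y 0) = 0.
  have iu := in_L2_integrable uL2; have iu' := integrable_rnorm iu.
  apply/eqP; rewrite -normr_le0.
  apply: (@le_trans _ _ (\int[mu]_(y in `[0, 1]) (C * `|u y 0|))).
    apply: Rintegral_dominated; first exact: integrable_rZ.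
    by move=> y y01; rewrite normrM ler_wpM2r// HC.
  by rewrite RintegralZl// L2_zero_L1// mulr0.
apply: (selection_rule zL2 z0).
move: Ud0; rewrite /Ud /feedback tk0 I0 add0r => /esym/eqP.
by rewrite mulf_eq0 => /orP[/eqP|/eqP].
Qed.

Lemma continuous_on_event (f : R -> R) t : {within `[0, tk 1%N], continuous f} ->
  0 < t < tk 1%N -> {for t, continuous f}.
Proof.
move=> cf /andP[t0 t1]; apply: (continuous_at_within _ cf).
exists (Num.min t (tk 1%N - t)); first by rewrite lt_min t0 subr_gt0.
move=> y; rewrite lt_min => /andP[]; rewrite ltr_norml => /andP[? _]; rewrite ltr_norml => /andP[_ ?].
by rewrite /= in_itv/=; apply/andP; split; lra.
Qed.

Lemma derive_eq0_on_event (f : R -> R) (l t : R) : 0 < t < tk 1%N ->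
  (forall s, 0 < s < tk 1%N -> f s = 0) -> is_derive t (1 : R) f l -> l = 0.
Proof.
move=> /andP[t0 t1] f0 [_ <-].
have [_ ->//] : is_derive t (1 : R) f 0.
apply: (near_eq_is_derive (f := cst 0)).
near=> s; rewrite f0//; apply/andP; split; near: s; [exact: lt_nbhsr|exact: lt_nbhsl].
Unshelve. all: by end_near. Qed.

(** The difference (x, y) of l and the true parameter is in the kernel of the Gram matrix [G_],
    whose quadratic form is the integral of (x g1 + y g2)^2. Hence x g1 + y g2 vanishes on the first
    interval, and its derivative in t is the stated relation. *)
Lemma feasible_first_relation l n : feasible p u zeta tk 0 l -> (0 < n)%N ->
  forall t, 0 < t < tk 1%N ->
  (th_lambda l - lambda p) * sin_coef u n t =
  (th_a l - acoef p) * (eps p * pi * n%:R / bcoef p * zeta t).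
Proof.
move=> [_ /(_ n) +] n0; move=> /(_ n0).
rewrite (Z_eq plantP gainP designP odeP L2P pdeP trigP idP th0P) => ZE.
set x := th_lambda l - _; set y := th_a l - _; set w := eps p * pi * n%:R / bcoef p.
(* The first window starts at 0 and is exactly the first inter-event interval. *)
have mu0 : mu_next p tk 0 = 0.
  have /andP[h1 h2] := mu_next_bounds plantP gainP designP odeP L2P trigP idP th0P 0.
  by apply/le_anti; rewrite h1 andbT -[leRHS]tk0.
have cs : {within `[0, tk 1%N], continuous (sin_coef u n)} by exact: sin_coef_continuous.
have cz : {within `[0, tk 1%N], continuous zeta} by exact: (zeta_continuous odeP (ltW t1_gt0)).
have is_ := integrable_itv cs; have iz := integrable_itv cz.
pose g1 t := g1_ u n t 0; pose g2 t := g2_ p zeta n t 0.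
have cg1 : {within `[0, tk 1%N], continuous g1}.
  exact: (parameterized_integral_continuous (ltW t1_gt0) is_).
have cg2 : {within `[0, tk 1%N], continuous g2}.
  apply: within_continuousM; first exact: within_continuous_cst.
  exact: (parameterized_integral_continuous (ltW t1_gt0) iz).
have sq0 : \int[mu]_(t in `[0, tk 1%N]) ((x * g1 t + y * g2 t) ^+ 2) = 0.
  pose I (F G : R -> R) := \int[mu]_(t in `[0, tk 1%N]) (F t * G t).
  have iFG (F G : R -> R) : {within `[0, tk 1%N], continuous F} -> {within `[0, tk 1%N], continuous G} ->
      mu.-integrable `[0, tk 1%N] (EFin \o (fun t => F t * G t)).
    by move=> cF cG; apply: integrable_itv; exact: within_continuousM.
  have i11 := iFG _ _ cg1 cg1; have i12 := iFG _ _ cg1 cg2; have i22 := iFG _ _ cg2 cg2.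
  have -> : \int[mu]_(t in `[0, tk 1%N]) ((x * g1 t + y * g2 t) ^+ 2) =
      x ^+ 2 * I g1 g1 + (2 * x * y * I g1 g2 + y ^+ 2 * I g2 g2).
    rewrite /I -!RintegralZl// -!RintegralD//.
    - by apply: eq_Rintegral => t _; ring.
    - exact: integrable_rZ.
    - by apply: integrable_rD; exact: integrable_rZ.
    - exact: integrable_rZ.
    - exact: integrable_rZ.
  have E0 := congr1 (fun M : 'cV[R]_2 => M 0 0) ZE.
  have E1 := congr1 (fun M : 'cV[R]_2 => M 1 0) ZE.
  move: E0 E1; rewrite !mxE !big_ord_recl !big_ord0 !addr0 !mxE /= /window_int mu0.
  rewrite -/(I g1 g1) -/(I g1 g2) -/(I g2 g2).
  have -> : lift ord0 ord0 = 1 :> 'I_2 by apply/val_inj.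
  rewrite -/(th_lambda l) -/(th_a l).
  move: (I g1 g1) (I g1 g2) (I g2 g2) => q1 q2 q3 E0 E1.
  have F0 : q1 * x + q2 * y = 0 by rewrite /x /y !mulrBr; lra.
  have F1 : q2 * x + q3 * y = 0 by rewrite /x /y !mulrBr; lra.
  have -> : x ^+ 2 * q1 + (2 * x * y * q2 + y ^+ 2 * q3) = x * (q1 * x + q2 * y) + y * (q2 * x + q3 * y) by ring.
  by rewrite F0 F1 !mulr0 addr0.
have lin0 t : 0 < t < tk 1%N -> x * g1 t + y * g2 t = 0.
  move=> t01; apply/eqP; rewrite -sqrf_eq0; apply/eqP.
  apply: (@ge0_continuous_Rintegral_eq0 R 0 (tk 1%N) (fun t => (x * g1 t + y * g2 t) ^+ 2)) => //.
  - have cl : {within `[0, tk 1%N], continuous (fun t => x * g1 t + y * g2 t)}.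
      by apply: within_continuousD; apply: within_continuousM => //; exact: within_continuous_cst.
    exact: (within_continuousM cl cl).
  - by move=> t' _; exact: sqr_ge0.
move=> t t01.
have h1 := is_derive_Rintegral t01 is_ (continuous_on_event cs t01).
have h2 := is_derive_Rintegral t01 iz (continuous_on_event cz t01).
have hl := is_derive_rD (is_derive_rZ x h1) (is_derive_rZ y (is_derive_rZ (- w) h2)).
have := derive_eq0_on_event t01 lin0 hl.
by rewrite mulNr mulrN => /eqP; rewrite subr_eq0 => /eqP.
Qed.

Lemma feasible_first_unique l : feasible p u zeta tk 0 l -> l = true_theta p.
Proof.
move=> fl; have rel := feasible_first_relation fl.
have tE t : 0 < t < tk 1%N -> tk 0%N < t < tk 1%N by rewrite tk0.
have sd (n : nat) t (t01 : 0 < t < tk 1%N) := sin_coef_derive pdeP n (tE t t01).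
have la : th_a l = acoef p.
  apply/eqP; rewrite -subr_eq0; apply/negPn/negP => y0; apply: boundary_trace_nonzero.
  have z0 t : 0 < t < tk 1%N -> zeta t = 0.
    move=> t01; have t0 : 0 <= t by case/andP: t01 => /ltW.
    apply/eqP; apply/negPn/negP => zn0.
    (* The L^1 norm of [u ^~ t] bounds all sine coefficients, so the left side of [rel] is at most
       [Q] in modulus, whereas the right side is n v; n is chosen with n v > Q. *)
    pose Q := `|th_lambda l - lambda p| * \int[mu]_(x in `[0, 1]) `|u x t|.
    pose v := `|(th_a l - acoef p) * (eps p * pi / bcoef p * zeta t)|.
    have v0 : 0 < v.
      have w0 : eps p * pi / bcoef p != 0.
        by rewrite mulf_neq0 ?invr_eq0// mulf_neq0 ?gt_eqF ?pi_gt0.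
      by rewrite normr_gt0 mulf_neq0// mulf_neq0.
    have Q0 : 0 <= Q by rewrite mulr_ge0//; exact: Rintegral_ge0.
    pose n := (Num.bound (Q / v)).+1.
    have : Q / v < n%:R.
      by apply: (lt_trans (archi_boundP (divr_ge0 Q0 (ltW v0)))); rewrite ltr_nat.
    rewrite ltr_pdivrMr// ltNge => /negP; apply.
    have := rel n isT t t01 => E.
    have -> : n%:R * v = `|(th_a l - acoef p) * (eps p * pi * n%:R / bcoef p * zeta t)|.
      have -> : (th_a l - acoef p) * (eps p * pi * n%:R / bcoef p * zeta t) =
        n%:R * ((th_a l - acoef p) * (eps p * pi / bcoef p * zeta t)) by ring.
      by rewrite normrM (ger0_norm (ler0n _ _)).
    by rewrite -E normrM ler_wpM2l// (sin_coef_bound L2P).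
  move=> t t01.
  have := derive_eq0_on_event t01 z0 (zeta_derive plantP gainP designP odeP L2P pdeP trigP idP th0P (tE t t01)).
  by rewrite z0// mulr0 add0r => /eqP; rewrite mulf_eq0 (negbTE bn0)/= => /eqP.
have ll : th_lambda l = lambda p.
  apply/eqP; rewrite -subr_eq0; apply/negPn/negP => x0; apply: boundary_trace_nonzero.
  have s0 n t : (0 < n)%N -> 0 < t < tk 1%N -> sin_coef u n t = 0.
    move=> n0 t01; apply/eqP; have := rel n n0 t t01.
    by rewrite la subrr mul0r => /eqP; rewrite mulf_eq0 (negbTE x0).
  move=> t t01.
  (* The sign (- 1)^n differs for n = 1 and n = 2, so adding the two identities removes u(1, t). *)
  have E n : (0 < n)%N -> u 0 t - (-1) ^+ n * u 1 t = 0.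
    move=> n0; have := derive_eq0_on_event t01 (fun s => s0 n s n0) (sd n t t01).
    rewrite /sin_rate s0// mulr0 addr0 => /eqP; rewrite mulf_eq0 => /orP[|/eqP //].
    by rewrite !mulf_eq0 !gt_eqF ?pi_gt0 ?ltr0n.
  by have := E 1%N isT; have := E 2%N isT; rewrite expr1 sqrrN expr1n mulN1r mul1r; lra.
apply/colP => j; rewrite mxE; case: j => -[|[|//]] jlt /=.
- by rewrite -ll /th_lambda; congr (l _ _); exact/val_inj.
- by rewrite -la /th_a; congr (l _ _); exact/val_inj.
Qed.

Lemma estimates_exact i : that (tk i.+1) = true_theta p.
Proof.
have [_ upd] := idP.
elim: i => [|i IH]; first by apply: feasible_first_unique; have [] := upd 0%N.
have [_ /(_ (true_theta p))] := upd i.+1.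
move=> /(_ (true_theta_feasible plantP gainP designP odeP L2P pdeP trigP idP th0P i.+1)).
rewrite IH /sqdist.
rewrite [X in _ <= X]big1; last by move=> j _; rewrite subrr expr0n.
move=> le0; apply/colP => j.
have sum0 : \sum_(j < 2) (that (tk i.+2) j 0 - true_theta p j 0) ^+ 2 = 0.
  by apply/eqP; rewrite eq_le le0 sumr_ge0// => k _; exact: sqr_ge0.
have /(_ j isT)/eqP := psumr_eq0P (fun k _ => sqr_ge0 _) sum0.
by rewrite sqrf_eq0 subr_eq0 => /eqP.
Qed.

(** Divergence of the triggering times gives a least index with t < tk k, which places t in one
    holding interval. The interval before [tk 1], where the initial guess is held, is excluded by tk
    2 <= t. *)
Lemma estimate_exact t : tk 2%N <= t -> that t = true_theta p.
Proof.
move=> t2.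
have ex : exists i, t < tk i.
  apply: (triggers_diverge plantP gainP designP odeP L2P trigP idP th0P (th := true_theta p) (i0 := 1%N)).
  by case=> // i _; exact: estimates_exact.
have [k tk_ kmin] := ex_minnP ex.
case: k tk_ kmin => [|k] tk_ kmin.
  by move: tk_; rewrite tk0 ltNge (le_trans (tge0 2%N) t2).
have kt : tk k <= t by rewrite leNgt; apply/negP => /kmin; rewrite ltnn.
have [hold _] := idP; rewrite (hold k t) ?kt ?tk_//.
case: k kt tk_ kmin => [|k] kt tk_ kmin; last exact: estimates_exact.
have : tk 1%N < tk 1%N by rewrite (lt_trans (tlt 1%N))// (le_lt_trans t2).
by rewrite ltxx.
Qed.

End identification.

Theorem lemma7 (R : realType) (p : sysdata R) (h : 'cV[R]_2 -> R -> R -> R)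
    (u : R -> R -> R) (zeta m : R -> R) (tk : nat -> R)
    (that : R -> 'cV[R]_2)
    (plantP : plant_assumptions p)
    (gainP : gain_assumptions p h)
    (designP : design_conditions p h)
    (loopP : closed_loop p h u zeta m tk that)
    (initP : Theta1 p h u zeta (that 0))
    (nonzeroP : ~ (L2_zero (u ^~ 0) /\ zeta 0 = 0)) :
  forall t : R, tk 2%N <= t ->
    th_lambda (that t) = lambda p /\ th_a (that t) = acoef p.
Proof.
have [odeP L2P pdeP trigP idP] := loopP.
move=> t t2.
rewrite (estimate_exact plantP gainP designP odeP L2P pdeP trigP idP initP nonzeroP t2).
by rewrite /th_lambda /th_a !mxE.
Qed.
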